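(* There exist sequences $(u_m)_{m\ge0}$ with $u_m\in C^\infty(B_2)$ and $(A_m)_{m\ge0}$ with $A_m\in C^\infty(B_2;\mathcal S^3)$ satisfying all of the following: (1) for every $m$, $I\le A_m\le 2^{81}I$ in $B_2$ and $A_m:D^2u_m=0$ in $B_2$; all $u_m$ have the same Dirichlet data $1-x_1^2/2$ on $\partial B_2$; $\|u_m\|_{L^\infty(B_2)}\le1$ for every $m$; $\lim_{m\to\infty}\|Du_m\|_{L^1(B_1)}=\infty$; and all $u_m$ agree with one fixed quadratic polynomial (independent of $m$) on $B_2\setminus Q_0$, where $Q_0=\left(-\tfrac12,\tfrac12\right)^3\Subset B_1$; (2) there are a function $u$ on $B_2$ and a measurable $A:B_2\to\mathcal S^3$ such that $$u_m\longrightarrow u\ \text{ uniformly in }B_2,\qquad A_m\longrightarrow A\ \text{ in }L^1(B_2),$$ $$I\le A\le 2^{81}I\ \text{ a.e. in }B_2,\qquad u\notin BV_{\rm loc}(B_1).$$ In particular, $u$ is an $L^1$-approximation solution of $A(x):D^2u=0$ in $B_2$.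
   Context: $B_r$ is the open ball of radius $r$ centered at the origin in $\mathbb R^3$. $\mathcal S^3$ is the space of real symmetric $3\times3$ matrices, $I$ is the identity matrix, and matrix inequalities are in the sense of quadratic forms. For $A,B\in\mathcal S^3$, $A:B=\operatorname{tr}(AB)$. $Du$ and $D^2u$ denote the gradient and the Hessian of $u$. Having Dirichlet data $\varphi$ on $\partial B_2$ means that the function extends continuously to $\overline{B_2}$ with boundary values $\varphi$. $BV_{\rm loc}(B_1)$ is the space of functions locally of bounded variation in $B_1$. Definition: $u$ is an $L^1$-approximation solution of $A(x):D^2u=0$ in $B_2$ if there are smooth coefficient matrices $A_m$ with a common ellipticity bound and classical solutions $u_m$ of $A_m(x):D^2u_m=0$ such that $u_m\to u$ uniformly and $A_m\to A$ in $L^1$. *)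

(* Defs.v *)
From HB Require Import structures.
From mathcomp Require Import all_boot all_order all_algebra.
From mathcomp Require Import all_classical all_reals all_analysis.

Set Implicit Arguments.
Unset Strict Implicit.
Unset Printing Implicit Defensive.

Import Order.TTheory GRing.Theory Num.Theory.
Import numFieldNormedType.Exports.

Local Open Scope classical_set_scope.
Local Open Scope ring_scope.

(* The points of R^n are the row vectors 'rV[R]_n.  The library's norm `|x| on
   'rV[R]_n is the max norm, and [ball] refers to it; hence the Euclidean
   versions below.  Functions "on U" are total functions, constrained on U
   only. *)

Definition enorm (R : realType) n (x : 'rV[R]_n) : R :=
  Num.sqrt (\sum_i x ord0 i ^+ 2).

Definition eball (R : realType) n (r : R) : set 'rV[R]_n :=
  [set x | enorm x < r].

Definition compactly_contained (T : topologicalType) (V U : set T) : Prop :=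
  compact (closure V) /\ closure V `<=` U.

Definition partial (R : realType) n (V : normedModType R) (i : 'I_n)
    (f : 'rV[R]_n -> V) : 'rV[R]_n -> V :=
  fun x => 'D_(delta_mx ord0 i) f x.

(* [iter_partial [:: i1; ...; ik] f] is d_i1 ... d_ik f *)
Definition iter_partial (R : realType) n (V : normedModType R)
    (s : seq 'I_n) (f : 'rV[R]_n -> V) : 'rV[R]_n -> V :=
  foldr (@partial R n V) f s.

(* All partial derivatives up to order k exist and are continuous at every
   point of U; U is meant to be open.  The existence has to be asked for, since
   'D_v is a total operator. *)
Definition class_C (R : realType) n (V : normedModType R) (k : nat)
    (U : set 'rV[R]_n) (f : 'rV[R]_n -> V) : Prop :=
  forall s : seq 'I_n, (size s <= k)%N -> forall x, U x ->
    {for x, continuous (iter_partial s f)} /\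
    ((size s < k)%N ->
       forall i : 'I_n, derivable (iter_partial s f) x (delta_mx ord0 i)).

Definition smooth_on (R : realType) n (V : normedModType R)
    (U : set 'rV[R]_n) (f : 'rV[R]_n -> V) : Prop :=
  forall k, class_C k U f.

Definition gradient (R : realType) n (u : 'rV[R]_n -> R) (x : 'rV[R]_n) :
    'rV[R]_n :=
  \row_i partial i u x.

Definition hessian (R : realType) n (u : 'rV[R]_n -> R) (x : 'rV[R]_n) :
    'M[R]_n :=
  \matrix_(i, j) partial i (partial j u) x.

Definition divergence (R : realType) n (phi : 'rV[R]_n -> 'rV[R]_n)
    (x : 'rV[R]_n) : R :=
  \sum_i partial i (fun y => phi y ord0 i) x.

Definition symmetric_mx (R : realType) n (A : 'M[R]_n) : Prop := A^T = A.

Definition mxdot (R : realType) n (A B : 'M[R]_n) : R := \tr (A *m B).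

Definition quadratic_form (R : realType) n (A : 'M[R]_n) (v : 'rV[R]_n) : R :=
  (v *m A *m v^T) ord0 ord0.

Definition mx_le (R : realType) n (A B : 'M[R]_n) : Prop :=
  forall v, quadratic_form A v <= quadratic_form B v.

Definition quadratic_polynomial (R : realType) n (P : 'rV[R]_n -> R) : Prop :=
  exists (M : 'M[R]_n) (b : 'rV[R]_n) (c : R),
    [/\ symmetric_mx M, M != 0 &
      forall x, P x = quadratic_form M x + (b *m x^T) ord0 ord0 + c].

Definition has_dirichlet_data (R : realType) n (U : set 'rV[R]_n)
    (phi u : 'rV[R]_n -> R) : Prop :=
  exists v : 'rV[R]_n -> R,
    [/\ {within closure U, continuous v},
        (forall x, U x -> v x = u x) &
        (forall x, (closure U `\` U) x -> v x = phi x)].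

(* The Borel sigma-algebra on matrices, generated by the entries, in the same
   way as the library does for tuples. *)

Definition mx_display : measure_display -> measure_display.
Proof. exact. Qed.

Section measurable_matrix.
Variables (R : realType) (m n : nat).

Definition mx_measurable : set (set 'M[R]_(m, n)) :=
  <<s \bigcup_(ij in [set: 'I_m * 'I_n])
        preimage_set_system setT (fun A : 'M[R]_(m, n) => A ij.1 ij.2)
          measurable >>.

Let mx_measurable0 : mx_measurable set0.
Proof. exact: sigma_algebra0. Qed.

Let mx_measurableC A : mx_measurable A -> mx_measurable (~` A).
Proof. exact: sigma_algebraC. Qed.

Let mx_measurable_bigcup (F : (set 'M[R]_(m, n))^nat) :
  (forall i, mx_measurable (F i)) -> mx_measurable (\bigcup_i F i).
Proof. exact: sigma_algebra_bigcup. Qed.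

HB.instance Definition _ :=
  @isMeasurable.Build (mx_display default_measure_display) 'M[R]_(m, n)
    mx_measurable mx_measurable0 mx_measurableC mx_measurable_bigcup.

Lemma measurable_fun_mxP d (T : measurableType d) (D : set T)
    (f : T -> 'M[R]_(m, n)) : measurable D ->
  measurable_fun D f <-> forall i j, measurable_fun D (fun x => f x i j).
Proof.
move=> mD; split=> [mf i j|mf].
  move=> _ Y mY.
  have /(mf mD) : measurable ((fun A : 'M[R]_(m, n) => A i j) @^-1` Y).
    apply: sub_sigma_algebra; exists (i, j) => //.
    by exists Y => //; rewrite setTI.
  by [].
apply: (@measurability _ _ _ _ D f _ erefl).
move=> _ [_ [[i j] _ [Y mY <-]] <-].
by rewrite setTI; exact: mf.
Qed.

End measurable_matrix.

(* Lebesgue measure on R^3: the product measure on R * R * R, transported to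
   'rV[R]_3. *)

Definition row3 (R : realType)
    (p : measurableTypeR R * measurableTypeR R * measurableTypeR R) :
    'rV[R]_3 :=
  \row_i tnth [tuple p.1.1 : R; p.1.2 : R; p.2 : R] i.

Lemma measurable_row3 (R : realType) : measurable_fun setT (@row3 R).
Proof.
apply/measurable_fun_mxP => // i j.
have [E|[E|E]] : j = 0%N :> nat \/ j = 1%N :> nat \/ j = 2%N :> nat.
  by case: j => -[|[|[|]]] //=; auto.
- rewrite (_ : (fun x => _) = fst \o fst); last first.
    by apply/funext => x; rewrite mxE (tnth_nth 0) E.
  exact: measurableT_comp.
- rewrite (_ : (fun x => _) = snd \o fst); last first.
    by apply/funext => x; rewrite mxE (tnth_nth 0) E.
  exact: measurableT_comp.
- rewrite (_ : (fun x => _) = snd)//.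
  by apply/funext => x; rewrite mxE (tnth_nth 0) E.
Qed.

Definition lebesgue3 (R : realType) : set 'rV[R]_3 -> \bar R :=
  pushforward
    ((@lebesgue_measure R \x @lebesgue_measure R) \x @lebesgue_measure R)%E
    (@row3 R).
Arguments lebesgue3 {R}.

Section lebesgue3_measure.
Local Open Scope ereal_scope.
Variable R : realType.

Let mf := @measurable_row3 R.

Let mu : {measure set _ -> \bar R} :=
  (@lebesgue_measure R \x @lebesgue_measure R) \x @lebesgue_measure R.

Let pushforward0 : @lebesgue3 R set0 = 0.
Proof. by rewrite /lebesgue3 /pushforward preimage_set0 (measure0 mu). Qed.

Let pushforward_ge0 A : 0 <= @lebesgue3 R A.
Proof. exact: (measure_ge0 mu). Qed.

Let pushforward_sigma_additive : semi_sigma_additive (@lebesgue3 R).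
Proof. by move: mf => ?; exact: measure_semi_sigma_additive. Qed.

HB.instance Definition _ := isMeasure.Build _ _ _ (@lebesgue3 R)
  pushforward0 pushforward_ge0 pushforward_sigma_additive.

End lebesgue3_measure.

Definition Lpnorm (R : realType) (U : set 'rV[R]_3) (p : \bar R)
    (f : 'rV[R]_3 -> R) : \bar R :=
  ('N[lebesgue3]_p [(EFin \o f) \_ U])%E.

(* Any norm on the finite-dimensional space of matrices gives the same
   convergence; `|_| is the library's max norm of the entries. *)
Definition cvg_L1 (R : realType) n (U : set 'rV[R]_3)
    (A_ : nat -> 'rV[R]_3 -> 'M[R]_n) (A : 'rV[R]_3 -> 'M[R]_n) : Prop :=
  Lpnorm U 1 (fun x => `|A_ m x - A x|) @[m --> \oo] --> 0%E.

Definition test_field (R : realType) (V : set 'rV[R]_3)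
    (phi : 'rV[R]_3 -> 'rV[R]_3) : Prop :=
  [/\ class_C 1 setT phi,
      compactly_contained [set x | phi x != 0] V &
      forall x, enorm (phi x) <= 1].

Definition variation (R : realType) (V : set 'rV[R]_3) (u : 'rV[R]_3 -> R) :
    \bar R :=
  ereal_sup [set (\int[lebesgue3]_(x in V) (u x * divergence phi x)%:E)%E
            | phi in test_field V].

Definition BV (R : realType) (V : set 'rV[R]_3) (u : 'rV[R]_3 -> R) : Prop :=
  lebesgue3.-integrable V (EFin \o u) /\ (variation V u < +oo)%E.

Definition BV_loc (R : realType) (U : set 'rV[R]_3) (u : 'rV[R]_3 -> R) :
    Prop :=
  forall V, open V -> compactly_contained V U -> BV V u.

Definition symmetric_on (R : realType) (U : set 'rV[R]_3)
    (A : 'rV[R]_3 -> 'M[R]_3) : Prop :=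
  forall x, U x -> symmetric_mx (A x).

Definition elliptic_on (R : realType) (U : set 'rV[R]_3) (lam Lam : R)
    (A : 'rV[R]_3 -> 'M[R]_3) : Prop :=
  forall x, U x -> mx_le lam%:M (A x) /\ mx_le (A x) Lam%:M.

Definition solves_on (R : realType) (U : set 'rV[R]_3)
    (A : 'rV[R]_3 -> 'M[R]_3) (u : 'rV[R]_3 -> R) : Prop :=
  forall x, U x -> mxdot (A x) (hessian u x) = 0.

Definition L1_approximation_solution (R : realType) (U : set 'rV[R]_3)
    (A : 'rV[R]_3 -> 'M[R]_3) (u : 'rV[R]_3 -> R) : Prop :=
  exists (A_ : nat -> 'rV[R]_3 -> 'M[R]_3) (u_ : nat -> 'rV[R]_3 -> R)
      (lam Lam : R),
    [/\ 0 < lam,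
        (forall m, [/\ smooth_on U (A_ m), symmetric_on U (A_ m) &
                      elliptic_on U lam Lam (A_ m)]),
        (forall m, class_C 2 U (u_ m) /\ solves_on U (A_ m) (u_ m)),
        {uniform U, u_ @ \oo --> u} &
        measurable_fun U A /\ cvg_L1 U A_ A].

Definition Q0 (R : realType) : set 'rV[R]_3 :=
  [set x | forall i, - 2^-1 < x ord0 i < 2^-1].

(* Main.v *)
Require Import Defs.
From HB Require Import structures.
From mathcomp Require Import all_boot all_order all_algebra.
From mathcomp Require Import all_classical all_reals all_analysis.
From mathcomp Require Import measurable_realfun ess_sup_inf hoelder ring lra.

(** The coefficients are read off from the solutions.  If the pure second
    derivatives H_0, H_1, H_2 of a smooth function (coordinates are numbered
    from 0) contain a positive and a negative entry, each at least 2^-78 times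
    the sum of the |H_i|, then some diagonal matrix between I and 2^81 I is
    orthogonal to the Hessian, and it can be chosen as a smooth function of
    the H_i: [coef], [coef_dot], [coef_bnd], [class_C_coef].  It remains to find
    functions with this indefiniteness that oscillate too much.

    Put k = 1/256 and N = 2^37.  The quadratic polynomial [base] has the
    Hessian diag (- k^2 s, e, k s) with e = k s.  A cycle adds three layers to it.
    Each layer is a product of a profile psi in one variable, made of N/4 tiny
    parabolas of width 1/N side by side, and of cut-offs in the two other
    variables; on the core of the parabolas it adds a constant to one diagonal
    entry.  The layers run along x_1, x_2 and x_0 in turn, and each of them
    overwhelms what was there before, whereas the errors made by its cut-offs
    are too small to matter.  The amplitudes are such that where all three
    parabolas are at their cores, the Hessian is again of the initial form,
    multiplied by N^2 and with (s, e) replaced by (- k^3 s, k^3 s).  So the next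
    cycle can be inserted in these small cubes, and indefiniteness follows by
    induction on the number of cycles: [first_cycle_indef], [corr_indef].

    The j-th cycle has height about k^(3j), so the functions converge uniformly
    and stay between -1 and 1.  But its slope in the direction x_1 is
    about (k^3 N)^j = 2^(13 j), on a set whose volume is about 4^(-3 j): the
    total variation grows like 2^(7 j).  This is made rigorous by duality.  The
    derivative in x_1 of [test_fun j] vanishes on all layers of the cycles after
    the j-th one and on two of the three layers of the j-th one, hence the
    integral of [approx_sol m] against it does not depend on m > j
    ([approx_test], [limit_test]).  The surviving layer contributes at least
    20 s 2^(13 j) 4^(-3 j - 1); the polynomial and the earlier cycles,
    integrated by parts, at most half of that ([layer_part_lb],
    [smooth_part_bnd]).  Therefore the integral is at least j in absolute value
    ([resonant_integral]), and it bounds from below both the variation of the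
    limit and the gradients.

    The matrices at a point x stop changing as soon as x_1 leaves the cores of
    the parabolas of some generation.  The points of the ball where this has
    not happened after m cycles have a measure of order 4^-m, whence the
    convergence of the coefficients in L^1 ([coef_cvg_L1]). *)

Set Implicit Arguments.
Unset Strict Implicit.
Unset Printing Implicit Defensive.

Import Order.TTheory GRing.Theory Num.Theory.
Import numFieldNormedType.Exports.

Local Open Scope classical_set_scope.
Local Open Scope ring_scope.

(** * Derivatives along directions, and flat functions *)

(** A function together with all its derivatives, [f p] being the p-th one.
    Smooth functions of one variable are handled in this form, so that the
    derivatives needed for bounds and supports are explicit. *)
Definition is_tower (R : realType) (f : nat -> R -> R) :=
  forall (p : nat) (x : R), is_derive x 1 (f p) (f p.+1 x).

Section derive_rules.
Variables (R : realType) (V : normedModType R).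
Implicit Types (f g : V -> R) (x v : V) (a b c : R).

Lemma is_derive_add f g x v a b : is_derive x v f a -> is_derive x v g b ->
  is_derive x v (fun y => f y + g y) (a + b).
Proof. exact: is_deriveD. Qed.

Lemma is_derive_mul f g x v a b : is_derive x v f a -> is_derive x v g b ->
  is_derive x v (fun y => f y * g y) (a * g x + f x * b).
Proof.
move=> fa gb; refine (is_derive_eq (is_deriveM fa gb) _).
by rewrite addrC; congr (_ + _); rewrite -[_ *: _]/(_ * _) mulrC.
Qed.

Lemma is_derive_cmul f x v a c : is_derive x v f a ->
  is_derive x v (fun y => c * f y) (c * a).
Proof. exact: is_deriveZ. Qed.

Lemma is_derive_const x v c : is_derive x v (fun=> c) (0 : R).
Proof. exact: is_derive_cst. Qed.

Lemma is_derive_bigsum n (f : 'I_n -> V -> R) (a : 'I_n -> R) x v :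
  (forall i, is_derive x v (f i) (a i)) ->
  is_derive x v (fun y => \sum_(i < n) f i y) (\sum_(i < n) a i).
Proof.
move=> fa.
have -> : (fun y => \sum_(i < n) f i y) = \sum_(i < n) f i.
  by apply/funext => y; rewrite fct_sumE.
exact: is_derive_sum.
Qed.

(** The derivative along v at x is the derivative at 0 of the restriction to
    the line h |-> x + h v, where the chain rule in one variable applies. *)
Lemma is_derive_chain f (g : R -> R) x v a b : is_derive x v f a ->
  is_derive (f x) 1 g b -> is_derive x v (fun y => g (f y)) (b * a).
Proof.
move=> fa gb.
have h1 : is_derive (0 : R) 1 (fun h : R => f (h *: v + x)) a.
  case: fa => fd fe; split; first exact: (derivable1P f x v).1.
  rewrite -fe /derive; set g1 := fun h => h^-1 *: _.
  set g2 := fun h => h^-1 *: _; suff -> : g1 = g2 by [].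
  by apply/funext => h; rewrite /g1 /g2 /= addr0 scale0r add0r [_%:A]mulr1.
have h2 : is_derive (0 : R) 1 (fun h : R => g (f (h *: v + x))) (b * a).
  refine (is_derive1_comp (f := g) _ h1).
  by rewrite /= scale0r add0r.
case: h2 => gd ge; split.
  exact: (derivable1P (fun y => g (f y)) x v).2.
rewrite -ge /derive; set g1 := fun h => h^-1 *: _.
set g2 := fun h => h^-1 *: _; suff -> : g1 = g2 by [].
by apply/funext => h; rewrite /g1 /g2 /= addr0 scale0r add0r [_%:A]mulr1.
Qed.

End derive_rules.

Section flat.
Variable R : realType.
Variable a : R.
Hypothesis a0 : 0 < a.

(** The functions q(1/x) exp (- a/x), extended by 0 to the negative half
    line. The family is closed under differentiation, by [flat_next]. *)
Definition flat (q : {poly R}) (x : R) : R :=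
  if 0 < x then q.[x^-1] * expR (- (a * x^-1)) else 0.

Definition flat_next (q : {poly R}) : {poly R} := 'X^2 * (a *: q - q^`()).

Lemma exprn_le_expR n (y : R) : 0 <= y -> y ^+ n <= n`!%:R * expR y.
Proof.
case: n => [|n] y0; first by rewrite expr0 fact0 mul1r -expR0 ler_expR.
rewrite mulrC -ler_pdivrMr ?ltr0n ?fact_gt0//.
by apply: le_trans (expR_ge1Dxn n y0); rewrite lerDr.
Qed.

Lemma horner_le_expR (q : {poly R}) :
  exists2 C, 0 <= C & forall y, 0 < y -> `|q.[y]| <= C * expR (a * y).
Proof.
exists (\sum_(i < size q) `|q`_i| * (i`!%:R / a ^+ i)).
  apply: sumr_ge0 => i _; rewrite mulr_ge0// divr_ge0// exprn_ge0//.
  exact: ltW.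
move=> y y0; rewrite horner_coef (le_trans (ler_norm_sum _ _ _))//.
rewrite mulr_suml; apply: ler_sum => i _.
rewrite normrM normrX -mulrA ler_wpM2l// (gtr0_norm y0) mulrAC.
rewrite ler_pdivlMr ?exprn_gt0// -exprMn [y * a]mulrC.
by apply: exprn_le_expR; rewrite mulr_ge0// ltW.
Qed.

(** Applied to the polynomial 'X * q, whose flat function is [flat q x / x],
    this says that the difference quotient of [flat q] at 0 tends to 0. *)
Lemma flat_le_lin (q : {poly R}) :
  exists2 C, 0 <= C & forall x, `|flat q x| <= C * `|x|.
Proof.
have [C C0 CP] := horner_le_expR ('X * q).
exists C => // x; rewrite /flat; case: ifPn => x0; last first.
  by rewrite normr0 mulr_ge0.
have xV0 : 0 < x^-1 by rewrite invr_gt0.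
have := CP _ xV0; rewrite hornerM hornerX normrM (gtr0_norm xV0) => h.
rewrite normrM (gtr0_norm (expR_gt0 _)) (gtr0_norm x0) expRN.
rewrite ler_pdivrMr ?expR_gt0// mulrAC -ler_pdivrMr// mulrC.
exact: h.
Qed.

Lemma is_derive_flat (q : {poly R}) (x : R) :
  is_derive x 1 (flat q) (flat (flat_next q) x).
Proof.
have [x0|x0|->] := ltgtP x 0.
- rewrite {2}/flat ltNge (ltW x0)/=.
  apply: (@near_eq_is_derive _ _ _ (cst 0)).
  by near=> y; rewrite /flat ltNge ltW//; near: y; exact: lt_nbhsl.
- pose g (y : R) : R := q.[y^-1] * expR (- (a * y^-1)).
  refine (near_eq_is_derive (f := g) _ _).
    by near=> y; rewrite /flat ifT//; near: y; exact: lt_nbhsr.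
  have x0' : x != 0 by rewrite gt_eqF.
  have iv : is_derive x 1 (fun y : R => y^-1) (- x ^- 2).
    refine (is_derive_eq (@is_deriveV R id x 1 1 x0' (is_derive_id _ _)) _).
    exact: mulr1.
  have d1 : is_derive x 1 (fun y : R => q.[y^-1]) ((q^`()).[x^-1] * - x ^- 2).
    exact: (is_derive_chain iv).
  have d3 := is_derive_chain (is_derive_cmul (- a) iv) (is_derive_expR _).
  have d4 := is_derive_mul d1 d3.
  have <- : (fun y => q.[y^-1] * expR (- a * y^-1)) = g.
    by apply/funext => y; rewrite /g mulNr.
  refine (is_derive_eq d4 _); rewrite /flat x0 /flat_next !hornerE /= -!exprVn mulNr.
  ring.
- rewrite {2}/flat ltxx.
  have [C C0 CP] := flat_le_lin ('X * q).
  have h : (fun h : R => h^-1 *: ((flat q \o shift 0) (h *: 1) - flat q 0))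
             @ 0^' --> (0 : R).
    apply/cvgrPdist_le => e e0.
    near=> h.
    rewrite sub0r normrN /= addr0 [h%:A]mulr1 {2}/flat ltxx subr0.
    have -> : h^-1 *: flat q h = flat ('X * q) h.
      rewrite /flat; case: ifP => _; last by rewrite scaler0.
      by rewrite hornerM hornerX -mulrA.
    apply: (le_trans (CP _)).
    apply: (@le_trans _ _ ((C + 1) * `|h|)).
      by rewrite ler_wpM2r// lerDl.
    rewrite mulrC -ler_pdivlMr ?ltr_wpDl//.
    near: h; apply: dnbhs0_le.
    by rewrite divr_gt0// ltr_wpDl.
  apply: DeriveDef; first by apply/cvg_ex; exists 0.
  exact/cvg_lim.
Unshelve. all: by end_near. Qed.

Definition flat_tower (p : nat) : R -> R := flat (iter p flat_next 1).

Lemma is_tower_flat : is_tower flat_tower.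
Proof. by move=> p x; exact: is_derive_flat. Qed.

End flat.

(** * Towers of derivatives and a smooth step *)

Section tower_algebra.
Variable R : realType.
Implicit Types f g : nat -> R -> R.

(** The p-th derivative of a product as a sum of 2^p terms: the recursion is
    the product rule, without collecting terms into binomial coefficients. *)
Fixpoint tmul (f g : nat -> R -> R) (p : nat) : R -> R :=
  if p is p'.+1 then
    fun x => tmul (fun k => f k.+1) g p' x + tmul f (fun k => g k.+1) p' x
  else fun x => f 0%N x * g 0%N x.

Definition tadd f g : nat -> R -> R := fun p x => f p x + g p x.

Definition tconst (c : R) : nat -> R -> R :=
  fun p x => if p is 0%N then c else 0.

Definition tid : nat -> R -> R :=
  fun p x => match p with 0%N => x | 1%N => 1 | _ => 0 end.

Definition taff (f : nat -> R -> R) (a b : R) : nat -> R -> R :=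
  fun p x => a ^+ p * f p (a * x + b).

Lemma is_tower_shift f : is_tower f -> is_tower (fun k => f k.+1).
Proof. by move=> tf p x; exact: tf. Qed.

Lemma is_tower_mul f g : is_tower f -> is_tower g -> is_tower (tmul f g).
Proof.
move=> tf tg p; elim: p f g tf tg => [|p IH] f g tf tg x.
  exact: is_derive_mul.
by apply: is_derive_add; apply: IH => //; exact: is_tower_shift.
Qed.

Lemma is_tower_add f g : is_tower f -> is_tower g -> is_tower (tadd f g).
Proof. by move=> tf tg p x; apply: is_derive_add. Qed.

Lemma is_tower_const c : is_tower (tconst c).
Proof. by case=> [|p] x; exact: is_derive_const. Qed.

Lemma is_tower_id : is_tower tid.
Proof.
case=> [|[|p]] x; [exact: is_derive_id|exact: is_derive_const|].
exact: is_derive_const.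
Qed.

Lemma is_derive_affine (a b x : R) : is_derive x 1 (fun y : R => a * y + b) a.
Proof.
refine (is_derive_eq (is_derive_add (is_derive_cmul a (is_derive_id x 1))
  (is_derive_const x 1 b)) _).
by rewrite addr0 mulr1.
Qed.

Lemma is_tower_aff f a b : is_tower f -> is_tower (taff f a b).
Proof.
move=> tf p x; rewrite /taff.
have h := is_derive_cmul (a ^+ p)
  (is_derive_chain (is_derive_affine a b x) (tf p (a * x + b))).
by refine (is_derive_eq h _); rewrite exprSr; ring.
Qed.

Lemma tmul0 f g p x : (forall k, f k x = 0) -> tmul f g p x = 0.
Proof.
elim: p f g => [|p IH] f g /= f0; first by rewrite f0 mul0r.
by rewrite !IH ?addr0.
Qed.

Lemma tmulC0 f g p x : (forall k, g k x = 0) -> tmul f g p x = 0.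
Proof.
elim: p f g => [|p IH] f g /= f0; first by rewrite f0 mulr0.
by rewrite !IH ?addr0.
Qed.

Lemma tower_continuous f p : is_tower f -> continuous (f p).
Proof.
move=> tf x; have [d _] := tf p x.
by apply: differentiable_continuous; apply/derivable1_diffP.
Qed.

End tower_algebra.

Section antiderivative.
Variable R : realType.
Implicit Types f F : R -> R.

(** Primitives are used instead of integrals wherever a value is only needed
    up to the mean value inequality. *)
Definition antider F f := forall x : R, is_derive x 1 F (f x).

Lemma antider_ge F f (a b m : R) : antider F f ->
  a <= b -> (forall x, a <= x <= b -> m <= f x) -> m * (b - a) <= F b - F a.
Proof.
move=> dF ab mf.
have cF : {within `[a, b], continuous F}.
  apply: derivable_within_continuous => x _; by case: (dF x).
have [c cab ->] := MVT_segment ab (fun x _ => dF x) cF.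
by rewrite ler_wpM2r ?subr_ge0// mf.
Qed.

Lemma antider_le F f (a b m : R) : antider F f ->
  a <= b -> (forall x, a <= x <= b -> f x <= m) -> F b - F a <= m * (b - a).
Proof.
move=> dF ab mf.
have cF : {within `[a, b], continuous F}.
  apply: derivable_within_continuous => x _; by case: (dF x).
have [c cab ->] := MVT_segment ab (fun x _ => dF x) cF.
by rewrite ler_wpM2r ?subr_ge0// mf.
Qed.

Lemma antider_eq F f (a b : R) : antider F f ->
  (forall x, a <= x <= b -> f x = 0) -> a <= b -> F b = F a.
Proof.
move=> dF f0 ab; apply/eqP; rewrite -subr_eq0 eq_le.
have h x : a <= x <= b -> f x <= 0 by move=> /f0 ->.
have h' x : a <= x <= b -> 0 <= f x by move=> /f0 ->.
have := antider_le dF ab h; rewrite mul0r => ->.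
by have := antider_ge dF ab h'; rewrite mul0r => ->.
Qed.

(** As f vanishes to the left of c, integrating from c - 1 gives a primitive
    on the whole line. *)
Lemma ex_antider f (c : R) : continuous f -> (forall x, x <= c -> f x = 0) ->
  exists F, antider F f.
Proof.
move=> cf f0.
pose F x := (\int[lebesgue_measure]_(t in [set` `[c - 1, x]]) (f t))%R.
exists F => x.
have [xc|cx] := ltP x c.
  rewrite f0 ?ltW//; refine (near_eq_is_derive (f := cst 0) _ _).
  near=> y; rewrite /F /Rintegral (eq_integral (cst 0%E)) ?integral0//.
  move=> z; rewrite inE/= in_itv/= => /andP[_ zy]; rewrite f0//.
  by apply: (le_trans zy); apply: ltW; near: y; exact: lt_nbhsl.
have int y : lebesgue_measure.-integrable `[c - 1, y] (EFin \o f).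
  apply: continuous_compact_integrable; first exact: segment_compact.
  by apply: continuous_subspaceT.
have x1 : c - 1 < x by rewrite (lt_le_trans _ cx)// ltrBlDr ltrDl.
have xx : x < x + 1 by rewrite ltrDl.
have [d e] := continuous_FTC1_closed xx (int _) x1 (cf x).
by apply: DeriveDef; [exact: d|rewrite -e derive1E].
Unshelve. all: by end_near. Qed.

End antiderivative.

Section step.
Variable R : realType.
Let a : R := 4^-1.
Let a0 : 0 < a. Proof. by rewrite invr_gt0. Qed.
Let E : nat -> R -> R := flat_tower a.
Let bump : nat -> R -> R := tmul E (taff E (-1) 1).

Let tE : is_tower E. Proof. exact: is_tower_flat. Qed.
Let tbump : is_tower bump.
Proof. by apply: is_tower_mul => //; exact: is_tower_aff. Qed.

Let E_neg p (x : R) : x <= 0 -> E p x = 0.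
Proof. by rewrite /E /flat_tower /flat ltNge => ->. Qed.

Let bump_out p (x : R) : (x <= 0) || (1 <= x) -> bump p x = 0.
Proof.
move=> /orP[x0|x1]; first by apply: tmul0 => k; exact: E_neg.
apply: tmulC0 => k; rewrite /taff E_neg ?mulr0//.
by rewrite mulN1r addrC subr_le0.
Qed.

Let E0E (x : R) : 0 < x -> E 0 x = expR (- (a * x^-1)).
Proof. by move=> x0; rewrite /E /flat_tower /flat/= x0 hornerC mul1r. Qed.

Let E1E (x : R) : 0 < x -> E 1 x = a * x^-1 ^+ 2 * expR (- (a * x^-1)).
Proof.
move=> x0; rewrite /E /flat_tower /flat/= x0 /flat_next.
by rewrite derivC !hornerE subr0 -[X in _ = X * _]mulrA [X in _ = X * _]mulrC expr2.
Qed.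

Let bump0E (x : R) : 0 < x < 1 -> bump 0 x = expR (- (a / (x * (1 - x)))).
Proof.
move=> /andP[x0 x1]; rewrite /bump/= /taff expr0 mul1r mulN1r [- x + 1]addrC.
rewrite !E0E ?subr_gt0// -expRD; congr expR.
by field; rewrite (gt_eqF x0) subr_eq0 gt_eqF.
Qed.

Let bump0_ge0 (x : R) : 0 <= bump 0 x.
Proof.
have [x0|x0] := leP x 0; first by rewrite bump_out ?x0.
have [x1|x1] := leP 1 x; first by rewrite bump_out ?x1 ?orbT.
by rewrite bump0E ?x0// expR_ge0.
Qed.

Let bump0_le (x : R) : bump 0 x <= expR (-1).
Proof.
have [x0|x0] := leP x 0; first by rewrite bump_out ?x0 ?expR_ge0.
have [x1|x1] := leP 1 x; first by rewrite bump_out ?x1 ?orbT// expR_ge0.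
rewrite bump0E ?x0// ler_expR lerN2 ler_pdivlMr ?mulr_gt0 ?subr_gt0// mul1r.
by have := sqr_ge0 (x - 2^-1); rewrite /a expr2; lra.
Qed.

Let E0_bnd (x : R) : x <= 1 -> 0 <= E 0 x <= expR (- a).
Proof.
have [x0 _|x0 x1] := leP x 0; first by rewrite E_neg// lexx expR_ge0.
rewrite E0E// expR_ge0 ler_expR lerN2 ler_pMr//.
by rewrite invf_ge1.
Qed.

Let E1_bnd (x : R) : 0 <= E 1 x <= 16 * expR (- 2).
Proof.
have [x0|x0] := leP x 0; first by rewrite E_neg// lexx mulr_ge0// expR_ge0.
rewrite E1E//; set y := x^-1; have y0 : 0 < y by rewrite invr_gt0.
rewrite !mulr_ge0 ?expR_ge0 ?(ltW y0) ?(ltW a0)//=.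
have h : a * y / 2 <= expR (a * y / 2 - 1).
  by apply: le_trans (expR_ge1Dx _); rewrite addrC subrK.
have h2 : (a * y / 2) ^+ 2 <= expR (a * y - 2).
  have -> : a * y - 2 = (a * y / 2 - 1) + (a * y / 2 - 1) by field.
  rewrite expRD -expr2 lerXn2r// ?nnegrE ?expR_ge0//.
  by rewrite divr_ge0// mulr_ge0// ltW.
have -> : expR (- 2) = expR (a * y - 2) * expR (- (a * y)) :> R.
  by rewrite -expRD; congr expR; ring.
rewrite mulrA ler_wpM2r ?expR_ge0//.
apply: (@le_trans _ _ (16 * (a * y / 2) ^+ 2)); last by rewrite ler_wpM2l.
by rewrite /a le_eqVlt; apply/orP; left; apply/eqP; field.
Qed.

Let bump1_bnd (x : R) : `|bump 1 x| <= 16 * expR (- 2) * expR (- a).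
Proof.
have p0 : 0 <= 16 * expR (- 2) * expR (- a) :> R.
  by rewrite !mulr_ge0// expR_ge0.
have [x0|x0] := leP x 0; first by rewrite bump_out ?x0 ?normr0.
have [x1|x1] := leP 1 x; first by rewrite bump_out ?x1 ?orbT ?normr0.
have /andP[l1 u1] := E1_bnd x.
have /andP[l2 u2] := E1_bnd (1 - x).
have /andP[l3 u3] := E0_bnd (ltW x1).
have /andP[l4 u4] : 0 <= E 0 (1 - x) <= expR (- a).
  by apply: E0_bnd; rewrite gerBl ltW.
rewrite /bump/= /taff expr0 expr1 mul1r mulN1r [- x + 1]addrC mulN1r mulrN.
have a1 : 0 <= E 1 x * E 0 (1 - x) <= 16 * expR (- 2) * expR (- a).
  by rewrite mulr_ge0//= ler_pM.
have a2 : 0 <= E 0 x * E 1 (1 - x) <= 16 * expR (- 2) * expR (- a).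
  by rewrite mulr_ge0//= mulrC ler_pM.
by rewrite ler_norml; lra.
Qed.

Let bump_mid (x : R) : 4^-1 <= x <= 3 / 4 -> expR (- (4 / 3)) <= bump 0 x.
Proof.
move=> /andP[x0 x1]; rewrite bump0E; last by apply/andP; split; lra.
rewrite ler_expR lerN2 ler_pdivrMr; last by rewrite mulr_gt0//; lra.
have : 0 <= (x - 4^-1) * (3 / 4 - x) by rewrite mulr_ge0// subr_ge0.
rewrite /a; lra.
Qed.

(** The maximum of the bump is at most 4 times the lower bound exp (- 4/3) /
    2 for its integral; this is where the bound 4 on the slope of the step
    comes from. *)
Let exp_num1 : expR (-1) <= 4 * (expR (- (4 / 3)) / 2) :> R.
Proof.
have -> : - (4 / 3) = -1 + - 3^-1 :> R by field.
rewrite expRD; have := expR_ge1Dx (- 3^-1 : R).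
have := expR_gt0 (-1 : R); nra.
Qed.

(** Similarly the derivative of the bump is at most 16 times that lower
    bound. *)
Let exp_num2 :
  16 * expR (- 2) * expR (- a) <= 16 * (expR (- (4 / 3)) / 2) :> R.
Proof.
have h : 2 <= expR (11 / 12) :> R.
  have -> : 11 / 12 = 11 / 24 + 11 / 24 :> R by field.
  rewrite expRD; have := expR_ge1Dx (11 / 24 : R); nra.
rewrite -mulrA ler_wpM2l// -expRD.
have -> : - (4 / 3) = (- 2 - a) + 11 / 12 :> R by rewrite /a; field.
rewrite [X in _ <= X / _]expRD; have := expR_gt0 (- 2 - a); nra.
Qed.

(** The normalised primitive of the bump exp (- 1/(4x)) exp (- 1/(4(1-x))),
    which is at least exp (- 4/3) on the middle half of the unit interval. *)
Lemma ex_smooth_step : exists z : nat -> R -> R,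
  [/\ is_tower z,
      (forall x, x <= 0 -> z 0 x = 0) /\ (forall x, 1 <= x -> z 0 x = 1),
      forall x, 0 <= z 1 x <= 4,
      forall x, `|z 2 x| <= 16 &
      forall p x, (x <= 0) || (1 <= x) -> z p.+1 x = 0].
Proof.
have [B dB] : exists B, antider B (bump 0).
  apply: (@ex_antider _ _ 0) => [|x x0]; last by rewrite bump_out ?x0.
  exact: (tower_continuous (p := 0%N) tbump).
pose I := B 1 - B 0.
have I_ge : expR (- (4 / 3)) / 2 <= I.
  have h1 : 0 * (4^-1 - 0) <= B 4^-1 - B 0
    by apply: antider_ge dB _ _ => [|y _]; [lra|exact: bump0_ge0].
  have h3 : 0 * (1 - 3 / 4) <= B 1 - B (3 / 4)
    by apply: antider_ge dB _ _ => [|y _]; [lra|exact: bump0_ge0].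
  have h2 : expR (- (4 / 3)) * (3 / 4 - 4^-1) <= B (3 / 4) - B 4^-1.
    by apply: antider_ge dB _ bump_mid; lra.
  rewrite /I; lra.
have I0 : 0 < I by apply: lt_le_trans I_ge; rewrite divr_gt0 ?expR_gt0.
exists (fun p => if p is p'.+1 then fun x => I^-1 * bump p' x
                 else fun x => I^-1 * (B x + (- B 0))).
split.
- case=> [|p] x; apply: is_derive_cmul; last exact: tbump.
  refine (is_derive_eq (is_derive_add (dB x) (is_derive_const x 1 _)) _).
  by rewrite addr0.
- split=> x x0 /=.
  rewrite (_ : B x = B 0) ?subrr ?mulr0//.
  apply/esym; apply: antider_eq dB _ _ => // y /andP[_ y0].
  by rewrite bump_out ?y0.
  rewrite (_ : B x = B 1) ?mulVf ?gt_eqF//.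
  apply: antider_eq dB _ _ => // y /andP[y0 _].
  by rewrite bump_out ?y0 ?orbT.
- move=> x /=; rewrite mulr_ge0 ?invr_ge0 ?(ltW I0)//= ler_pdivrMl// mulrC.
  apply: (le_trans (bump0_le x)); apply: (le_trans exp_num1).
  by rewrite ler_wpM2l.
- move=> x /=; rewrite normrM gtr0_norm ?invr_gt0// ler_pdivrMl// mulrC.
  apply: (le_trans (bump1_bnd x)); apply: (le_trans exp_num2).
  by rewrite ler_wpM2l.
- by move=> p x x01 /=; rewrite bump_out// mulr0.
Qed.

End step.

(** * Profiles on the unit cell *)

Section plateau.
Variable R : realType.

Definition smooth_step : nat -> R -> R := sval (cid (ex_smooth_step R)).

Lemma is_tower_smooth_step : is_tower smooth_step.
Proof. by rewrite /smooth_step; case: cid => z /= []. Qed.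

Lemma smooth_step_le0 p (x : R) : x <= 0 -> smooth_step p x = 0.
Proof.
rewrite /smooth_step; case: cid => z /= [_ [z0 _] _ _ z'] x0.
by case: p => [|p]; [exact: z0|rewrite z' ?x0].
Qed.

Lemma smooth_step_ge1 p (x : R) : 1 <= x -> smooth_step p x = (p == 0)%:R.
Proof.
rewrite /smooth_step; case: cid => z /= [_ [_ z1] _ _ z'] x1.
by case: p => [|p]; [exact: z1|rewrite z' ?x1 ?orbT].
Qed.

Lemma smooth_step_d1 (x : R) : 0 <= smooth_step 1 x <= 4.
Proof. by rewrite /smooth_step; case: cid => z /= [_ _ ->]. Qed.

Lemma smooth_step_d2 (x : R) : `|smooth_step 2 x| <= 16.
Proof. by rewrite /smooth_step; case: cid => z /= [_ _ _ ->]. Qed.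

Lemma smooth_step_itv (x : R) : 0 <= smooth_step 0 x <= 1.
Proof.
have [x0|x0] := leP x 0; first by rewrite smooth_step_le0// lexx ler01.
have [x1|x1] := leP 1 x; first by rewrite smooth_step_ge1// lexx ler01.
have pos (y : R) : 0 <= smooth_step 1 y by case/andP: (smooth_step_d1 y).
have := antider_ge (is_tower_smooth_step 0) (ltW x0) (fun y _ => pos y).
have := antider_ge (is_tower_smooth_step 0) (ltW x1) (fun y _ => pos y).
rewrite !mul0r !subr_ge0 (smooth_step_ge1 0 (lexx 1)).
by rewrite (smooth_step_le0 0 (lexx 0)) => -> ->.
Qed.

(** A rising step on [l, l + d] plus a falling one on [r - d, r], minus 1.
    When l + d <= r - d the ramps do not meet, so near each point the
    function is a single rescaled step; this is how all its bounds are
    proved. *)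
Definition plateau (l r d : R) : nat -> R -> R :=
  tadd (tadd (taff smooth_step d^-1 (- l / d))
             (taff smooth_step (- d^-1) (r / d))) (tconst (-1)).

Lemma is_tower_plateau l r d : is_tower (plateau l r d).
Proof.
apply: is_tower_add (is_tower_const _).
by apply: is_tower_add; apply: is_tower_aff; exact: is_tower_smooth_step.
Qed.

Variables l r d : R.
Hypotheses (d0 : 0 < d) (lr : l + d <= r - d).

Let pl := plateau l r d.

Let plE p (x : R) : pl p x = d^-1 ^+ p * smooth_step p ((x - l) / d) +
  (- d^-1) ^+ p * smooth_step p ((r - x) / d) - (p == 0)%:R.
Proof.
rewrite /pl /plateau /tadd /taff /tconst; congr (_ * _ + _ * _ + _).
- by congr smooth_step; rewrite mulrBl mulrC mulNr.
- by congr smooth_step; rewrite mulrBl mulNr [in LHS]mulrC addrC mulrC.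
- by case: p => //=; rewrite oppr0.
Qed.

Let left_big (x : R) : l + d <= x -> 1 <= (x - l) / d.
Proof. by move=> h; rewrite ler_pdivlMr// mul1r; lra. Qed.

Let right_big (x : R) : x <= r - d -> 1 <= (r - x) / d.
Proof. by move=> h; rewrite ler_pdivlMr// mul1r; lra. Qed.

Let left_small (x : R) : x <= l -> (x - l) / d <= 0.
Proof. by move=> h; rewrite ler_pdivrMr// mul0r; lra. Qed.

Let right_small (x : R) : r <= x -> (r - x) / d <= 0.
Proof. by move=> h; rewrite ler_pdivrMr// mul0r; lra. Qed.

Let side (x : R) : (l + d <= x) || (x <= r - d).
Proof. by have [h|h] := leP (l + d) x; rewrite ?(le_trans (ltW h) lr) ?orbT. Qed.

Let pl_right (x : R) p : l + d <= x ->
  pl p x = (- d^-1) ^+ p * smooth_step p ((r - x) / d).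
Proof.
move=> h; rewrite plE (smooth_step_ge1 _ (left_big h)).
by case: p => [|p]; rewrite ?expr0/=; ring.
Qed.

Let pl_left (x : R) p : x <= r - d ->
  pl p x = d^-1 ^+ p * smooth_step p ((x - l) / d).
Proof.
move=> h; rewrite plE (smooth_step_ge1 _ (right_big h)).
by case: p => [|p]; rewrite ?expr0/=; ring.
Qed.

Lemma plateau_out p (x : R) : (x <= l) || (r <= x) -> plateau l r d p x = 0.
Proof.
have d1 : 0 < d := d0; have lr1 : l + d <= r - d := lr.
rewrite -/(pl p x) => /orP[h|h].
  have h' : x <= r - d by lra.
  by rewrite pl_left// smooth_step_le0 ?mulr0 ?left_small.
have h' : l + d <= x by lra.
by rewrite pl_right// smooth_step_le0 ?mulr0 ?right_small.
Qed.

Lemma plateau_in p (x : R) : l + d <= x <= r - d -> plateau l r d p x = (p == 0)%:R.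
Proof.
rewrite -/(pl p x) => /andP[h h']; rewrite pl_left// smooth_step_ge1 ?left_big//.
by case: p => [|p]; rewrite ?expr0 ?mulr1 ?mulr0.
Qed.

Lemma plateau_itv (x : R) : 0 <= plateau l r d 0 x <= 1.
Proof.
rewrite -/(pl 0 x); case/orP: (side x) => h.
  by rewrite pl_right// expr0 mul1r smooth_step_itv.
by rewrite pl_left// expr0 mul1r smooth_step_itv.
Qed.

Lemma plateau_d1 (x : R) : `|plateau l r d 1 x| <= 4 / d.
Proof.
have h4 y : `|smooth_step 1 y| <= 4.
  by case/andP: (smooth_step_d1 y) => h ?; rewrite ger0_norm.
have dd : 0 < d^-1 by rewrite invr_gt0.
rewrite -/(pl 1 x) [4 / d]mulrC; case/orP: (side x) => h.
  by rewrite pl_right// expr1 normrM normrN (gtr0_norm dd) ler_pM2l.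
by rewrite pl_left// expr1 normrM (gtr0_norm dd) ler_pM2l.
Qed.

Lemma plateau_d2 (x : R) : `|plateau l r d 2 x| <= 16 / d ^+ 2.
Proof.
rewrite -/(pl 2 x) [16 / _]mulrC -exprVn.
have dd : 0 < d^-1 ^+ 2 by rewrite exprn_gt0// invr_gt0.
case/orP: (side x) => h.
  by rewrite pl_right// sqrrN normrM (gtr0_norm dd) ler_pM2l// smooth_step_d2.
by rewrite pl_left// normrM (gtr0_norm dd) ler_pM2l// smooth_step_d2.
Qed.

Lemma plateau_d1_left (x : R) : x <= r - d -> 0 <= plateau l r d 1 x.
Proof.
move=> h; rewrite -/(pl 1 x) pl_left// expr1 mulr_ge0 ?invr_ge0 ?(ltW d0)//.
by case/andP: (smooth_step_d1 ((x - l) / d)).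
Qed.

End plateau.

Section profiles.
Variable R : realType.

(** The ramps of the profiles are nested, in units of 1/16: the cut-off beta
    falls from 2 to 3, gamma from 3 to 5, and psi is an exact parabola up to
    6 and vanishes from 7 on. Thus gamma is 1 on the support of beta, and
    psi is a parabola on the support of gamma. The profile theta serves in
    the test functions. It is constant on the support of gamma, rises on
    [-6, -5] where psi is a parabola, and falls on [7, 8], beyond psi; hence
    psi theta' has a sign and does not integrate to 0. *)
Definition beta : nat -> R -> R := plateau (- (3 / 16)) (3 / 16) (1 / 16).
Definition gamma : nat -> R -> R := plateau (- (5 / 16)) (5 / 16) (2 / 16).
Definition theta : nat -> R -> R := plateau (- (6 / 16)) (8 / 16) (1 / 16).
Definition chi : nat -> R -> R := plateau (- (7 / 16)) (7 / 16) (1 / 16).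
Definition psi : nat -> R -> R :=
  tmul (tmul (tconst 2^-1) (tmul (@tid R) (@tid R))) chi.

Definition cell_tower (f : nat -> R -> R) :=
  is_tower f /\ forall p x, 2^-1 <= `|x| -> f p x = 0.

Lemma ge_normP (a x : R) : a <= `|x| -> (x <= - a) || (a <= x).
Proof. by rewrite ler_normr lerNr orbC. Qed.

Lemma beta_out p (x : R) : 3 / 16 <= `|x| -> beta p x = 0.
Proof. by move/ge_normP; apply: plateau_out; lra. Qed.

Lemma beta_in p (x : R) : `|x| <= 2 / 16 -> beta p x = (p == 0)%:R.
Proof. by rewrite ler_norml => h; apply: plateau_in; lra. Qed.

Lemma beta_bnd (x : R) :
  [/\ 0 <= beta 0 x <= 1, `|beta 1 x| <= 64 & `|beta 2 x| <= 4096].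
Proof.
split; first by apply: plateau_itv; lra.
  by apply: (le_trans (plateau_d1 _ _ _)); lra.
by apply: (le_trans (plateau_d2 _ _ _)); lra.
Qed.

Lemma gamma_out p (x : R) : 5 / 16 <= `|x| -> gamma p x = 0.
Proof. by move/ge_normP; apply: plateau_out; lra. Qed.

Lemma gamma_in p (x : R) : `|x| <= 3 / 16 -> gamma p x = (p == 0)%:R.
Proof. by rewrite ler_norml => h; apply: plateau_in; lra. Qed.

Lemma gamma_bnd (x : R) :
  [/\ 0 <= gamma 0 x <= 1, `|gamma 1 x| <= 32 & `|gamma 2 x| <= 1024].
Proof.
split; first by apply: plateau_itv; lra.
  by apply: (le_trans (plateau_d1 _ _ _)); lra.
by apply: (le_trans (plateau_d2 _ _ _)); lra.
Qed.

Lemma chi_out p (x : R) : 7 / 16 <= `|x| -> chi p x = 0.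
Proof. by move/ge_normP; apply: plateau_out; lra. Qed.

Lemma chi_in p (x : R) : `|x| <= 6 / 16 -> chi p x = (p == 0)%:R.
Proof. by rewrite ler_norml => h; apply: plateau_in; lra. Qed.

Lemma chi_bnd (x : R) :
  [/\ 0 <= chi 0 x <= 1, `|chi 1 x| <= 64 & `|chi 2 x| <= 4096].
Proof.
split; first by apply: plateau_itv; lra.
  by apply: (le_trans (plateau_d1 _ _ _)); lra.
by apply: (le_trans (plateau_d2 _ _ _)); lra.
Qed.

Lemma theta_out p (x : R) : 1 / 2 <= `|x| -> theta p x = 0.
Proof.
move=> /ge_normP h; apply: plateau_out; [lra|lra|].
by case/orP: h => h; apply/orP; [left|right]; lra.
Qed.

Lemma theta_flat p (x : R) : `|x| <= 5 / 16 -> theta p.+1 x = 0.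
Proof. by rewrite ler_norml => h; rewrite /theta plateau_in//; lra. Qed.

Lemma theta_itv (x : R) : 0 <= theta 0 x <= 1.
Proof. by apply: plateau_itv; lra. Qed.

Lemma psi0E (x : R) : psi 0 x = x ^+ 2 / 2 * chi 0 x.
Proof. by rewrite /psi /= expr2; ring. Qed.

Lemma psi1E (x : R) : psi 1 x = x * chi 0 x + x ^+ 2 / 2 * chi 1 x.
Proof. by rewrite /psi /= expr2; field. Qed.

Lemma psi2E (x : R) : psi 2 x = chi 0 x + 2 * x * chi 1 x + x ^+ 2 / 2 * chi 2 x.
Proof. by rewrite /psi /= expr2; field. Qed.

Lemma psi_out p (x : R) : 7 / 16 <= `|x| -> psi p x = 0.
Proof. by move=> h; apply: tmulC0 => k; exact: chi_out. Qed.

Lemma psi_in (x : R) : `|x| <= 6 / 16 -> psi 2 x = 1.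
Proof. by move=> h; rewrite psi2E !chi_in//= !mulr0 !addr0. Qed.

Let sq_small (x : R) : `|x| <= 7 / 16 -> 0 <= x ^+ 2 / 2 <= 49 / 512.
Proof.
move=> h; rewrite divr_ge0 ?sqr_ge0//=; move: h; rewrite ler_norml expr2; nra.
Qed.

Lemma psi_bnd (x : R) :
  [/\ 0 <= psi 0 x <= 7 / 64, `|psi 1 x| <= 8 & `|psi 2 x| <= 512].
Proof.
have [h|h] := leP (7 / 16) `|x|.
  by rewrite !psi_out// normr0; split; [apply/andP; split|..]; lra.
have /andP[q0 q1] := sq_small (ltW h).
have [/andP[c0 c0'] c1 c2] := chi_bnd x.
rewrite psi0E psi1E psi2E; move: q0 q1; set q := x ^+ 2 / 2 => q0 q1.
split.
- rewrite mulr_ge0//=; apply: (@le_trans _ _ (49 / 512 * 1)); last lra.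
  by rewrite ler_pM.
- have h1 : `|x * chi 0 x| <= 7 / 16 * 1.
    by rewrite normrM ler_pM ?(ltW h)// ger0_norm.
  have h2 : `|q * chi 1 x| <= 49 / 512 * 64 by rewrite normrM ler_pM// ger0_norm.
  by apply: (le_trans (ler_normD _ _)); lra.
- have h1 : `|2 * x * chi 1 x| <= 2 * (7 / 16) * 64.
    rewrite normrM ler_pM// normrM ler_pM ?(ltW h)// ger0_norm//.
  have h2 : `|q * chi 2 x| <= 49 / 512 * 4096.
    by rewrite normrM ler_pM// ger0_norm.
  have h3 : `|chi 0 x| <= 1 by rewrite ger0_norm.
  apply: (le_trans (ler_normD _ _)).
  have := ler_normD (chi 0 x) (2 * x * chi 1 x); lra.
Qed.

(** Where theta rises, x^2 / 2 is at least 25/512. *)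
Lemma psi_theta (x : R) : x <= 0 -> 25 / 512 * theta 1 x <= psi 0 x * theta 1 x.
Proof.
move=> x0; have t0 : 0 <= theta 1 x by apply: plateau_d1_left; lra.
have [h|h] := leP `|x| (5 / 16); first by rewrite theta_flat// !mulr0.
have [h'|h'] := leP (6 / 16) `|x|.
  rewrite (_ : theta 1 x = 0) ?mulr0//; apply: plateau_out; [lra|lra|].
  by move: h'; rewrite ler0_norm//; lra.
rewrite ler_wpM2r// psi0E chi_in ?(ltW h')//= mulr1.
by move: h h'; rewrite ler0_norm// expr2; nra.
Qed.

Lemma psi_theta_right (x : R) : 0 <= x -> psi 0 x * theta 1 x = 0.
Proof.
move=> x0; have [h|h] := leP (7 / 16) `|x|; first by rewrite psi_out// mul0r.
have -> : theta 1 x = 0; last by rewrite mulr0.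
by move: h; rewrite ger0_norm// => h; apply: plateau_in; lra.
Qed.

Lemma cell_beta : cell_tower beta.
Proof.
split; first exact: is_tower_plateau.
by move=> p x h; apply: beta_out; lra.
Qed.

Lemma cell_gamma : cell_tower gamma.
Proof.
split; first exact: is_tower_plateau.
by move=> p x h; apply: gamma_out; lra.
Qed.

Lemma cell_theta : cell_tower theta.
Proof.
split; first exact: is_tower_plateau.
by move=> p x h; apply: theta_out; lra.
Qed.

Lemma cell_psi : cell_tower psi.
Proof.
split; last by move=> p x h; apply: psi_out; lra.
apply: is_tower_mul (is_tower_plateau _ _ _).
apply: is_tower_mul (is_tower_const _) _.
by apply: is_tower_mul; exact: is_tower_id.
Qed.

End profiles.

(** * Self-similar copies of a profile *)

Lemma ex_ncopies : exists n, n = (2 ^ 35)%N. Proof. by eexists. Qed.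

(** The value 2^35 is hidden behind a choice, for nothing but its product
    with 4 matters and a unary numeral of this size must not be unfolded. *)
Definition ncopies : nat := sval (cid ex_ncopies).

Lemma ncopiesE : ncopies = (2 ^ 35)%N.
Proof. by rewrite /ncopies; exact: (svalP (cid ex_ncopies)). Qed.

Section replicate.
Variable R : realType.

Definition freq : R := 2 ^+ 37.

Lemma ncopies_freq : ncopies%:R * 4 = freq.
Proof.
rewrite ncopiesE natrX.
have -> : 4 = 2 ^+ 2 :> R by rewrite expr2 -natrM.
by rewrite -exprD.
Qed.

Lemma freq_ge4 : 4 <= freq.
Proof.
have -> : 4 = 2 ^+ 2 :> R by rewrite expr2 -natrM.
by rewrite /freq ler_eXn2l// ltr1n.
Qed.

Let N := freq.
Let N0 : 0 < N. Proof. by apply: lt_le_trans freq_ge4. Qed.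

(** The i-th of the N/4 adjacent intervals of length 1/N that fill [-1/8,
    1/8], mapped affinely onto the unit cell. *)
Definition slot (i : nat) (x : R) : R := N * x + ((ncopies%:R - 1) / 2 - i%:R).

Definition copies (f : R -> R) (x : R) : R := \sum_(i < ncopies) f (slot i x).

Definition rep (j : nat) : (R -> R) -> R -> R := iter j copies.

(** The tower of the j-th generation: each generation multiplies a p-th
    derivative by N^p. *)
Definition trep (j : nat) (f : nat -> R -> R) (p : nat) (x : R) : R :=
  N ^+ (j * p) * rep j (f p) x.

Definition cellular (f : R -> R) := forall x, 2^-1 <= `|x| -> f x = 0.

(** The slots do not overlap, so at each point t either no copy of any
    profile is alive, or a single one is. In the second case all profiles
    are seen through the same local coordinate z; the order of the
    quantifiers is what lets products of different profiles be rescaled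
    together. *)
Lemma copies_cell t :
  (forall f, cellular f -> copies f t = 0) \/
  (`|t| <= 8^-1 /\ exists2 z, `|z| <= 2^-1 &
     forall f, cellular f -> copies f t = f z).
Proof.
have [[i hi]|no] := pselect (exists i : 'I_ncopies, `|slot i t| < 2^-1).
  right; split; last exists (slot i t); first 2 last.
  - move=> f cf; rewrite /copies (bigD1 i)//= big1 ?addr0// => k ki.
    apply: cf; have -> : slot k t = slot i t + (i%:R - k%:R).
      by rewrite /slot; ring.
    have [ik|ik] : (i%:R + 1 <= k%:R :> R) \/ (k%:R + 1 <= i%:R :> R).
    + have : (i < k)%N || (k < i)%N by rewrite -neq_ltn eq_sym.
      by case/orP => h; [left|right]; rewrite natr1 ler_nat.
    + by move: hi; rewrite ltr_norml ler_normr; lra.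
    + by move: hi; rewrite ltr_norml ler_normr; lra.
  - have i1 : i%:R + 1 <= ncopies%:R :> R by rewrite natr1 ler_nat.
    have i0 : 0 <= i%:R :> R by rewrite ler0n.
    have nN := ncopies_freq; move: hi; rewrite ltr_norml /slot => hi.
    rewrite -[8^-1]mul1r ler_pdivlMr// mulrC -(ler_pM2l N0) mulr1.
    rewrite -[X in X * _]gtr0_norm// mulrCA -normrM.
    have : `|N * t| <= N / 8 by rewrite ler_norml; rewrite -/N in nN; lra.
    by lra.
  - exact: ltW.
left=> f cf; apply: big1 => i _; apply: cf; rewrite leNgt.
by apply/negP => h; apply: no; exists i.
Qed.

Lemma copies_out f t : cellular f -> 8^-1 < `|t| -> copies f t = 0.
Proof.
move=> cf h; have [->//|[h' _]] := copies_cell t.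
by move: (le_lt_trans h' h); rewrite ltxx.
Qed.

Lemma cellular_copies f : cellular f -> cellular (copies f).
Proof. by move=> cf t h; apply: copies_out => //; lra. Qed.

Lemma cellular_rep j f : cellular f -> cellular (rep j f).
Proof. by move=> cf; elim: j => //= j; exact: cellular_copies. Qed.

Lemma repS j f t : rep j.+1 f t = copies (rep j f) t.
Proof. by []. Qed.

Lemma rep_cell j t :
  (forall f, cellular f -> rep j f t = 0) \/
  (exists2 z, `|z| <= 2^-1 & forall f, cellular f -> rep j f t = f z).
Proof.
elim: j t => [|j IH] t.
  have [h|h] := leP `|t| 2^-1; first by right; exists t.
  by left=> f cf; apply: cf; exact: ltW.
have cr f : cellular f -> cellular (rep j f) by exact: cellular_rep.
have [h|[_ [z zle zE]]] := copies_cell t.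
  by left=> f cf; rewrite repS h//; exact: cr.
have [h|[y yle yE]] := IH z.
  by left=> f cf; rewrite repS zE ?h//; exact: cr.
by right; exists y => // f cf; rewrite repS zE ?yE//; exact: cr.
Qed.

(** Every value of the copies is a value of the profile or 0, so all
    pointwise bounds are inherited. *)
Lemma rep_range (P : R -> Prop) j f : cellular f -> P 0 ->
  (forall x, P (f x)) -> forall t, P (rep j f t).
Proof. by move=> cf P0 Pf t; have [->|[z _ ->]] := rep_cell j t. Qed.

Lemma rep_mul j f g t : cellular f -> cellular g ->
  rep j f t * rep j g t = rep j (fun x => f x * g x) t.
Proof.
move=> cf cg; have cfg : cellular (fun x => f x * g x).
  by move=> x h; rewrite cf ?mul0r.
by have [h|[z _ h]] := rep_cell j t; rewrite !h ?mul0r.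
Qed.

Lemma trepS j f p x : trep j.+1 f p x = N ^+ p * copies (trep j f p) x.
Proof.
rewrite /trep /rep iterS mulSn exprD -mulrA; congr (_ * _).
by rewrite /copies mulr_sumr.
Qed.

Lemma is_derive_slot i (x : R) : is_derive x 1 (slot i) N.
Proof. exact: is_derive_affine. Qed.

Lemma is_derive_copies (F f : R -> R) (x : R) : (forall y : R, is_derive y 1 F (f y)) ->
  is_derive x 1 (copies F) (N * copies f x).
Proof.
move=> dF; rewrite /copies mulr_sumr; apply: is_derive_bigsum => i.
by rewrite mulrC; apply: is_derive_chain (is_derive_slot _ _) (dF _).
Qed.

Lemma is_tower_trep j f : is_tower f -> is_tower (trep j f).
Proof.
move=> tf; elim: j => [|j IH] p x.
  have := tf p x; rewrite /trep !mul0n !expr0 mul1r.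
  by congr is_derive; apply/funext => y; rewrite mul1r.
have -> : trep j.+1 f p = fun x => N ^+ p * copies (trep j f p) x.
  by apply/funext => y; exact: trepS.
rewrite trepS exprSr -mulrA.
by apply: is_derive_cmul; apply: is_derive_copies => y; exact: IH.
Qed.

Lemma cell_tower_cellular f p : cell_tower f -> cellular (f p).
Proof. by move=> [_ h] x; exact: h. Qed.

Lemma cell_trep j f : cell_tower f -> cell_tower (trep j f).
Proof.
move=> cf; split; first by apply: is_tower_trep; case: cf.
move=> p x h; rewrite /trep cellular_rep ?mulr0//.
exact: cell_tower_cellular.
Qed.

(** The integral of f over the unit cell, expressed by a primitive. *)
Definition cell_integral (f : R -> R) (I : R) :=
  exists2 F, antider F f & F 2^-1 - F (- 2^-1) = I.

Lemma cell_integral_cmul f I c : cell_integral f I ->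
  cell_integral (fun x => c * f x) (c * I).
Proof.
move=> [F dF FI]; exists (fun x => c * F x); last by rewrite -mulrBr FI.
by move=> x; exact: is_derive_cmul.
Qed.

(** There are N/4 copies, each with 1/N times the integral. *)
Lemma cell_integral_copies f I : cellular f -> cell_integral f I ->
  cell_integral (copies f) (I / 4).
Proof.
move=> cf [F dF FI]; exists (fun x => N^-1 * copies F x).
  move=> x; have := is_derive_cmul N^-1 (is_derive_copies x dF).
  by rewrite mulrA mulVf ?mul1r// gt_eqF.
have nN := ncopies_freq; have N4 := freq_ge4.
rewrite -mulrBr /copies -sumrB.
rewrite (eq_bigr (fun=> I)).
  rewrite sumr_const card_ord -[I *+ _]mulr_natr.
  have n0 : ncopies%:R != 0 :> R.
    by apply/eqP => h; move: nN N4; rewrite h mul0r => <-; lra.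
  by rewrite -[N]nN; field.
move=> i _; rewrite -FI.
have i1 : i%:R + 1 <= ncopies%:R :> R by rewrite natr1 ler_nat.
have i0 : 0 <= i%:R :> R by rewrite ler0n.
have f1 (y : R) : 2^-1 <= y -> F y = F 2^-1.
  move=> h; apply: antider_eq dF _ h => z /andP[h1 _].
  by apply: cf; rewrite ger0_norm//; lra.
have f2 (y : R) : y <= - 2^-1 -> F y = F (- 2^-1).
  move=> h; apply/esym; apply: antider_eq dF _ h => z /andP[_ h1].
  by apply: cf; rewrite ler0_norm; lra.
rewrite -/N in nN N4.
have s1 : 2^-1 <= slot i 2^-1 by rewrite /slot; lra.
have s2 : slot i (- 2^-1) <= - 2^-1 by rewrite /slot; lra.
by rewrite (f1 _ s1) (f2 _ s2).
Qed.

Lemma cell_integral_rep j f I : cellular f -> cell_integral f I ->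
  cell_integral (rep j f) (I / 4 ^+ j).
Proof.
move=> cf fI; elim: j => [|j IH]; first by rewrite expr0 divr1.
rewrite exprSr invfM mulrA; apply: cell_integral_copies => //.
exact: cellular_rep.
Qed.

Lemma ex_cell_integral f : continuous f -> cellular f ->
  exists I, cell_integral f I.
Proof.
move=> ctf cf; have [|F dF] := @ex_antider _ f (- 2^-1) ctf.
  by move=> x h; apply: cf; rewrite ler0_norm; lra.
by exists (F 2^-1 - F (- 2^-1)); exists F.
Qed.

Lemma cell_integral_le f I (m : R) : cell_integral f I ->
  (forall x, f x <= m) -> I <= m.
Proof.
move=> [F dF <-] fm.
have h : - 2^-1 <= 2^-1 :> R by lra.
by have := antider_le dF h (fun x _ => fm x); lra.
Qed.

Lemma cell_integral_ge f I (m : R) : cell_integral f I ->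
  (forall x, m <= f x) -> m <= I.
Proof.
move=> [F dF <-] fm.
have h : - 2^-1 <= 2^-1 :> R by lra.
by have := antider_ge dF h (fun x _ => fm x); lra.
Qed.

End replicate.

(** * Cycles of three layers *)

Section corrector.
Variable R : realType.

Let N : R := freq R.

Definition kap : R := 256^-1.

Let k := kap.

(** With second derivatives of psi equal to N^2 on the cores, these
    amplitudes turn the diagonal (- k^2 s, e, k s) into
    N^2 (k^5 s, k^3 s, - k^4 s), one entry at a time: the first entry to change is the one of
    x_1, then that of x_2, then that of x_0. The result is N^2 (- k^2 s',
    e', k s') for s' = - k^3 s and e' = k^3 s. *)
Definition amp0 (s e : R) : R := k ^+ 3 * s - e / N ^+ 2.
Definition amp1 (s : R) : R := - (k ^+ 4 * s + k * s / N ^+ 2).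
Definition amp2 (s : R) : R := k ^+ 5 * s + k ^+ 2 * s / N ^+ 2.

(** A layer of the i-th cycle differentiated [p0], [p1], [p2] times. The
    profile psi sits one generation deeper than the scale of the cubes in
    which the cycle is inserted, and so do the cut-offs in those variables
    that have already been subdivided by the preceding layers of the cycle. *)
Definition layer0 s e i (p0 p1 p2 : nat) (x0 x1 x2 : R) : R := amp0 s e *
  (trep i (@gamma R) p0 x0 * trep i.+1 (@psi R) p1 x1 * trep i (@beta R) p2 x2).
Definition layer1 s i (p0 p1 p2 : nat) (x0 x1 x2 : R) : R := amp1 s *
  (trep i (@beta R) p0 x0 * trep i.+1 (@gamma R) p1 x1
   * trep i.+1 (@psi R) p2 x2).
Definition layer2 s i (p0 p1 p2 : nat) (x0 x1 x2 : R) : R := amp2 s *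
  (trep i.+1 (@psi R) p0 x0 * trep i.+1 (@beta R) p1 x1
   * trep i.+1 (@gamma R) p2 x2).

Definition cyc s e i p0 p1 p2 (x0 x1 x2 : R) : R :=
  layer0 s e i p0 p1 p2 x0 x1 x2 + layer1 s i p0 p1 p2 x0 x1 x2
  + layer2 s i p0 p1 p2 x0 x1 x2.

(** The parameters (s, e) of the i-th cycle: each cycle replaces them by
    (- k^3 s, k^3 s). *)
Definition size_at (s : R) (i : nat) : R := (- k ^+ 3) ^+ i * s.
Definition extra_at (s e : R) (i : nat) : R :=
  if i is 0%N then e else - size_at s i.

Definition corr m s e p0 p1 p2 (x0 x1 x2 : R) : R :=
  \sum_(i < m) cyc (size_at s i) (extra_at s e i) i p0 p1 p2 x0 x1 x2.

Lemma trep0 (f : nat -> R -> R) p x : trep 0 f p x = f p x.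
Proof. by rewrite /trep mul0n expr0 mul1r. Qed.

(** [copies_cell] for towers: passing from t to its local coordinate z
    lowers the generation by one. *)
Lemma trep_cell (t : R) :
  (forall i f p, cell_tower f -> trep i.+1 f p t = 0) \/
  (`|t| <= 8^-1 /\ exists2 z : R, `|z| <= 2^-1 &
     forall i f p, cell_tower f -> trep i.+1 f p t = N ^+ p * trep i f p z).
Proof.
have ct i f p : cell_tower f -> cellular (trep i f p).
  by move=> cf; apply: cell_tower_cellular; exact: cell_trep.
have [h|[t8 [z z2 h]]] := copies_cell t; [left|right].
  by move=> i f p cf; rewrite trepS h ?mulr0//; exact: ct.
split=> //; exists z => // i f p cf; rewrite trepS h//; exact: ct.
Qed.

Lemma trep_out rho i (f : nat -> R -> R) p x : 8^-1 < rho -> cell_tower f ->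
  (forall p x, rho <= `|x| -> f p x = 0) -> rho <= `|x| -> trep i f p x = 0.
Proof.
move=> r8 cf f0 rx; case: i => [|i]; first by rewrite trep0 f0.
have [->//|[x8 _]] := trep_cell x.
by have := lt_le_trans r8 (le_trans rx x8); rewrite ltxx.
Qed.

(** Self-similarity: seen through local coordinates in all three variables,
    the cycle i + 1 is the cycle i, with the factor N for each derivative. *)
Lemma cyc_shift s e i p0 p1 p2 (x0 x1 x2 z0 z1 z2 : R) :
  (forall i f p, cell_tower f -> trep i.+1 f p x0 = N ^+ p * trep i f p z0) ->
  (forall i f p, cell_tower f -> trep i.+1 f p x1 = N ^+ p * trep i f p z1) ->
  (forall i f p, cell_tower f -> trep i.+1 f p x2 = N ^+ p * trep i f p z2) ->
  cyc s e i.+1 p0 p1 p2 x0 x1 x2 =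
    N ^+ (p0 + p1 + p2) * cyc s e i p0 p1 p2 z0 z1 z2.
Proof.
move=> h0 h1 h2; have cb := cell_beta R; have cg := cell_gamma R.
have cp := cell_psi R.
rewrite /cyc /layer0 /layer1 /layer2 !h0 ?h1 ?h2// !exprD; ring.
Qed.

Lemma cyc_shift0 s e i p0 p1 p2 (x0 x1 x2 : R) :
  [\/ forall i f p, cell_tower f -> trep i.+1 f p x0 = 0,
      forall i f p, cell_tower f -> trep i.+1 f p x1 = 0 |
      forall i f p, cell_tower f -> trep i.+1 f p x2 = 0] ->
  cyc s e i.+1 p0 p1 p2 x0 x1 x2 = 0.
Proof.
have cb := cell_beta R; have cg := cell_gamma R.
have cp := cell_psi R; rewrite /cyc /layer0 /layer1 /layer2.
by case=> h; rewrite !h// !(mul0r, mulr0) !addr0.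
Qed.

(** All cycles live in a box well inside the unit cell. In a box of local
    coordinates of this kind the layers of the preceding cycle are at their
    cores. *)
Lemma cyc_core s e i p0 p1 p2 (x0 x1 x2 : R) :
  [|| 5 / 16 <= `|x0|, 8^-1 < `|x1| | 3 / 16 <= `|x2|] ->
  cyc s e i p0 p1 p2 x0 x1 x2 = 0.
Proof.
have cb := cell_beta R; have cg := cell_gamma R.
have cp := cell_psi R; rewrite /cyc /layer0 /layer1 /layer2.
have small (x : R) : 8^-1 < `|x| ->
    forall i f p, cell_tower f -> trep i.+1 f p x = 0.
  move=> h; have [//|[h' _]] := trep_cell x.
  by have := lt_le_trans h h'; rewrite ltxx.
case/or3P => h.
- have h' : 8^-1 < `|x0| by lra.
  have r : 8^-1 < 5 / 16 :> R by lra.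
  have e1 : trep i (@gamma R) p0 x0 = 0.
    exact: trep_out r cg (fun p x => @gamma_out R p x) h.
  have e2 : trep i (@beta R) p0 x0 = 0.
    apply: trep_out r cb _ h => p x hx; apply: beta_out; lra.
  by rewrite e1 e2 (small _ h')// !(mul0r, mulr0) !addr0.
- by rewrite !(small _ h)// !(mul0r, mulr0) !addr0.
- have h' : 8^-1 < `|x2| by lra.
  have r : 8^-1 < 3 / 16 :> R by lra.
  have e1 : trep i (@beta R) p2 x2 = 0.
    exact: trep_out r cb (fun p x => @beta_out R p x) h.
  by rewrite e1 !(small _ h')// !(mul0r, mulr0) !addr0.
Qed.

Lemma cyc_scale c s e i p0 p1 p2 (x0 x1 x2 : R) :
  cyc (c * s) (c * e) i p0 p1 p2 x0 x1 x2 = c * cyc s e i p0 p1 p2 x0 x1 x2.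
Proof.
rewrite /cyc /layer0 /layer1 /layer2 /amp0 /amp1 /amp2; ring.
Qed.

Lemma size_atS s i : size_at s i.+1 = size_at (- k ^+ 3 * s) i.
Proof. by rewrite /size_at exprSr -mulrA. Qed.

Lemma extra_atS s e i :
  extra_at s e i.+1 = extra_at (- k ^+ 3 * s) (k ^+ 3 * s) i.
Proof.
case: i => [|i]; rewrite /extra_at size_atS//.
by rewrite /size_at expr0; ring.
Qed.

Lemma corrS m s e p0 p1 p2 (x0 x1 x2 : R) :
  corr m.+1 s e p0 p1 p2 x0 x1 x2 = cyc s e 0 p0 p1 p2 x0 x1 x2 +
  \sum_(i < m) cyc (size_at (- k ^+ 3 * s) i)
     (extra_at (- k ^+ 3 * s) (k ^+ 3 * s) i) i.+1 p0 p1 p2 x0 x1 x2.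
Proof.
rewrite /corr big_ord_recl /=; congr (_ + _).
  by rewrite /size_at expr0 mul1r.
by apply: eq_bigr => i _; rewrite -(extra_atS s e) -size_atS.
Qed.

Let N0 : 0 < N. Proof. exact: lt_le_trans (freq_ge4 R). Qed.

Lemma prod3_bnd (a b c A B C : R) : `|a| <= A -> `|b| <= B -> `|c| <= C ->
  `|a * b * c| <= A * B * C.
Proof. by move=> hA hB hC; rewrite !normrM !ler_pM// mulr_ge0. Qed.

Lemma mul_bnd (a b A B : R) : `|a| <= A -> `|b| <= B -> `|a * b| <= A * B.
Proof. by move=> hA hB; rewrite normrM ler_pM. Qed.

Lemma trep_bnd i p (f : nat -> R -> R) x C : cell_tower f -> 0 <= C ->
  (forall y, `|f p y| <= C) -> `|trep i f p x| <= N ^+ (i * p) * C.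
Proof.
move=> cf C0 fC; rewrite /trep normrM ger0_norm ?exprn_ge0 ?(ltW N0)//.
rewrite ler_wpM2l ?exprn_ge0 ?(ltW N0)//.
apply: (@rep_range _ (fun y => `|y| <= C)); rewrite ?normr0//.
exact: cell_tower_cellular.
Qed.

Lemma trep_bnd0 i (f : nat -> R -> R) x C : cell_tower f -> 0 <= C ->
  (forall y, `|f 0%N y| <= C) -> `|trep i f 0 x| <= C.
Proof.
by move=> cf C0 fC; have := trep_bnd i x cf C0 fC; rewrite muln0 expr0 mul1r.
Qed.

Let itv01_norm (y : R) : 0 <= y <= 1 -> `|y| <= 1.
Proof. by case/andP => h ?; rewrite ger0_norm. Qed.

Lemma trep_psi0 i (y : R) : `|trep i (@psi R) 0 y| <= 7 / 64.
Proof.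
apply: trep_bnd0 (cell_psi R) _ _ => [|z]; first by lra.
by have [/andP[h h'] _ _] := psi_bnd z; rewrite ger0_norm.
Qed.

Lemma trep_beta0 i (y : R) : `|trep i (@beta R) 0 y| <= 1.
Proof.
apply: trep_bnd0 (cell_beta R) _ _ => // z.
by have [/itv01_norm] := beta_bnd z.
Qed.

Lemma trep_gamma0 i (y : R) : `|trep i (@gamma R) 0 y| <= 1.
Proof.
apply: trep_bnd0 (cell_gamma R) _ _ => // z.
by have [/itv01_norm] := gamma_bnd z.
Qed.

Lemma trep_ge0 i (f : nat -> R -> R) x : cell_tower f ->
  (forall y, 0 <= f 0%N y) -> 0 <= trep i f 0 x.
Proof.
move=> cf f0; rewrite /trep muln0 expr0 mul1r.
apply: (@rep_range _ (fun y => 0 <= y)) => //; exact: cell_tower_cellular.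
Qed.

Lemma trep_continuous i (f : nat -> R -> R) p : cell_tower f ->
  continuous (trep i f p).
Proof. by move=> cf; apply: tower_continuous; exact: is_tower_trep cf.1. Qed.

Lemma trep_cellular i (f : nat -> R -> R) p : cell_tower f ->
  cellular (trep i f p).
Proof. by move=> cf; apply: cell_tower_cellular; exact: cell_trep. Qed.

End corrector.

(** * Indefinite triples and the first cycle *)

Section indefinite.
Variable R : realType.

Let N : R := freq R.
Let k : R := kap R.

(** A positive and a negative entry, both comparable with the size of H. The
    condition is invariant under multiplication of H by a nonzero number of
    any sign ([indef_scale]). *)
Definition indef (H : 'I_3 -> R) : Prop :=
  [/\ 0 < \sum_i `|H i|, exists i, \sum_i `|H i| <= 2 ^+ 78 * H i &
      exists i, \sum_i `|H i| <= - (2 ^+ 78 * H i)].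

Definition triple (a b c : R) (i : 'I_3) : R :=
  match val i with 0%N => a | 1%N => b | _ => c end.

Lemma sum_triple a b c : \sum_i `|triple a b c i| = `|a| + `|b| + `|c|.
Proof. by rewrite !big_ord_recr big_ord0 /= add0r. Qed.

Lemma indef_scale c H : c != 0 -> indef H -> indef (fun i => c * H i).
Proof.
move=> c0 [S0 [i Hi] [j Hj]].
have SE : \sum_i `|c * H i| = `|c| * \sum_i `|H i|.
  by rewrite mulr_sumr; apply: eq_bigr => l _; rewrite normrM.
have nc : 0 < `|c| by rewrite normr_gt0.
rewrite /indef SE; split; first by rewrite mulr_gt0.
  have [cp|cn] := ltP 0 c.
    by exists i; rewrite gtr0_norm// mulrCA ler_pM2l.
  exists j; rewrite ler0_norm//; rewrite -ler0_norm//.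
  by rewrite mulrCA -[c * _]opprK -mulNr -(ler0_norm cn) -mulrN ler_pM2l.
have [cp|cn] := ltP 0 c.
  by exists j; rewrite gtr0_norm// mulrCA -mulrN ler_pM2l.
by exists i; rewrite mulrCA -mulNr -(ler0_norm cn) ler_pM2l.
Qed.

(** The four sign patterns that occur in a cycle. It is enough to bound the
    relevant entries from below by m, and the sum of all entries from above. *)
Lemma indef_triple (a b c S m : R) : 0 < m -> S <= 2 ^+ 78 * m ->
  `|a| + `|b| + `|c| <= S ->
  [\/ m <= a /\ m <= - b, m <= - a /\ m <= b, m <= - a /\ m <= c |
      m <= b /\ m <= - c] -> indef (triple a b c).
Proof.
move=> m0 Sm nS h; rewrite /indef sum_triple; set d := 2 ^+ 78.
pose i0 : 'I_3 := ord0.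
pose i1 : 'I_3 := lift ord0 ord0.
pose i2 : 'I_3 := ord_max.
have d0 : 0 < d by rewrite exprn_gt0.
have key y : m <= y -> `|a| + `|b| + `|c| <= d * y.
  by move=> my; apply: (le_trans nS); apply: (le_trans Sm); rewrite ler_pM2l.
have keyN y : m <= - y -> `|a| + `|b| + `|c| <= - (d * y).
  by move=> /key; rewrite mulrN.
split.
- have := ler_norm a; have := ler_norm (- a); have := ler_norm b.
  have := ler_norm (- b); have := normr_ge0 c; have := normr_ge0 a.
  have := normr_ge0 b; rewrite !normrN; case: h => -[]; lra.
- by case: h => -[h1 h2]; [exists i0|exists i1|exists i2|exists i1];
    rewrite /triple/=; exact: key.
- by case: h => -[h1 h2]; [exists i1|exists i0|exists i0|exists i2];
    rewrite /triple/=; exact: keyN.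
Qed.

(** Here M = N^2, and K below is k^3 N^2, the entry of x_1 that the core of
    the first layer produces for s = 1. *)
Let M : R := 2 ^+ 74.
Let M0 : 0 < M. Proof. by rewrite exprn_gt0. Qed.
Let ME : N ^+ 2 = M. Proof. by rewrite /N /freq /M -exprM. Qed.
Let K : R := 2 ^+ 50.
Let kE : k = 256^-1. Proof. by []. Qed.
Let k0 : 0 <= k. Proof. by rewrite kE invr_ge0 ler0n. Qed.
Let K0 : 0 <= K. Proof. by rewrite exprn_ge0. Qed.
Let kKM i : 0 <= k ^+ i * (K + 1) / M.
Proof.
have hM := ltW M0; have h : 0 <= K + 1 by apply: addr_ge0 K0 ler01.
by apply: divr_ge0 hM; apply: mulr_ge0 h; exact: exprn_ge0.
Qed.
Let KE : k ^+ 3 * M = K. Proof. by rewrite kE /M /K; lra. Qed.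

Let bnd01 (y : R) : 0 <= y <= 1 -> `|y| <= 1.
Proof. by case/andP => h ?; rewrite ger0_norm. Qed.

Let psi_n2 (y : R) : `|psi 2 y| <= 512.
Proof. by have [] := psi_bnd y. Qed.
Let beta_n0 (y : R) : `|beta 0 y| <= 1.
Proof. by have [/bnd01] := beta_bnd y. Qed.
Let beta_n2 (y : R) : `|beta 2 y| <= 4096.
Proof. by have [] := beta_bnd y. Qed.
Let gamma_n0 (y : R) : `|gamma 0 y| <= 1.
Proof. by have [/bnd01] := gamma_bnd y. Qed.
Let gamma_n2 (y : R) : `|gamma 2 y| <= 1024.
Proof. by have [] := gamma_bnd y. Qed.

Let cb := cell_beta R.
Let cg := cell_gamma R.
Let cp := cell_psi R.

Variables (e x0 x1 x2 : R).
Hypothesis e1 : `|e| <= 1.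

Let hessG :=
  triple (- k ^+ 2 + cyc 1 e 0 2 0 0 x0 x1 x2) (e + cyc 1 e 0 0 2 0 x0 x1 x2)
         (k + cyc 1 e 0 0 0 2 x0 x1 x2).

Let amp0E : amp0 1 e = (K - e) / M.
Proof. by rewrite /amp0 ME -/k -KE mulr1; field; rewrite gt_eqF. Qed.
Let amp1E : amp1 (1 : R) = - (k * (K + 1) / M).
Proof. by rewrite /amp1 ME -/k -KE !mulr1; field; rewrite gt_eqF. Qed.
Let amp2E : amp2 (1 : R) = k ^+ 2 * (K + 1) / M.
Proof. by rewrite /amp2 ME -/k -KE !mulr1; field; rewrite gt_eqF. Qed.

Let psi1_2 (y : R) : `|trep 1 (@psi R) 2 y| <= M * 512.
Proof.
have := trep_bnd 1 y cp (ler0n R 512) (@psi_n2).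
by rewrite mul1n ME.
Qed.
Let beta1_2 (y : R) : `|trep 1 (@beta R) 2 y| <= M * 4096.
Proof.
have := trep_bnd 1 y cb (ler0n R 4096) (@beta_n2).
by rewrite mul1n ME.
Qed.
Let gamma1_2 (y : R) : `|trep 1 (@gamma R) 2 y| <= M * 1024.
Proof.
have := trep_bnd 1 y cg (ler0n R 1024) (@gamma_n2).
by rewrite mul1n ME.
Qed.

(** Only the first layer is present. Its cut-offs contribute at most about
    1024 * 7/64 and 4096 * 7/64 times K/M = k^3 to the entries of x_0 and x_2,
    less than half of k^2 and of k; so - k^2 and k keep their signs, whatever the
    entry of x_1 is. *)
Let caseA : (forall p0 p1 p2, layer1 1 0 p0 p1 p2 x0 x1 x2 = 0) ->
  (forall p0 p1 p2, layer2 1 0 p0 p1 p2 x0 x1 x2 = 0) -> indef hessG.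
Proof.
move=> l1 l2; rewrite /hessG /cyc !l1 !l2 !addr0 /layer0 !trep0 amp0E.
have t0 := prod3_bnd (gamma_n2 x0) (trep_psi0 1 x1) (beta_n0 x2).
have t1 := prod3_bnd (gamma_n0 x0) (psi1_2 x1) (beta_n0 x2).
have t2 := prod3_bnd (gamma_n0 x0) (trep_psi0 1 x1) (beta_n2 x2).
have a : `|(K - e) / M| <= (K + 1) / M.
  rewrite normrM (@ger0_norm _ M^-1) ?invr_ge0 ?(ltW M0)//.
  rewrite ler_pM2r ?invr_gt0//; apply: (le_trans (ler_normB _ _)).
  by rewrite (ger0_norm K0) lerD2l.
have s0 := mul_bnd a t0; have s1 := mul_bnd a t1; have s2 := mul_bnd a t2.
move: s0 s1 s2; set u0 := _ * (gamma 2 _ * _ * _).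
set u1 := _ * (_ * trep _ _ 2 _ * _).
set u2 := _ * (_ * _ * beta 2 _) => s0 s1 s2.
clearbody u0 u1 u2; clear t0 t1 t2 a.
move: e1; rewrite ler_norml => /andP[e_lo e_hi].
(* k = 2^-8, so both sides are equal *)
have S61 : 2 ^+ 61 <= 2 ^+ 78 * (k ^+ 2 / 2) by rewrite kE; lra.
have m0 : 0 < k ^+ 2 / 2 by rewrite kE; lra.
apply: (indef_triple m0 S61).
  apply: (le_trans (lerD (lerD (ler_normD _ _) (ler_normD _ _)) (ler_normD _ _))).
  rewrite normrN (ger0_norm (sqr_ge0 k)) (ger0_norm k0) ?kE.
  move: e1 s0 s1 s2; rewrite /M /K; lra.
apply: Or43; move: s0 s2; rewrite !ler_norml kE /M /K; split; lra.
Qed.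

(** Where the second layer is present, its factors force the first one to be
    at its core. The entry of x_1 is then K up to an error of the second
    layer of less than K / 2, and the entry of x_0 is still close to - k^2. *)
Let caseB z1 z2 : `|x0| <= 3 / 16 -> `|x2| <= 8^-1 ->
  (forall i f p, cell_tower f -> trep i.+1 f p x1 = N ^+ p * trep i f p z1) ->
  (forall i f p, cell_tower f -> trep i.+1 f p x2 = N ^+ p * trep i f p z2) ->
  `|z1| <= 6 / 16 ->
  (forall p0 p1 p2, layer2 1 0 p0 p1 p2 x0 x1 x2 = 0) -> indef hessG.
Proof.
move=> h0 h2 loc1 loc2 hz1 l2.
have g0 : gamma 0 x0 = 1 by rewrite gamma_in.
have g2 : gamma 2 x0 = 0 by rewrite gamma_in.
have b0 : beta 0 x2 = 1 by rewrite beta_in//; lra.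
have b2 : beta 2 x2 = 0 by rewrite beta_in//; lra.
have f2 : trep 1 (@psi R) 2 x1 = M by rewrite loc1// trep0 psi_in// mulr1.
rewrite /hessG /cyc !l2 !addr0 /layer0 /layer1 !trep0 g0 g2 b0 b2 f2.
rewrite !(mul0r, mulr0, mul1r, mulr1, addr0, add0r) amp0E amp1E.
rewrite divfK ?gt_eqF// [e + _]addrC -[K - e + _ + e]addrAC subrK.
have t0 := prod3_bnd (beta_n2 x0) (trep_gamma0 1 x1) (trep_psi0 1 x2).
have t1 := prod3_bnd (beta_n0 x0) (gamma1_2 x1) (trep_psi0 1 x2).
have t2 := prod3_bnd (beta_n0 x0) (trep_gamma0 1 x1) (psi1_2 x2).
have a : `|- (k * (K + 1) / M)| <= k * (K + 1) / M.
  by have h := kKM 1; rewrite expr1 in h; rewrite normrN (ger0_norm h).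
have s0 := mul_bnd a t0; have s1 := mul_bnd a t1; have s2 := mul_bnd a t2.
move: s0 s1 s2; set u0 := _ * (beta 2 _ * _ * _).
set u1 := _ * (_ * trep _ _ 2 _ * _).
set u2 := _ * (_ * _ * trep _ _ 2 _) => s0 s1 s2.
clearbody u0 u1 u2; clear t0 t1 t2 a.
have S61 : 2 ^+ 61 <= 2 ^+ 78 * (k ^+ 2 / 2) by rewrite kE; lra.
have m0 : 0 < k ^+ 2 / 2 by rewrite kE; lra.
apply: (indef_triple m0 S61).
  apply: (le_trans (lerD (lerD (ler_normD _ _) (ler_normD _ _)) (ler_normD _ _))).
  rewrite normrN (ger0_norm (sqr_ge0 k)) (ger0_norm k0) ?kE.
  rewrite (ger0_norm K0).
  move: s0 s1 s2; rewrite ?kE /M /K; lra.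
apply: Or42; move: s0 s1; rewrite !ler_norml ?kE /M /K; split; lra.
Qed.

(** Where the third layer is present too, the second one is at its core. The
    entry of x_2 is then - k K and the entry of x_1 is K, up to errors of
    the third layer of less than half of these values. *)
Let caseC z0 z1 z2 : `|x0| <= 8^-1 -> `|x2| <= 8^-1 ->
  (forall i f p, cell_tower f -> trep i.+1 f p x0 = N ^+ p * trep i f p z0) ->
  (forall i f p, cell_tower f -> trep i.+1 f p x1 = N ^+ p * trep i f p z1) ->
  (forall i f p, cell_tower f -> trep i.+1 f p x2 = N ^+ p * trep i f p z2) ->
  `|z1| <= 3 / 16 -> `|z2| <= 6 / 16 -> indef hessG.
Proof.
move=> h0 h2 loc0 loc1 loc2 hz1 hz2.
have g0 : gamma 0 x0 = 1 by rewrite gamma_in//; lra.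
have g2 : gamma 2 x0 = 0 by rewrite gamma_in//; lra.
have b0 : beta 0 x2 = 1 by rewrite beta_in//; lra.
have b2 : beta 2 x2 = 0 by rewrite beta_in//; lra.
have b0' : beta 0 x0 = 1 by rewrite beta_in//; lra.
have b2' : beta 2 x0 = 0 by rewrite beta_in//; lra.
have f2 : trep 1 (@psi R) 2 x1 = M.
  by rewrite loc1// trep0 psi_in ?mulr1//; lra.
have f2' : trep 1 (@psi R) 2 x2 = M by rewrite loc2// trep0 psi_in ?mulr1.
have g1 : trep 1 (@gamma R) 0 x1 = 1 by rewrite loc1// trep0 gamma_in ?mulr1.
have g1' : trep 1 (@gamma R) 2 x1 = 0 by rewrite loc1// trep0 gamma_in ?mulr0.
rewrite /hessG /cyc /layer0 /layer1 /layer2 !trep0 g0 g2 b0 b2 f2 b0' b2' f2'.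
rewrite g1 g1' !(mul0r, mulr0, mul1r, mulr1, addr0, add0r) amp0E amp1E amp2E.
rewrite !(divfK (lt0r_neq0 M0)) mulNr (divfK (lt0r_neq0 M0)).
have t0 := prod3_bnd (psi1_2 x0) (trep_beta0 1 x1) (trep_gamma0 1 x2).
have t1 := prod3_bnd (trep_psi0 1 x0) (beta1_2 x1) (trep_gamma0 1 x2).
have t2 := prod3_bnd (trep_psi0 1 x0) (trep_beta0 1 x1) (gamma1_2 x2).
have a : `|k ^+ 2 * (K + 1) / M| <= k ^+ 2 * (K + 1) / M.
  by rewrite (ger0_norm (kKM 2)).
have s0 := mul_bnd a t0; have s1 := mul_bnd a t1; have s2 := mul_bnd a t2.
move: s0 s1 s2; set u0 := _ * (trep _ _ 2 _ * _ * _).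
set u1 := _ * (_ * trep _ _ 2 _ * _).
set u2 := _ * (_ * _ * trep _ _ 2 _) => s0 s1 s2.
clearbody u0 u1 u2; clear t0 t1 t2 a.
have -> : e + (K - e + u1) = K + u1 by ring.
have -> : k + (- (k * (K + 1)) + u2) = - (k * K) + u2 by ring.
have S61 : 2 ^+ 61 <= 2 ^+ 78 * (k ^+ 2 / 2) by rewrite kE; lra.
have m0 : 0 < k ^+ 2 / 2 by rewrite kE; lra.
apply: (indef_triple m0 S61).
  apply: (le_trans (lerD (lerD (ler_normD _ _) (ler_normD _ _)) (ler_normD _ _))).
  rewrite !normrN (ger0_norm (sqr_ge0 k)) (ger0_norm (mulr_ge0 k0 K0)).
  rewrite (ger0_norm K0).
  move: s0 s1 s2; rewrite ?kE /M /K; lra.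
apply: Or44; move: s1 s2; rewrite !ler_norml kE /M /K; split; lra.
Qed.

(** The supports of the cut-offs of each layer lie in the cores of the
    preceding layers, so only the three nested situations above occur. *)
Lemma first_cycle_indef : indef hessG.
Proof.
have z3 p0 p1 p2 : [\/ trep 1 (@psi R) p0 x0 = 0, trep 1 (@beta R) p1 x1 = 0 |
    trep 1 (@gamma R) p2 x2 = 0] -> layer2 1 0 p0 p1 p2 x0 x1 x2 = 0.
  by rewrite /layer2; case=> ->; rewrite !(mul0r, mulr0).
have z2 p0 p1 p2 : [\/ beta p0 x0 = 0, trep 1 (@gamma R) p1 x1 = 0 |
    trep 1 (@psi R) p2 x2 = 0] -> layer1 1 0 p0 p1 p2 x0 x1 x2 = 0.
  by rewrite /layer1 trep0; case=> ->; rewrite !(mul0r, mulr0).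
have [n2|[b2 [y2 _ loc2]]] := trep_cell x2.
  apply: caseA => *; [apply: z2|apply: z3]; exact/Or33/n2.
have [n1|[_ [y1 _ loc1]]] := trep_cell x1.
  apply: caseA => *; [apply: z2|apply: z3]; exact/Or32/n1.
have [h1|h1] := leP (5 / 16) `|y1|.
  apply: caseA => *; [apply: z2|apply: z3]; apply/Or32.
    by rewrite loc1// trep0 gamma_out ?mulr0.
  by rewrite loc1// trep0 beta_out ?mulr0//; lra.
have [h0|h0] := leP (3 / 16) `|x0|.
  have [n0|[b0 _]] := trep_cell x0; last by lra.
  apply: caseA => *; [apply: z2|apply: z3]; apply/Or31; last exact: n0.
  exact: beta_out.
have dB : (forall p0 p1 p2, layer2 1 0 p0 p1 p2 x0 x1 x2 = 0) -> indef hessG.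
  by apply: (caseB (ltW h0) b2 loc1 loc2); lra.
have [n0|[b0 [y0 _ loc0]]] := trep_cell x0.
  by apply: dB => *; apply: z3; exact/Or31/n0.
have [h1'|h1'] := leP (3 / 16) `|y1|.
  by apply: dB => *; apply/z3/Or32; rewrite loc1// trep0 beta_out ?mulr0.
have [h2|h2] := leP (5 / 16) `|y2|.
  by apply: dB => *; apply/z3/Or33; rewrite loc2// trep0 gamma_out ?mulr0.
by apply: (caseC b0 b2 loc0 loc1 loc2 (ltW h1')); lra.
Qed.

End indefinite.

(** * The sum of all cycles *)

Section corrector_properties.
Variable R : realType.

Let N : R := freq R.
Let k : R := kap R.
Let kE : k = 256^-1. Proof. by []. Qed.
Let k0 : 0 < k. Proof. by rewrite kE invr_gt0 ltr0n. Qed.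
Let N0 : 0 < N. Proof. exact: lt_le_trans (freq_ge4 R). Qed.
Let kX i : 0 <= k ^+ i. Proof. by rewrite exprn_ge0// ltW. Qed.

(** The pure second derivatives of the quadratic polynomial plus m cycles. *)
Definition corr_hess m (s e x0 x1 x2 : R) : 'I_3 -> R :=
  triple (- k ^+ 2 * s + corr m s e 2 0 0 x0 x1 x2)
         (e + corr m s e 0 2 0 x0 x1 x2)
         (k * s + corr m s e 0 0 2 x0 x1 x2).

Lemma triple_scale c a b d i :
  triple (c * a) (c * b) (c * d) i = c * triple a b d i :> R.
Proof. by rewrite /triple; case: (val i) => [|[|]]. Qed.

Lemma indef_ext (H H' : 'I_3 -> R) : H =1 H' -> indef H -> indef H'.
Proof. by move=> /funext ->. Qed.

Lemma corr_hess_no_tail s e (x0 x1 x2 : R) (G : nat -> nat -> nat -> R) :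
  s != 0 -> `|e| <= `|s| ->
  (forall p0 p1 p2, G p0 p1 p2 = cyc s e 0 p0 p1 p2 x0 x1 x2) ->
  indef (triple (- k ^+ 2 * s + G 2 0 0) (e + G 0 2 0) (k * s + G 0 0 2))%N.
Proof.
move=> s0 es GE; have e1 : `|e / s| <= 1.
  by rewrite normrM normfV ler_pdivrMr ?normr_gt0// mul1r.
apply: (indef_ext _ (indef_scale s0 (first_cycle_indef x0 x1 x2 e1))) => i.
rewrite -triple_scale !GE.
have cE p0 p1 p2 : cyc s e 0 p0 p1 p2 x0 x1 x2 =
    s * cyc 1 (e / s) 0 p0 p1 p2 x0 x1 x2.
  by rewrite -cyc_scale mulr1 mulrC divfK.
rewrite !cE; congr triple; first by rewrite mulrDr mulrC.
  by rewrite mulrDr [s * (e / s)]mulrC divfK.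
by rewrite mulrDr mulrC.
Qed.

(** All three layers at their cores: these contributions bring the diagonal to
    the initial form with the parameters of the next cycle. *)
Lemma cyc_in_core s e (x0 x1 x2 z0 z1 z2 : R) :
  `|x0| <= 8^-1 -> `|x1| <= 8^-1 -> `|x2| <= 8^-1 ->
  (forall i f p, cell_tower f -> trep i.+1 f p x0 = N ^+ p * trep i f p z0) ->
  (forall i f p, cell_tower f -> trep i.+1 f p x1 = N ^+ p * trep i f p z1) ->
  (forall i f p, cell_tower f -> trep i.+1 f p x2 = N ^+ p * trep i f p z2) ->
  `|z0| <= 5 / 16 -> `|z1| <= 8^-1 -> `|z2| <= 3 / 16 ->
  [/\ cyc s e 0 2 0 0 x0 x1 x2 = amp2 s * N ^+ 2,
      cyc s e 0 0 2 0 x0 x1 x2 = amp0 s e * N ^+ 2 &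
      cyc s e 0 0 0 2 x0 x1 x2 = amp1 s * N ^+ 2].
Proof.
move=> h0 h1 h2 loc0 loc1 loc2 c0 c1 c2.
have cb := cell_beta R; have cg := cell_gamma R; have cp := cell_psi R.
rewrite /cyc /layer0 /layer1 /layer2 !trep0 !loc0// !loc1// !loc2// !trep0.
rewrite !(@psi_in R) ?(@gamma_in R) ?(@beta_in R); try lra.
rewrite /= !expr0; split; ring.
Qed.

(** Induction on the number of cycles. If the remaining cycles vanish at x,
    only the first one counts. Otherwise x is in the core of the first
    cycle, where the Hessian is N^2 times that of m cycles with the new
    parameters, at the local coordinates of x. *)
Lemma corr_indef m s e (x0 x1 x2 : R) : s != 0 -> `|e| <= `|s| ->
  indef (corr_hess m s e x0 x1 x2).
Proof.
elim: m s e x0 x1 x2 => [|m IH] s e x0 x1 x2 s0 es.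
  rewrite /corr_hess /corr !big_ord0 !addr0.
  have e1 : `|e / s| <= 1.
    by rewrite normrM normfV ler_pdivrMr ?normr_gt0// mul1r.
  have h : indef (triple (- k ^+ 2) (e / s) k).
    have m0 : 0 < k ^+ 2 by rewrite kE; lra.
    have S3 : 3 <= 2 ^+ 78 * k ^+ 2 by rewrite kE; lra.
    apply: (indef_triple m0 S3); last by apply: Or43; rewrite kE; split; lra.
    by rewrite normrN !(@ger0_norm _ k, @ger0_norm _ (k ^+ 2)) kE; lra.
  apply: (indef_ext _ (indef_scale s0 h)) => i; rewrite -triple_scale.
  by congr triple; rewrite mulrC ?divfK// mulrN.
rewrite /corr_hess !corrS.
pose tail (p0 p1 p2 : nat) := \sum_(i < m) cyc
  (size_at (- kap R ^+ 3 * s) i)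
  (extra_at (- kap R ^+ 3 * s) (kap R ^+ 3 * s) i) i.+1 p0 p1 p2 x0 x1 x2.
rewrite -/(tail 2 0 0)%N -/(tail 0 2 0)%N -/(tail 0 0 2)%N.
have done_if : (forall p0 p1 p2, tail p0 p1 p2 = 0) ->
    indef (triple (- k ^+ 2 * s + (cyc s e 0 2 0 0 x0 x1 x2 + tail 2 0 0))
     (e + (cyc s e 0 0 2 0 x0 x1 x2 + tail 0 2 0))
     (k * s + (cyc s e 0 0 0 2 x0 x1 x2 + tail 0 0 2)))%N.
  move=> t0; apply: (@corr_hess_no_tail _ _ x0 x1 x2
    (fun p0 p1 p2 => cyc s e 0 p0 p1 p2 x0 x1 x2 + tail p0 p1 p2)) => //.
  by move=> *; rewrite t0 addr0.
have [n0|[h0 [z0 _ loc0]]] := trep_cell x0.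
  by apply: done_if => *; apply: big1 => i _; exact/cyc_shift0/Or31.
have [n1|[h1 [z1 _ loc1]]] := trep_cell x1.
  by apply: done_if => *; apply: big1 => i _; exact/cyc_shift0/Or32.
have [n2|[h2 [z2 _ loc2]]] := trep_cell x2.
  by apply: done_if => *; apply: big1 => i _; exact/cyc_shift0/Or33.
have tE p0 p1 p2 : tail p0 p1 p2 = N ^+ (p0 + p1 + p2) *
    corr m (- k ^+ 3 * s) (k ^+ 3 * s) p0 p1 p2 z0 z1 z2.
  by rewrite /corr mulr_sumr; apply: eq_bigr => i _; exact: cyc_shift.
have [out|] := boolP [|| 5 / 16 <= `|z0|, 8^-1 < `|z1| | 3 / 16 <= `|z2|].
  apply: done_if => *; rewrite tE /corr big1 ?mulr0// => i _.
  exact: cyc_core.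
rewrite !negb_or -!ltNge -leNgt => /and3P[c0 c1 c2].
have [-> -> ->] := cyc_in_core s e h0 h1 h2 loc0 loc1 loc2 (ltW c0) c1 (ltW c2).
have kn : k != 0 by rewrite gt_eqF.
have k3 : k ^+ 3 != 0 := expf_neq0 3 kn.
have s0' : - k ^+ 3 * s != 0 by rewrite mulf_neq0// oppr_eq0.
have es' : `|k ^+ 3 * s| <= `|- k ^+ 3 * s| by rewrite mulNr normrN.
have NN : N ^+ 2 != 0 by rewrite expf_neq0// gt_eqF.
apply: (indef_ext _ (indef_scale NN (IH _ _ z0 z1 z2 s0' es'))) => i.
have Nn : N != 0 by rewrite gt_eqF.
rewrite -triple_scale !tE /amp0 /amp1 /amp2 -/k -/N; congr triple; by field.
Qed.

Lemma size_atE (s : R) i : size_at s i = (-1) ^+ i * (k ^+ 3) ^+ i * s.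
Proof. by rewrite /size_at -exprMn mulN1r. Qed.

Lemma size_at_norm (s : R) i : `|size_at s i| = (k ^+ 3) ^+ i * `|s|.
Proof.
rewrite size_atE normrM normrMsign ger0_norm//.
by rewrite exprn_ge0.
Qed.

Lemma extra_at_norm (s e : R) i : `|e| <= `|s| -> `|extra_at s e i| <= `|size_at s i|.
Proof.
by case: i => [|i] es; rewrite /= ?normrN// /size_at expr0 mul1r.
Qed.

Let M : R := 2 ^+ 74.
Let ME : N ^+ 2 = M. Proof. by rewrite /N /freq /M -exprM. Qed.

Lemma amp0_bnd (s e : R) : `|e| <= `|s| -> `|amp0 s e| <= 9 / 8 * k ^+ 3 * `|s|.
Proof.
move=> es; apply: (le_trans (ler_normB _ _)); rewrite -/N -/k ME.
rewrite (normrM (k ^+ 3)) (normrM e) normfV (ger0_norm (kX 3)).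
rewrite (@ger0_norm _ M) ?exprn_ge0//.
apply: (@le_trans _ _ (k ^+ 3 * `|s| + `|s| / M)).
  by rewrite lerD2l ler_wpM2r// invr_ge0 exprn_ge0.
by have := normr_ge0 s; rewrite kE /M; lra.
Qed.

Lemma amp1_bnd (s : R) : `|amp1 s| <= 9 / 8 * k ^+ 4 * `|s|.
Proof.
rewrite /amp1 normrN -/N -/k ME.
have -> : k ^+ 4 * s + k * s / M = (k ^+ 4 + k / M) * s by ring.
rewrite normrM ler_wpM2r// ger0_norm; first by rewrite kE /M; lra.
by rewrite kE /M; lra.
Qed.

Lemma amp2_bnd (s : R) : `|amp2 s| <= 9 / 8 * k ^+ 5 * `|s|.
Proof.
rewrite /amp2 -/N -/k ME.
have -> : k ^+ 5 * s + k ^+ 2 * s / M = (k ^+ 5 + k ^+ 2 / M) * s by ring.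
rewrite normrM ler_wpM2r// ger0_norm; first by rewrite kE /M; lra.
by rewrite kE /M; lra.
Qed.

Lemma cyc_bnd (s e : R) i (x0 x1 x2 : R) : `|e| <= `|s| ->
  `|cyc s e i 0 0 0 x0 x1 x2| <= k ^+ 3 * `|s| / 4.
Proof.
move=> es; rewrite /cyc /layer0 /layer1 /layer2.
have t0 := mul_bnd (amp0_bnd es)
  (prod3_bnd (trep_gamma0 i x0) (trep_psi0 i.+1 x1) (trep_beta0 i x2)).
have t1 := mul_bnd (amp1_bnd s)
  (prod3_bnd (trep_beta0 i x0) (trep_gamma0 i.+1 x1) (trep_psi0 i.+1 x2)).
have t2 := mul_bnd (amp2_bnd s)
  (prod3_bnd (trep_psi0 i.+1 x0) (trep_beta0 i.+1 x1) (trep_gamma0 i.+1 x2)).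
apply: (le_trans (ler_normD _ _)); apply: (le_trans (lerD (ler_normD _ _) t2)).
apply: (le_trans (lerD (lerD t0 t1) (lexx _))).
by have := normr_ge0 s; rewrite kE; lra.
Qed.

(** The heights of the cycles decrease geometrically with ratio k^3; a
    telescoping sum replaces the geometric series. *)
Lemma corr_tail_bnd (s e : R) m m' (x0 x1 x2 : R) : `|e| <= `|s| -> (m <= m')%N ->
  `|corr m' s e 0 0 0 x0 x1 x2 - corr m s e 0 0 0 x0 x1 x2|
    <= k ^+ 3 * `|s| / 2 * (k ^+ 3) ^+ m.
Proof.
move=> es mm'; rewrite /corr -!(big_mkord xpredT (fun i => cyc (size_at s i)
  (extra_at s e i) i 0 0 0 x0 x1 x2)) (big_cat_nat _ mm')//= addrAC subrr add0r.
apply: (le_trans (ler_norm_sum _ _ _)).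
apply: (@le_trans _ _ (\sum_(m <= i < m')
   k ^+ 3 * `|s| / 2 * (- (k ^+ 3) ^+ i.+1 - - (k ^+ 3) ^+ i))).
  apply: ler_sum => i _.
  apply: (le_trans (cyc_bnd i x0 x1 x2 (extra_at_norm i es))).
  rewrite size_at_norm [(k ^+ 3) ^+ i.+1]exprS.
  have : 0 <= (k ^+ 3) ^+ i * `|s| by rewrite mulr_ge0// exprn_ge0.
  move: ((k ^+ 3) ^+ i) => q; rewrite kE; lra.
rewrite -mulr_sumr (@telescope_sumr _ _ _ (fun i => - (k ^+ 3) ^+ i))//.
have c0 : 0 <= k ^+ 3 * `|s| / 2.
  by apply: divr_ge0 => //; apply: mulr_ge0 (kX 3) _.
apply: (ler_wpM2l c0); rewrite opprK addrC gerBl.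
exact: exprn_ge0 (kX 3).
Qed.

Lemma corr_bnd (s e : R) m (x0 x1 x2 : R) : `|e| <= `|s| ->
  `|corr m s e 0 0 0 x0 x1 x2| <= k ^+ 3 * `|s| / 2.
Proof.
move=> es; have := corr_tail_bnd x0 x1 x2 es (leq0n m).
by rewrite /corr big_ord0 subr0 expr0 mulr1.
Qed.

Lemma corr_out (s e : R) m p0 p1 p2 (x0 x1 x2 : R) :
  [|| 2^-1 <= `|x0|, 2^-1 <= `|x1| | 2^-1 <= `|x2|] ->
  corr m s e p0 p1 p2 x0 x1 x2 = 0.
Proof.
move=> h; apply: big1 => i _; apply: cyc_core.
by case/or3P: h => h; apply/or3P; [apply: Or31|apply: Or32|apply: Or33]; lra.
Qed.

(** Everything of a generation beyond j lives where beta of generation j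
    equals 1: the copies in a cell fill |z| <= 1/8, where beta is 1. *)
Lemma trep_deep j i (f : nat -> R -> R) p t : cell_tower f -> (j <= i)%N ->
  trep j (@beta R) 0 t != 1 -> trep i.+1 f p t = 0.
Proof.
move=> cf ji; rewrite /trep muln0 expr0 mul1r => h.
have cfp : cellular (f p) by exact: cell_tower_cellular.
have -> : rep i.+1 (f p) t = rep j (rep (i - j).+1 (f p)) t.
  by rewrite /rep -iterD addnS subnKC.
have crf : cellular (rep (i - j).+1 (f p)) by exact: cellular_rep.
have [H|[z _ H]] := rep_cell j t; first by rewrite H ?mulr0.
rewrite H// repS copies_out ?mulr0//; first exact: cellular_rep.
rewrite ltNge; apply/negP => z8; move: h.
rewrite H ?beta_in ?eqxx//; last exact: cell_tower_cellular (cell_beta R).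
lra.
Qed.

Lemma cyc_deep (s e : R) j i p0 p1 p2 (x0 x1 x2 : R) : (j <= i)%N ->
  trep j (@beta R) 0 x1 != 1 -> cyc s e i p0 p1 p2 x0 x1 x2 = 0.
Proof.
move=> ji h; have cb := cell_beta R; have cg := cell_gamma R.
have cp := cell_psi R; rewrite /cyc /layer0 /layer1 /layer2.
by rewrite !(trep_deep _ _ ji h)// !(mul0r, mulr0) !addr0.
Qed.

Lemma corr_stable (s e : R) j m p0 p1 p2 (x0 x1 x2 : R) : (j <= m)%N ->
  trep j (@beta R) 0 x1 != 1 ->
  corr m s e p0 p1 p2 x0 x1 x2 = corr j s e p0 p1 p2 x0 x1 x2.
Proof.
move=> jm h; rewrite /corr -!(big_mkord xpredT (fun i => cyc (size_at s i)
  (extra_at s e i) i p0 p1 p2 x0 x1 x2)) (big_cat_nat _ jm)//=.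
rewrite [X in _ + X](_ : _ = 0) ?addr0//.
rewrite big_nat_cond big1// => i /andP[/andP[ji _] _].
exact: cyc_deep ji h.
Qed.

Lemma beta_stable j m (t : R) : (j <= m)%N ->
  trep j (@beta R) 0 t != 1 -> trep m (@beta R) 0 t != 1.
Proof.
case: m => [|m]; first by rewrite leqn0 => /eqP ->.
rewrite leq_eqVlt => /orP[/eqP ->//|jm h].
by rewrite (trep_deep _ (cell_beta R) _ h)// eq_sym oner_eq0.
Qed.

(** Profiles supported in |z| < 5/16 only meet the part of theta that is
    constant. *)
Lemma theta_kills j (f : R -> R) (t : R) : cellular f ->
  (forall z, 5 / 16 <= `|z| -> f z = 0) ->
  rep j f t * rep j (theta 1) t = 0.
Proof.
move=> cf f0; have ct := cell_tower_cellular 1 (cell_theta R).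
have [H|[z _ H]] := rep_cell j t; rewrite !H ?mul0r//.
have [h|h] := leP (5 / 16) `|z|; first by rewrite f0 ?mul0r.
by rewrite theta_flat ?mulr0 ?(ltW h).
Qed.

End corrector_properties.

(** * Operations on functions with continuous partial derivatives *)

Section class_C_closure.
Variables (R : realType) (n : nat) (U : set 'rV[R]_n).
Hypothesis oU : open U.
Let E := 'rV[R]_n.

Lemma iter_partial_rcons (V : normedModType R) (s : seq 'I_n) i (f : E -> V) :
  iter_partial (rcons s i) f = iter_partial s (partial i f).
Proof. by rewrite /iter_partial foldr_rcons. Qed.

Lemma class_CS (V : normedModType R) k (f : E -> V) :
  (forall x, U x -> {for x, continuous f}) ->
  (forall x i, U x -> derivable f x (delta_mx ord0 i)) ->
  (forall i, class_C k U (partial i f)) -> class_C k.+1 U f.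
Proof.
move=> cf df pf s; case/lastP: s => [|s i].
  by move=> _ x Ux; split=> [|_ i]; [exact: cf|exact: df].
rewrite size_rcons iter_partial_rcons => ks x Ux.
exact: (pf i s ks x Ux).
Qed.

Lemma class_C_partial (V : normedModType R) k (f : E -> V) i :
  class_C k.+1 U f -> class_C k U (partial i f).
Proof.
move=> cf s ks x Ux; rewrite -iter_partial_rcons.
have := cf (rcons s i); rewrite size_rcons ltnS => /(_ ks x Ux)[c d].
by split.
Qed.

Lemma class_C_continuous (V : normedModType R) k (f : E -> V) x :
  class_C k U f -> U x -> {for x, continuous f}.
Proof. by move=> cf Ux; have [] := cf [::] (leq0n _) x Ux. Qed.

Lemma class_C_derivable (V : normedModType R) k (f : E -> V) x i :
  class_C k.+1 U f -> U x -> derivable f x (delta_mx ord0 i).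
Proof. by move=> cf Ux; have [_] := cf [::] (leq0n _) x Ux; apply. Qed.

Lemma class_C0 (V : normedModType R) (f : E -> V) :
  (forall x, U x -> {for x, continuous f}) -> class_C 0 U f.
Proof. by move=> cf s; case: s => [|//] _ x Ux; split=> //; exact: cf. Qed.

Lemma class_C_leq (V : normedModType R) k l (f : E -> V) : (k <= l)%N ->
  class_C l U f -> class_C k U f.
Proof.
move=> kl cf s sk x Ux; have [c d] := cf s (leq_trans sk kl) x Ux.
by split=> // sk'; apply: d; exact: leq_trans sk' kl.
Qed.

Lemma class_C_ext (V : normedModType R) k (f g : E -> V) :
  (forall x, U x -> f x = g x) -> class_C k U f -> class_C k U g.
Proof.
have nearU x (f' g' : E -> V) : U x -> (forall x, U x -> f' x = g' x) ->
    \near x, f' x = g' x.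
  by move=> Ux fg; near=> y; apply: fg; near: y; exact: open_nbhs_nbhs.
have cont x (f' g' : E -> V) : U x -> (forall x, U x -> f' x = g' x) ->
    {for x, continuous f'} -> {for x, continuous g'}.
  move=> Ux fg cf; have e := nearU _ _ _ Ux fg.
  rewrite /prop_for /continuous_at -(fg _ Ux).
  exact: cvg_trans (near_eq_cvg e) cf.
elim: k f g => [|k IH] f g fg cf.
  apply: class_C0 => x Ux; apply: (cont _ _ _ Ux fg).
  exact: (class_C_continuous cf Ux).
apply: class_CS => [x Ux|x i Ux|i].
- by apply: (cont _ _ _ Ux fg); exact: (class_C_continuous cf Ux).
- apply: (near_eq_derivable (nearU _ _ _ Ux fg)).
  exact: class_C_derivable cf Ux.
- apply: IH (class_C_partial i cf) => x Ux.
  by apply: near_eq_derive; exact: nearU.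
Unshelve. all: by end_near. Qed.

(** Reduces the order by means of explicit first derivatives, so that
    closure properties follow by induction on k. *)
Lemma class_C_intro (V : normedModType R) k (f : E -> V) (g : 'I_n -> E -> V) :
  (forall x, U x -> {for x, continuous f}) ->
  (forall i x, U x -> is_derive x (delta_mx ord0 i) f (g i x)) ->
  (forall i, class_C k U (g i)) -> class_C k.+1 U f.
Proof.
move=> cf dg cg; apply: class_CS => // [x i Ux|i].
  by case: (dg i x Ux).
by apply: class_C_ext (cg i) => x Ux; rewrite /partial; case: (dg i x Ux).
Qed.

Lemma class_C_is_derive k (f : E -> R) x i : class_C k.+1 U f -> U x ->
  is_derive x (delta_mx ord0 i) f (partial i f x).
Proof. by move=> cf Ux; apply: derivableP; exact: class_C_derivable cf Ux. Qed.

Lemma class_C_cst k (V : normedModType R) (c : V) : class_C k U (fun=> c).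
Proof.
elim: k c => [|k IH] c; first by apply: class_C0 => x _; exact: cst_continuous.
apply: (@class_C_intro _ _ _ (fun _ _ => 0)) => [x _|i].
  exact: cst_continuous.
exact: IH.
Qed.

Lemma class_C_add k (V : normedModType R) (f g : E -> V) :
  class_C k U f -> class_C k U g -> class_C k U (fun x => f x + g x).
Proof.
elim: k f g => [|k IH] f g cf cg.
  apply: class_C0 => x Ux.
  exact: (continuousD (class_C_continuous cf Ux) (class_C_continuous cg Ux)).
apply: (@class_C_intro _ _ _ (fun i x => partial i f x + partial i g x)).
- move=> x Ux.
  exact: (continuousD (class_C_continuous cf Ux) (class_C_continuous cg Ux)).
- move=> i x Ux.
  have df := derivableP (class_C_derivable (i := i) cf Ux).
  have dg := derivableP (class_C_derivable (i := i) cg Ux).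
  by have := is_deriveD df dg.
- by move=> i; apply: IH; exact: class_C_partial.
Qed.

Lemma class_C_mul k (f g : E -> R) :
  class_C k U f -> class_C k U g -> class_C k U (fun x => f x * g x).
Proof.
elim: k f g => [|k IH] f g cf cg.
  apply: class_C0 => x Ux.
  exact: (continuousM (class_C_continuous cf Ux) (class_C_continuous cg Ux)).
apply: (@class_C_intro _ _ _
  (fun i x => partial i f x * g x + f x * partial i g x)).
- move=> x Ux.
  exact: (continuousM (class_C_continuous cf Ux) (class_C_continuous cg Ux)).
- move=> i x Ux.
  exact: (is_derive_mul (class_C_is_derive i cf Ux)
    (class_C_is_derive i cg Ux)).
- move=> i; have lk := class_C_leq (leqnSn k).
  by apply: class_C_add; apply: IH;
    do ?[exact: class_C_partial|exact: lk].
Qed.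

Lemma is_derive_scale (V : normedModType R) (f : E -> R) (c : V) x v a :
  is_derive x v f a -> is_derive x v (fun y => f y *: c) (a *: c).
Proof.
move=> [df fa].
have h : (fun h : R => h^-1 *: (((fun y => f y *: c) \o shift x) (h *: v)
    - f x *: c)) @ 0^' --> a *: c.
  have -> : (fun h : R => h^-1 *: (((fun y => f y *: c) \o shift x) (h *: v)
    - f x *: c)) =
    (fun h : R => (h^-1 *: ((f \o shift x) (h *: v) - f x)) *: c).
    by apply/funext => h; rewrite /= -scalerBl scalerA.
  apply: cvgZr_tmp; rewrite -fa; exact: df.
by split; [apply/cvg_ex; exists (a *: c)|exact/cvg_lim].
Qed.

Lemma class_C_scale k (V : normedModType R) (f : E -> R) (c : V) :
  class_C k U f -> class_C k U (fun x => f x *: c).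
Proof.
elim: k f => [|k IH] f cf.
  apply: class_C0 => x Ux.
  exact: (continuousZr_tmp (class_C_continuous cf Ux)).
apply: (@class_C_intro _ _ _ (fun i x => partial i f x *: c)) => [x Ux|i x Ux|i].
- exact: (continuousZr_tmp (class_C_continuous cf Ux)).
- exact: (is_derive_scale c (class_C_is_derive i cf Ux)).
- by apply: IH; exact: class_C_partial.
Qed.

Lemma class_C_sum k (V : normedModType R) m (f : 'I_m -> E -> V) :
  (forall i, class_C k U (f i)) -> class_C k U (fun x => \sum_(i < m) f i x).
Proof.
elim: m f => [|m IH] f cf.
  have h := @class_C_cst k V 0.
  by apply: class_C_ext h => x _; rewrite big_ord0.
apply: (@class_C_ext _ _ (fun x =>
  f ord0 x + \sum_(i < m) f (lift ord0 i) x)) => [x _|].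
  by rewrite big_ord_recl.
by apply: class_C_add => //; apply: IH.
Qed.

Lemma class_C_tower k (h : nat -> R -> R) (f : E -> R) p : is_tower h ->
  class_C k U f -> class_C k U (fun x => h p (f x)).
Proof.
move=> th; elim: k f p => [|k IH] f p cf.
  apply: class_C0 => x Ux; apply: continuous_comp.
    exact: (class_C_continuous cf Ux).
  exact: tower_continuous.
apply: (@class_C_intro _ _ _ (fun i x => h p.+1 (f x) * partial i f x)).
- move=> x Ux; apply: continuous_comp; first exact: (class_C_continuous cf Ux).
  exact: tower_continuous.
- move=> i x Ux.
  exact: (is_derive_chain (class_C_is_derive i cf Ux) (th p (f x))).
- move=> i; apply: class_C_mul; last exact: class_C_partial.
  by apply: IH; exact: class_C_leq (leqnSn k) cf.
Qed.

Lemma class_C_exp k (f : E -> R) p :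
  class_C k U f -> class_C k U (fun x => f x ^+ p).
Proof.
move=> cf; elim: p => [|p IH].
  have h := @class_C_cst k R 1.
  by apply: class_C_ext h => x _; rewrite expr0.
have h := class_C_mul cf IH.
by apply: class_C_ext h => x _; rewrite exprS.
Qed.

(** Functions h with h' = c h^p can be composed with f without knowing their
    higher derivatives. The cases used are the inverse and the inverse
    square root. *)
Lemma class_C_ode k (h : R -> R) (D : set R) c p (f : E -> R) :
  (forall x : R, D x -> is_derive x 1 h (c * h x ^+ p)) ->
  (forall x, U x -> D (f x)) ->
  class_C k U f -> class_C k U (fun x => h (f x)).
Proof.
move=> dh fD; elim: k f fD => [|k IH] f fD cf.
  apply: class_C0 => x Ux; apply: continuous_comp.
    exact: (class_C_continuous cf Ux).
  have [d _] := dh _ (fD x Ux).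
  by apply: differentiable_continuous; apply/derivable1_diffP.
apply: (@class_C_intro _ _ _ (fun i x => c * h (f x) ^+ p * partial i f x)).
- move=> x Ux; apply: continuous_comp; first exact: (class_C_continuous cf Ux).
  have [d _] := dh _ (fD x Ux).
  by apply: differentiable_continuous; apply/derivable1_diffP.
- move=> i x Ux.
  exact: (is_derive_chain (class_C_is_derive i cf Ux) (dh _ (fD x Ux))).
- move=> i; apply: class_C_mul; last exact: class_C_partial.
  apply: class_C_mul; first exact: class_C_cst.
  by apply: class_C_exp; apply: IH => //; exact: class_C_leq (leqnSn k) cf.
Qed.

End class_C_closure.

Section coordinates.
Variables (R : realType) (n : nat).
Let E := 'rV[R]_n.

Lemma is_derive_coord (x : E) (i j : 'I_n) :
  is_derive x (delta_mx ord0 i) (fun y : E => y ord0 j) ((j == i)%:R : R).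
Proof.
have h : (fun h : R => h^-1 *: (((fun y : E => y ord0 j) \o shift x)
    (h *: delta_mx ord0 i) - x ord0 j)) @ 0^' --> ((j == i)%:R : R).
  apply: (@cvg_trans _ ((fun=> (j == i)%:R : R) @ 0^')); last exact: cvg_cst.
  apply: near_eq_cvg; near=> h; rewrite /= !mxE eqxx/= addrK.
  rewrite scalerA mulVf ?scale1r//.
  by near: h; exact: nbhs_dnbhs_neq.
by split; [apply/cvg_ex; exists (j == i)%:R|exact/cvg_lim].
Unshelve. all: by end_near. Qed.

Lemma coord_continuous_rV (j : 'I_n) : continuous (fun y : E => y ord0 j).
Proof. exact: coord_continuous. Qed.

Lemma class_C_coord k (U : set E) (j : 'I_n) : open U ->
  class_C k U (fun y : E => y ord0 j).
Proof.
move=> oU; case: k => [|k].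
  by apply: class_C0 => x _; exact: coord_continuous_rV.
apply: (@class_C_intro R n U oU R k (fun y : E => y ord0 j)
  (fun i _ => (j == i)%:R)).
- by move=> x _; exact: coord_continuous_rV.
- by move=> i x _; exact: is_derive_coord.
- by move=> i; exact: class_C_cst.
Qed.

End coordinates.

(** * Elliptic coefficients from an indefinite Hessian *)

Section coefficients.
Variable R : realType.
Implicit Types H : 'I_3 -> R.

Definition inv_sqrt (q : R) : R := (Num.sqrt q)^-1.

Lemma is_derive_inv_sqrt (q : R) : 0 < q ->
  is_derive q 1 inv_sqrt (- 2^-1 * inv_sqrt q ^+ 3).
Proof.
move=> q0; have s0 : Num.sqrt q != 0 by rewrite gt_eqF// sqrtr_gt0.
refine (is_derive_eq (is_deriveV s0 (is_derive1_sqrt q0)) _).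
rewrite -[LHS]/(_ * _) /inv_sqrt; field.
by rewrite s0.
Qed.

Lemma is_derive_inv (q : R) : q != 0 ->
  is_derive q 1 (fun y : R => y^-1) (-1 * (q^-1) ^+ 2).
Proof.
move=> q0; refine (is_derive_eq (is_deriveV q0 (is_derive_id q 1)) _).
by rewrite -[LHS]/(_ * _) mulr1 mulN1r exprVn.
Qed.

Definition normalized H (i : 'I_3) : R := H i * inv_sqrt (\sum_j H j ^+ 2).

(** A smooth substitute for the indicator of positive numbers, with values
    exactly 0 for h <= 0 and 1 for h >= 2^-78. *)
Definition weight (h : R) : R := @smooth_step R 0 (2 ^+ 78 * h).

Definition pos_mass (h : 'I_3 -> R) : R := \sum_i weight (h i) * h i.

(** For a unit vector h with sum t the identity matrix gives the product t.
    The second term lowers it by 2 + t, using negative entries only, and the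
    third raises it by 2, using positive entries only. As 2 + t >= 0, both
    terms are nonnegative and the result stays above the identity. *)
Definition coef_hat (h : 'I_3 -> R) (i : 'I_3) : R :=
  1 + (2 + \sum_j h j) * (pos_mass (fun j => - h j))^-1 * weight (- h i)
    + 2 * (pos_mass h)^-1 * weight (h i).

Definition coef H : 'I_3 -> R := coef_hat (normalized H).

Lemma weight_itv (h : R) : 0 <= weight h <= 1.
Proof. exact: smooth_step_itv. Qed.

Lemma weight_pos (h : R) : 0 <= weight h * h.
Proof.
have [h0|h0] := leP h 0; last first.
  by rewrite mulr_ge0 ?(ltW h0)//; case/andP: (weight_itv h).
rewrite /weight smooth_step_le0 ?mul0r//.
by rewrite mulr_ge0_le0// exprn_ge0.
Qed.

Lemma pos_mass_ge (h : 'I_3 -> R) i : 1 <= 2 ^+ 78 * h i ->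
  1 <= 2 ^+ 78 * pos_mass h.
Proof.
move=> hi; apply: (le_trans hi); rewrite ler_pM2l ?exprn_gt0//.
rewrite /pos_mass (bigD1 i)//= {1}/weight smooth_step_ge1//= mul1r lerDl.
by apply: sumr_ge0 => j _; exact: weight_pos.
Qed.

Definition unit_indef (h : 'I_3 -> R) : Prop :=
  [/\ \sum_i h i ^+ 2 = 1, exists i, 1 <= 2 ^+ 78 * h i &
      exists i, 1 <= 2 ^+ 78 * - h i].

Lemma indef_sum_sqr H : indef H -> 0 < \sum_i H i ^+ 2.
Proof.
move=> [S0 _ _]; rewrite lt_neqAle sumr_ge0 ?andbT => [|i _]; last exact: sqr_ge0.
rewrite eq_sym; apply: contraTN S0 => /eqP/psumr_eq0P H0.
rewrite -leNgt big1// => i _.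
have /eqP := H0 (fun i _ => sqr_ge0 (H i)) i isT.
by rewrite sqrf_eq0 => /eqP ->; rewrite normr0.
Qed.

Lemma normalized_indef H : indef H -> unit_indef (normalized H).
Proof.
move=> iH; have q0 := indef_sum_sqr iH; case: iH => S0 [i Hi] [j Hj].
have r0 : 0 < Num.sqrt (\sum_i H i ^+ 2) by rewrite sqrtr_gt0.
have rS : Num.sqrt (\sum_i H i ^+ 2) <= \sum_i `|H i|.
  rewrite -[leRHS]ger0_norm ?(ltW S0)// -sqrtr_sqr ler_sqrt ?sqr_ge0//.
  rewrite !big_ord_recr !big_ord0/= !add0r.
  have sq (y : R) : y ^+ 2 = `|y| ^+ 2 by rewrite real_normK ?num_real.
  rewrite ![H _ ^+ 2]sq.
  set a := `|_|; set b := `|_|; set c := `|_|.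
  have ab : 0 <= a * b := mulr_ge0 (normr_ge0 _) (normr_ge0 _).
  have bc : 0 <= b * c := mulr_ge0 (normr_ge0 _) (normr_ge0 _).
  have ac : 0 <= a * c := mulr_ge0 (normr_ge0 _) (normr_ge0 _).
  rewrite !expr2; lra.
split.
- rewrite /normalized /inv_sqrt; under eq_bigr do rewrite exprMn.
  by rewrite -mulr_suml exprVn sqr_sqrtr ?(ltW q0)// divff// gt_eqF.
- exists i; rewrite /normalized /inv_sqrt mulrA ler_pdivlMr// mul1r.
  exact: le_trans rS Hi.
- exists j; rewrite /normalized /inv_sqrt -mulNr mulrA ler_pdivlMr// mul1r mulrN.
  exact: le_trans rS Hj.
Qed.

Section coef_hat.
Variable h : 'I_3 -> R.
Hypothesis uh : unit_indef h.

Lemma pos_mass_gt0 : 0 < pos_mass h.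
Proof.
case: uh => _ [i hi] _; have := pos_mass_ge hi.
by move=> /(lt_le_trans ltr01); rewrite pmulr_rgt0// exprn_gt0.
Qed.

Lemma neg_mass_gt0 : 0 < pos_mass (fun j => - h j).
Proof.
case: uh => _ _ [i hi]; have := @pos_mass_ge (fun j => - h j) _ hi.
by move=> /(lt_le_trans ltr01); rewrite pmulr_rgt0// exprn_gt0.
Qed.

Lemma coef_hat_dot : \sum_i coef_hat h i * h i = 0.
Proof.
have p0 := pos_mass_gt0; have n0 := neg_mass_gt0.
set t := \sum_j h j; set p := pos_mass h; set n := pos_mass (fun j => - h j).
have -> : \sum_i coef_hat h i * h i =
    t + (2 + t) * n^-1 * - n + 2 * p^-1 * p.
  rewrite /coef_hat -/t -/n -/p {2}/t {3}/n {3}/p /pos_mass.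
  rewrite -sumrN !mulr_sumr -!big_split /=; apply: eq_bigr => i _; ring.
by field; rewrite !gt_eqF.
Qed.

Lemma sum_unit_bnd : 0 <= 2 + \sum_j h j <= 4.
Proof.
case: uh => + _ _; rewrite !big_ord_recr !big_ord0/= !add0r.
move: (h _) (h _) (h _) => a b c abc.
have t2 : (c + b + a) * (c + b + a) <= 3.
  have := sqr_ge0 (a - b); have := sqr_ge0 (b - c); have := sqr_ge0 (a - c).
  move: abc; rewrite !expr2; lra.
move: (c + b + a) t2 => t t2; have := sqr_ge0 (t - 2); have := sqr_ge0 (t + 2).
rewrite !expr2 => h1 h2; apply/andP; split; lra.
Qed.

Lemma coef_hat_ge1 i : 1 <= coef_hat h i.
Proof.
have /andP[t0 _] := sum_unit_bnd.
have p0 := pos_mass_gt0; have n0 := neg_mass_gt0.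
have /andP[w0 _] := weight_itv (h i).
have /andP[v0 _] := weight_itv (- h i).
rewrite /coef_hat -addrA lerDl.
by rewrite addr_ge0// mulr_ge0// mulr_ge0// invr_ge0 ltW.
Qed.

Lemma coef_hat_le i : coef_hat h i <= 2 ^+ 81.
Proof.
have /andP[t0 t4] := sum_unit_bnd.
have p0 := pos_mass_gt0; have n0 := neg_mass_gt0.
have /andP[w0 w1] := weight_itv (h i).
have /andP[v0 v1] := weight_itv (- h i).
case: (uh) => _ [k hk] [l hl].
have pP : (pos_mass h)^-1 <= 2 ^+ 78.
  by rewrite -[_^-1]mul1r ler_pdivrMr// (pos_mass_ge hk).
have nP : (pos_mass (fun j => - h j))^-1 <= 2 ^+ 78.
  by rewrite -[_^-1]mul1r ler_pdivrMr// (@pos_mass_ge (fun j => - h j) _ hl).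
have a1 : (2 + \sum_j h j) * (pos_mass (fun j => - h j))^-1 * weight (- h i)
    <= 4 * 2 ^+ 78 * 1.
  by rewrite !ler_pM// ?mulr_ge0// invr_ge0 ltW.
have a2 : 2 * (pos_mass h)^-1 * weight (h i) <= 2 * 2 ^+ 78 * 1.
  by rewrite !ler_pM// ?mulr_ge0// invr_ge0 ltW.
rewrite /coef_hat; lra.
Qed.

End coef_hat.

Lemma coef_dot H : indef H -> \sum_i coef H i * H i = 0.
Proof.
move=> iH; have q0 := indef_sum_sqr iH.
have r0 : inv_sqrt (\sum_j H j ^+ 2) != 0.
  by rewrite invr_eq0 gt_eqF// sqrtr_gt0.
have := coef_hat_dot (normalized_indef iH).
rewrite /normalized; under eq_bigr do rewrite mulrA.
by rewrite -mulr_suml => /eqP; rewrite mulf_eq0 (negPf r0) orbF => /eqP.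
Qed.

(** The masses are at least 2^-78, so the coefficients are at most 1 + 4 *
    2^78 + 2 * 2^78. *)
Lemma coef_bnd H i : indef H -> 1 <= coef H i <= 2 ^+ 81.
Proof.
by move=> /normalized_indef uH; rewrite coef_hat_ge1// coef_hat_le.
Qed.

Lemma class_C_coef n (U : set 'rV[R]_n) k (H : 'rV[R]_n -> 'I_3 -> R) i :
  open U -> (forall x, U x -> indef (H x)) ->
  (forall j, class_C k U (fun x => H x j)) ->
  class_C k U (fun x => coef (H x) i).
Proof.
move=> oU iH cH.
have cq : class_C k U (fun x => \sum_j H x j ^+ 2).
  by apply: (class_C_sum oU) => j; exact: (class_C_exp oU 2 (cH j)).
have q0 x : U x -> 0 < \sum_j H x j ^+ 2.
  by move=> Ux; exact: indef_sum_sqr (iH x Ux).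
have cr : class_C k U (fun x => inv_sqrt (\sum_j H x j ^+ 2)).
  exact: (class_C_ode oU (D := [set q : R | 0 < q]) is_derive_inv_sqrt q0 cq).
have cn j : class_C k U (fun x => normalized (H x) j).
  exact: (class_C_mul oU (cH j) cr).
have cN j : class_C k U (fun x => - normalized (H x) j).
  have h := class_C_mul oU (@class_C_cst _ _ _ oU k R (-1)) (cn j).
  by apply: (class_C_ext oU _ h) => x _; exact: mulN1r.
have cw (f : 'rV[R]_n -> R) : class_C k U f -> class_C k U (fun x => weight (f x)).
  move=> cf; have h := class_C_mul oU (@class_C_cst _ _ _ oU k R (2 ^+ 78)) cf.
  exact: (class_C_tower oU 0 (@is_tower_smooth_step R) h).
have cm (f : 'rV[R]_n -> 'I_3 -> R) : (forall j, class_C k U (fun x => f x j)) ->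
    class_C k U (fun x => pos_mass (f x)).
  move=> cf; rewrite /pos_mass; apply: (class_C_sum oU) => j.
  exact: (class_C_mul oU (cw _ (cf j)) (cf j)).
have cinv (f : 'rV[R]_n -> R) : (forall x, U x -> f x != 0) ->
    class_C k U f -> class_C k U (fun x => (f x)^-1).
  move=> f0 cf.
  exact: (class_C_ode oU (D := [set q : R | q != 0]) is_derive_inv f0 cf).
have cc c : class_C k U (fun _ : 'rV[R]_n => c : R).
  exact: (@class_C_cst _ _ _ oU k R).
have p0 x : U x -> pos_mass (normalized (H x)) != 0.
  by move=> Ux; rewrite gt_eqF// pos_mass_gt0//; exact/normalized_indef/iH.
have n0 x : U x -> pos_mass (fun j => - normalized (H x) j) != 0.
  by move=> Ux; rewrite gt_eqF// neg_mass_gt0//; exact/normalized_indef/iH.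
have cp := class_C_mul oU (cc 2) (cinv _ p0 (cm _ cn)).
have cs := class_C_add oU (cc 2) (class_C_sum oU cn).
have cneg := class_C_mul oU cs
  (cinv _ n0 (cm (fun x j => - normalized (H x) j) cN)).
have h1 := class_C_mul oU cneg (cw _ (cN i)).
have h2 := class_C_mul oU cp (cw _ (cn i)).
exact: (class_C_add oU (class_C_add oU (cc 1) h1) h2).
Qed.

End coefficients.

(** * The approximate solutions and their equations *)

Definition c0 : 'I_3 := Ordinal (isT : (0 < 3)%N).
Definition c1 : 'I_3 := Ordinal (isT : (1 < 3)%N).
Definition c2 : 'I_3 := Ordinal (isT : (2 < 3)%N).

Lemma I3P (P : 'I_3 -> Prop) : P c0 -> P c1 -> P c2 -> forall i, P i.
Proof.
move=> p0 p1 p2 [[|[|[|//]]] h].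
- by have -> : Ordinal h = c0 by exact: val_inj.
- by have -> : Ordinal h = c1 by exact: val_inj.
- by have -> : Ordinal h = c2 by exact: val_inj.
Qed.

Lemma sum_I3 (V : nmodType) (F : 'I_3 -> V) : \sum_i F i = F c0 + F c1 + F c2.
Proof.
rewrite !big_ord_recr big_ord0 /= add0r.
have -> : widen_ord (leqnSn 2) (widen_ord (leqnSn 1) ord_max) = c0.
  exact: val_inj.
have -> : widen_ord (leqnSn 2) ord_max = c1 by exact: val_inj.
by have -> : ord_max = c2 by exact: val_inj.
Qed.

Section approximants.
Variable R : realType.
Let E := 'rV[R]_3.
Let k : R := kap R.

Definition on_coords (F : R -> R -> R -> R) (x : E) : R :=
  F (x ord0 c0) (x ord0 c1) (x ord0 c2).

Lemma is_derive_tensor (f g h : R -> R) (a b d : R) (x : E) i :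
  is_derive (x ord0 c0) 1 f a -> is_derive (x ord0 c1) 1 g b ->
  is_derive (x ord0 c2) 1 h d ->
  is_derive x (delta_mx ord0 i) (on_coords (fun r s t => f r * g s * h t))
   ((c0 == i)%:R * (a * g (x ord0 c1) * h (x ord0 c2))
    + (c1 == i)%:R * (f (x ord0 c0) * b * h (x ord0 c2))
    + (c2 == i)%:R * (f (x ord0 c0) * g (x ord0 c1) * d)).
Proof.
move=> fa gb hd.
have Df := is_derive_chain (is_derive_coord x i c0) fa.
have Dg := is_derive_chain (is_derive_coord x i c1) gb.
have Dh := is_derive_chain (is_derive_coord x i c2) hd.
refine (is_derive_eq (is_derive_mul (is_derive_mul Df Dg) Dh) _); ring.
Qed.

Lemma is_derive_cyc s e j p0 p1 p2 (x : E) i :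
  is_derive x (delta_mx ord0 i) (on_coords (cyc s e j p0 p1 p2))
   ((c0 == i)%:R * on_coords (cyc s e j p0.+1 p1 p2) x
    + (c1 == i)%:R * on_coords (cyc s e j p0 p1.+1 p2) x
    + (c2 == i)%:R * on_coords (cyc s e j p0 p1 p2.+1) x).
Proof.
have tb l := is_tower_trep l (cell_beta R).1.
have tg l := is_tower_trep l (cell_gamma R).1.
have tp l := is_tower_trep l (cell_psi R).1.
have D0 := is_derive_cmul (amp0 s e)
  (is_derive_tensor i (tg j p0 _) (tp j.+1 p1 _) (tb j p2 _)).
have D1 := is_derive_cmul (amp1 s)
  (is_derive_tensor i (tb j p0 _) (tg j.+1 p1 _) (tp j.+1 p2 _)).
have D2 := is_derive_cmul (amp2 s)
  (is_derive_tensor i (tp j.+1 p0 _) (tb j.+1 p1 _) (tg j.+1 p2 _)).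
refine (is_derive_eq (is_derive_add (is_derive_add (D0 x) (D1 x)) (D2 x)) _).
rewrite /on_coords /cyc /layer0 /layer1 /layer2; ring.
Qed.

Lemma is_derive_corr m s e p0 p1 p2 (x : E) i :
  is_derive x (delta_mx ord0 i) (on_coords (corr m s e p0 p1 p2))
   ((c0 == i)%:R * on_coords (corr m s e p0.+1 p1 p2) x
    + (c1 == i)%:R * on_coords (corr m s e p0 p1.+1 p2) x
    + (c2 == i)%:R * on_coords (corr m s e p0 p1 p2.+1) x).
Proof.
rewrite /on_coords /corr !mulr_sumr -!big_split/=.
by apply: is_derive_bigsum => j; exact: is_derive_cyc.
Qed.

(** Chosen so that k s + k^2 s = 1. Then the part of [base] that is not a
    multiple of |x|^2 - 4 is 1 - x_0^2 / 2, the prescribed boundary values. *)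
Definition scale0 : R := (k + k ^+ 2)^-1.
Definition extra0 : R := k * scale0.

Let k0 : 0 < k. Proof. by rewrite /k /kap invr_gt0 ltr0n. Qed.

Lemma scale0_gt0 : 0 < scale0.
Proof. by rewrite invr_gt0 addr_gt0// exprn_gt0. Qed.

Lemma scale0E : k * scale0 + k ^+ 2 * scale0 = 1.
Proof. by rewrite -mulrDl divff// gt_eqF// addr_gt0// exprn_gt0. Qed.

Lemma extra0_le : `|extra0| <= `|scale0|.
Proof.
rewrite /extra0 normrM (gtr0_norm k0) ler_piMl//.
by rewrite /k /kap invf_le1 ?ltr0n// ler1n.
Qed.

Definition base_hess : 'I_3 -> R :=
  triple (- k ^+ 2 * scale0) extra0 (k * scale0).

Definition base (x : E) : R :=
  (1 - 2 * k * scale0) + \sum_j base_hess j / 2 * (x ord0 j * x ord0 j).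

Definition approx_sol m (x : E) : R :=
  base x + on_coords (corr m scale0 extra0 0 0 0) x.

Definition approx_hess m (x : E) : 'I_3 -> R :=
  corr_hess m scale0 extra0 (x ord0 c0) (x ord0 c1) (x ord0 c2).

Lemma approx_hess_indef m x : indef (approx_hess m x).
Proof.
by apply: corr_indef; [rewrite gt_eqF// scale0_gt0|exact: extra0_le].
Qed.

Lemma is_derive_base (x : E) i :
  is_derive x (delta_mx ord0 i) base (base_hess i * x ord0 i).
Proof.
have D j : is_derive x (delta_mx ord0 i)
    (fun y : E => base_hess j / 2 * (y ord0 j * y ord0 j))
    (base_hess j * x ord0 j * (j == i)%:R).
  have d := is_derive_coord x i j.
  by refine (is_derive_eq (is_derive_cmul _ (is_derive_mul d d)) _); field.
refine (is_derive_eq (is_derive_add (is_derive_const x _ _)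
  (is_derive_bigsum D)) _).
rewrite add0r (bigD1 i)//= eqxx mulr1 big1 ?addr0// => j /negPf ->.
by rewrite mulr0.
Qed.

Lemma is_derive_approx m (x : E) i :
  is_derive x (delta_mx ord0 i) (approx_sol m)
   (base_hess i * x ord0 i +
   ((c0 == i)%:R * on_coords (corr m scale0 extra0 1 0 0) x
    + (c1 == i)%:R * on_coords (corr m scale0 extra0 0 1 0) x
    + (c2 == i)%:R * on_coords (corr m scale0 extra0 0 0 1) x)).
Proof.
by apply: is_derive_add; [exact: is_derive_base|exact: is_derive_corr].
Qed.

Lemma partial_approx m i (x : E) : partial i (approx_sol m) x =
   base_hess i * x ord0 i +
   ((c0 == i)%:R * on_coords (corr m scale0 extra0 1 0 0) x
    + (c1 == i)%:R * on_coords (corr m scale0 extra0 0 1 0) x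
    + (c2 == i)%:R * on_coords (corr m scale0 extra0 0 0 1) x).
Proof. by rewrite /partial; case: (is_derive_approx m x i). Qed.

Lemma hessian_approx m (x : E) i :
  hessian (approx_sol m) x i i = approx_hess m x i.
Proof.
rewrite mxE /partial.
have -> : (fun y => 'D_(delta_mx ord0 i) (approx_sol m) y) = fun x =>
   base_hess i * x ord0 i +
   ((c0 == i)%:R * on_coords (corr m scale0 extra0 1 0 0) x
    + (c1 == i)%:R * on_coords (corr m scale0 extra0 0 1 0) x
    + (c2 == i)%:R * on_coords (corr m scale0 extra0 0 0 1) x).
  by apply/funext => y; rewrite -partial_approx.
have D := is_derive_add
  (is_derive_cmul (base_hess i) (is_derive_coord x i i))
  (is_derive_add (is_derive_add
    (is_derive_cmul (c0 == i)%:R (is_derive_corr m scale0 extra0 1 0 0 x i))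
    (is_derive_cmul (c1 == i)%:R (is_derive_corr m scale0 extra0 0 1 0 x i)))
    (is_derive_cmul (c2 == i)%:R (is_derive_corr m scale0 extra0 0 0 1 x i))).
have -> := @derive_val _ _ _ _ _ _ _ D.
rewrite /approx_hess /corr_hess /base_hess eqxx mulr1 /on_coords.
by elim/I3P: i {D} => /=; rewrite /triple/= ?(mul1r, mul0r, addr0, add0r).
Qed.

(** Written as a combination of constant matrices, in order that smoothness
    reduces to that of the entries. *)
Definition coef_mx m (x : E) : 'M[R]_3 :=
  \sum_i coef (approx_hess m x) i *: delta_mx i i.

Lemma coef_mxE m x : coef_mx m x = diag_mx (\row_i coef (approx_hess m x) i).
Proof.
rewrite diag_mx_sum_delta; apply: eq_bigr => i _; by rewrite mxE.
Qed.

Lemma diag_quadratic_form (d : 'rV[R]_3) v :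
  quadratic_form (diag_mx d) v = \sum_i d ord0 i * v ord0 i ^+ 2.
Proof.
rewrite /quadratic_form mul_mx_diag mxE; apply: eq_bigr => i _.
by rewrite !mxE; ring.
Qed.

Lemma diag_elliptic (d : 'rV[R]_3) a b :
  (forall i, a <= d ord0 i <= b) ->
  mx_le a%:M (diag_mx d) /\ mx_le (diag_mx d) b%:M.
Proof.
move=> dab; rewrite -!diag_const_mx.
by split=> v; rewrite !diag_quadratic_form; apply: ler_sum => i _;
  rewrite mxE ler_wpM2r ?sqr_ge0//; case/andP: (dab i).
Qed.

Lemma coef_mx_elliptic m U : elliptic_on U 1 (2 ^+ 81) (coef_mx m).
Proof.
move=> x _; rewrite coef_mxE; apply: diag_elliptic => i.
by rewrite mxE; exact: coef_bnd (approx_hess_indef m x).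
Qed.

Lemma coef_mx_symmetric m U : symmetric_on U (coef_mx m).
Proof. by move=> x _; rewrite /symmetric_mx coef_mxE tr_diag_mx. Qed.

Lemma approx_solves m U : solves_on U (coef_mx m) (approx_sol m).
Proof.
move=> x _; rewrite /mxdot coef_mxE /mxtrace.
rewrite -[RHS](coef_dot (approx_hess_indef m x)); apply: eq_bigr => i _.
by rewrite mul_diag_mx !mxE -hessian_approx mxE.
Qed.

Section smooth.
Variable U : set E.
Hypothesis oU : open U.

Lemma smooth_corr l m s e p0 p1 p2 :
  class_C l U (on_coords (corr m s e p0 p1 p2)).
Proof.
have ct f p (i : 'I_3) j : cell_tower f ->
    class_C l U (fun x : E => trep j f p (x ord0 i)).
  move=> cf.
  have h := class_C_coord (k := l) i oU.
  have h' := class_C_tower oU p (is_tower_trep j cf.1) h.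
  exact: h'.
have cc (c : R) := @class_C_cst _ _ _ oU l R c.
have cb := cell_beta R; have cg := cell_gamma R; have cp := cell_psi R.
have t3 (c : R) f g h q0 q1 q2 j0 j1 j2 :
    cell_tower f -> cell_tower g -> cell_tower h ->
    class_C l U (fun x : E => c * (trep j0 f q0 (x ord0 c0) *
      trep j1 g q1 (x ord0 c1) * trep j2 h q2 (x ord0 c2))).
  move=> cf ch ci; apply: (class_C_mul oU (cc c)).
  exact: (class_C_mul oU (class_C_mul oU (ct _ _ _ _ cf) (ct _ _ _ _ ch))
    (ct _ _ _ _ ci)).
rewrite /on_coords /corr; apply: (class_C_sum oU) => i.
apply: (class_C_add oU); last exact: t3.
by apply: (class_C_add oU); exact: t3.
Qed.

Lemma smooth_base l : class_C l U base.
Proof.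
apply: (class_C_add oU (@class_C_cst _ _ _ oU l R _)).
apply: (class_C_sum oU) => j; apply: (class_C_mul oU (@class_C_cst _ _ _ oU l R _)).
by apply: (class_C_mul oU); exact: class_C_coord.
Qed.

Lemma smooth_approx m : smooth_on U (approx_sol m).
Proof.
move=> l; have h1 : class_C l U base by exact: smooth_base.
have h2 : class_C l U (on_coords (corr m scale0 extra0 0 0 0)).
  exact: smooth_corr.
exact: (class_C_add oU h1 h2).
Qed.

Lemma smooth_coef m l i : class_C l U (fun x => coef (approx_hess m x) i).
Proof.
apply: (class_C_coef i oU (H := approx_hess m)) => [x _|].
  exact: approx_hess_indef.
have cc (c : R) := @class_C_cst _ _ _ oU l R c.
have cr p0 p1 p2 : class_C l U (on_coords (corr m scale0 extra0 p0 p1 p2)).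
  exact: smooth_corr.
by apply: I3P; exact: (class_C_add oU (cc _) (cr _ _ _)).
Qed.

Lemma smooth_coef_mx m : smooth_on U (coef_mx m).
Proof.
by move=> l; apply: (class_C_sum oU) => i; apply: (class_C_scale oU);
  exact: smooth_coef.
Qed.

End smooth.

End approximants.

(** * Boundary values, bounds and the uniform limit *)

Section geometry.
Variable R : realType.
Let E := 'rV[R]_3.

Lemma coord_cont (j : 'I_3) : continuous (fun y : E => y ord0 j).
Proof. exact: coord_continuous_rV. Qed.

Definition sq_norm (x : E) : R := \sum_i x ord0 i ^+ 2.

Lemma enormE x : enorm x = Num.sqrt (sq_norm x). Proof. by []. Qed.

Lemma enorm_lt x r : 0 < r -> (enorm x < r) = (sq_norm x < r ^+ 2).
Proof.
move=> r0; rewrite enormE -{1}(ger0_norm (ltW r0)) -sqrtr_sqr ltr_sqrt//.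
by rewrite exprn_gt0.
Qed.

Lemma enorm_le x r : 0 <= r -> (enorm x <= r) = (sq_norm x <= r ^+ 2).
Proof.
by move=> r0; rewrite enormE -{1}(ger0_norm r0) -sqrtr_sqr ler_sqrt// sqr_ge0.
Qed.

Lemma sq_norm_continuous : continuous sq_norm.
Proof.
move=> x; have h i : class_C 0 [set: E] (fun y : E => y ord0 i).
  by apply: class_C_coord; exact: openT.
have h2 : class_C 0 [set: E] sq_norm.
  by apply: (class_C_sum openT) => i; exact: (class_C_exp openT 2 (h i)).
exact: (class_C_continuous h2 I).
Qed.

Lemma eball_sq_norm r : 0 < r -> eball r = [set x : E | sq_norm x < r ^+ 2].
Proof. by move=> r0; apply/seteqP; split=> x /=; rewrite /eball/= enorm_lt. Qed.

Lemma eball_open r : 0 < r -> open (eball r : set E).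
Proof.
move=> r0; rewrite eball_sq_norm//.
apply: (@open_comp _ _ sq_norm [set y | y < r ^+ 2]); last exact: open_lt.
by move=> x _; exact: sq_norm_continuous.
Qed.

Lemma closure_eball r (x : E) : 0 < r -> closure (eball r) x ->
  sq_norm x <= r ^+ 2.
Proof.
move=> r0; have cl : closed [set y : E | sq_norm y <= r ^+ 2].
  apply: (@closed_comp _ _ sq_norm [set y | y <= r ^+ 2]); last exact: closed_le.
  by move=> y _; exact: sq_norm_continuous.
rewrite eball_sq_norm// => h.
have sub : [set x : E | sq_norm x < r ^+ 2] `<=` [set y | sq_norm y <= r ^+ 2].
  by move=> y /ltW.
have cE : [set y : E | sq_norm y <= r ^+ 2] =
  closure [set y : E | sq_norm y <= r ^+ 2] by apply/closure_id.
by have := closure_subset sub h; rewrite -cE.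
Qed.

Definition cbox (r : 'I_3 -> R) : set E :=
  [set x | forall i, `|x ord0 i| <= r i].

Lemma cbox_compact r : compact (cbox r).
Proof.
have -> : cbox r = [set v : E | forall i, `[- r i, r i]%classic (v ord0 i)].
  by apply/seteqP; split=> x h i; have := h i; rewrite /= in_itv/= ler_norml.
apply: (@rV_compact _ _ (fun i => `[- r i, r i]%classic)) => i.
exact: segment_compact.
Qed.

Lemma cbox_closed r : closed (cbox r).
Proof.
by apply: compact_closed; [exact: norm_hausdorff|exact: cbox_compact].
Qed.

Lemma sub_cbox_compactly r (A U : set E) :
  A `<=` cbox r -> cbox r `<=` U -> compactly_contained A U.
Proof.
move=> Ar rU; have cl : closure A `<=` cbox r.
  have cE : cbox r = closure (cbox r) by apply/closure_id; exact: cbox_closed.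
  by rewrite [X in _ `<=` X]cE; exact: closure_subset.
split; last exact: subset_trans rU.
have cr : compact (cbox r) by exact: cbox_compact.
have cA : closed (closure A) by exact: closed_closure.
exact: subclosed_compact cA cr cl.
Qed.

Lemma Q0_abs (x : E) : Q0 x <-> forall i, `|x ord0 i| < 2^-1.
Proof. by split=> h i; have := h i; rewrite ltr_norml. Qed.

Lemma Q0_open : open (@Q0 R).
Proof.
pose A i := [set x : E | `|x ord0 i| < 2^-1].
have oA i : open (A i).
  apply: (@open_comp _ _ (fun x : E => `|x ord0 i|) [set y | y < 2^-1]);
    last exact: open_lt.
  move=> x _; apply: continuous_comp; first exact: coord_cont.
  exact: norm_continuous.
have -> : @Q0 R = A c0 `&` A c1 `&` A c2.
  apply/seteqP; split=> x.
    by move=> /Q0_abs h; split; [split|]; exact: h.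
  by move=> [[h0 h1] h2]; apply/Q0_abs; exact: I3P.
by apply: openI => //; exact: openI.
Qed.

Lemma cbox_half_sub : cbox (fun=> 2^-1) `<=` (eball 1 : set E).
Proof.
move=> x h; rewrite eball_sq_norm//= /sq_norm sum_I3.
have sq i : x ord0 i ^+ 2 <= 4^-1.
  have := h i; rewrite ler_norml expr2; nra.
have := sq c0; have := sq c1; have := sq c2; rewrite expr1n; lra.
Qed.

Lemma Q0_sub_cbox : @Q0 R `<=` cbox (fun=> 2^-1).
Proof. by move=> x /Q0_abs h i; exact: ltW. Qed.

Lemma Q0_compactly : compactly_contained (@Q0 R) (eball 1).
Proof. exact: sub_cbox_compactly Q0_sub_cbox cbox_half_sub. Qed.

Lemma not_Q0 (x : E) : ~ Q0 x -> exists i, 2^-1 <= `|x ord0 i|.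
Proof.
move=> h; apply: contrapT => no; apply: h; apply/Q0_abs => i.
by rewrite ltNge; apply/negP => h; apply: no; exists i.
Qed.

End geometry.

Section bounds.
Variable R : realType.
Let E := 'rV[R]_3.
Let k : R := kap R.
Let s : R := scale0 R.
Let kE : k = 256^-1. Proof. by []. Qed.
Let k0 : 0 < k. Proof. by rewrite /k /kap invr_gt0 ltr0n. Qed.
Let s0 : 0 < s. Proof. exact: scale0_gt0. Qed.
Let ksE : k * s + k ^+ 2 * s = 1. Proof. exact: scale0E. Qed.

(** The entries of x_1 and x_2 coincide, and the entry of x_0 is smaller by
    k s + k^2 s = 1. *)
Lemma baseE (x : E) :
  base x = 1 - x ord0 c0 ^+ 2 / 2 + k * s / 2 * (sq_norm x - 4).
Proof.
rewrite /base /sq_norm !sum_I3 /base_hess /triple/= /extra0 -/k -/s.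
have -> : - k ^+ 2 * s = k * s - 1 by have := ksE; lra.
by rewrite !expr2; field.
Qed.

Lemma approx_off m (x : E) : ~ Q0 x -> approx_sol m x = base x.
Proof.
move=> /not_Q0[i hi]; rewrite /approx_sol /on_coords corr_out ?addr0//.
by elim/I3P: i hi => ->; rewrite ?orbT.
Qed.

Lemma base_quadratic : quadratic_polynomial (@base R).
Proof.
exists (diag_mx (\row_j (base_hess R j / 2))), 0, (1 - 2 * k * s); split.
- by rewrite /symmetric_mx tr_diag_mx.
- apply/eqP => /matrixP/(_ c0 c0); rewrite !mxE eqxx mulr1n.
  rewrite /base_hess /triple/= -/k -/s => /eqP.
  rewrite mulf_eq0 invr_eq0 pnatr_eq0 orbF mulf_eq0 oppr_eq0 (gt_eqF s0) orbF.
  by rewrite expf_eq0/= (gt_eqF k0).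
- move=> x; rewrite mul0mx mxE addr0 diag_quadratic_form addrC /base.
  by congr (_ + _); apply: eq_bigr => j _; rewrite mxE expr2.
Qed.

Lemma approx_dirichlet m : has_dirichlet_data (eball 2)
  (fun x : E => 1 - x ord0 ord0 ^+ 2 / 2) (approx_sol m).
Proof.
exists (approx_sol m); split=> //.
  apply: continuous_subspaceT => x.
  exact: class_C_continuous (@smooth_approx R setT openT m 0) I.
move=> x [/closure_eball xle xge].
have sq4 : sq_norm x = 4.
  apply/eqP; rewrite eq_le; apply/andP; split.
    by have := xle ltac:(by []); lra.
  rewrite leNgt; apply/negP => h; apply: xge.
  by rewrite eball_sq_norm//=; lra.
rewrite approx_off => [|/Q0_sub_cbox/cbox_half_sub].
  rewrite baseE sq4 subrr mulr0 addr0.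
  by rewrite (_ : c0 = ord0)//; exact: val_inj.
by rewrite eball_sq_norm//= sq4; lra.
Qed.

(** In the cube |x_i| < 1/2 the polynomial stays away from -1 and, thanks to
    its term k s (|x|^2 - 4) / 2, also away from 1, by more than the size
    k^3 s / 2 of the corrections; outside the cube there are no corrections. *)
Lemma approx_le1 m (x : E) : eball 2 x -> `|approx_sol m x| <= 1.
Proof.
rewrite eball_sq_norm//= => x4.
have x0 := sqr_ge0 (x ord0 c0); have x1 := sqr_ge0 (x ord0 c1).
have x2 := sqr_ge0 (x ord0 c2).
have ks0 : 0 <= k * s by rewrite mulr_ge0 ?ltW.
have kks : k ^+ 2 * s = 1 - k * s by have := ksE; lra.
have kks0 : 0 <= k ^+ 2 * s by rewrite mulr_ge0 ?sqr_ge0 ?ltW.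
have sE : sq_norm x = x ord0 c0 ^+ 2 + x ord0 c1 ^+ 2 + x ord0 c2 ^+ 2.
  by rewrite /sq_norm sum_I3.
have [xQ|xQ] := pselect (Q0 x); last first.
  rewrite approx_off// baseE.
  move: (k * s) ks0 kks kks0 sE => t t0 -> kks0 sE.
  have h : t * sq_norm x <= t * 4 by rewrite ler_wpM2l//; lra.
  have h' : (1 - t) * x ord0 c0 ^+ 2 <= (1 - t) * 4 by rewrite ler_wpM2l//; lra.
  have h1 : 0 <= t * x ord0 c1 ^+ 2 by rewrite mulr_ge0.
  have h2 : 0 <= t * x ord0 c2 ^+ 2 by rewrite mulr_ge0.
  rewrite ler_norml; move: h; rewrite sE; lra.
have sq i : x ord0 i ^+ 2 <= 4^-1.
  have := Q0_sub_cbox xQ i; rewrite ler_norml expr2; nra.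
have := corr_bnd m (x ord0 c0) (x ord0 c1) (x ord0 c2) (extra0_le R).
rewrite /approx_sol /on_coords -/k -/s (gtr0_norm s0).
move: (corr _ _ _ _ _ _ _ _ _) => w wb; rewrite baseE.
have kk : k ^+ 3 * s = k * (1 - k * s) by rewrite -kks; ring.
have k3s : k ^+ 3 * s <= 1 - k * s.
  have ks1 : 0 <= 1 - k * s by rewrite -kks.
  by rewrite kk ler_piMl// kE invf_le1 ?ltr0n// ler1n.
have b0 := sq c0; have b1 := sq c1; have b2 := sq c2.
have ks_lo : 2^-1 <= k * s.
  have : k ^+ 2 * s = k * (k * s) by ring.
  rewrite kks {2}kE; lra.
move: k3s wb; rewrite ler_norml; set d := k ^+ 3 * s.
move: (k * s) ks0 kks kks0 ks_lo {kk} => t t0 kks kks0 ks_lo k3s wb.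
have h : 0 <= t * (x ord0 c0 ^+ 2 + x ord0 c1 ^+ 2 + x ord0 c2 ^+ 2)
    <= t * (3 / 4).
  by rewrite mulr_ge0 ?addr_ge0//= ler_wpM2l//; lra.
have h' : (1 - t) * x ord0 c0 ^+ 2 <= (1 - t) * 4^-1 by rewrite ler_wpM2l//; lra.
have h1 : 0 <= t * x ord0 c1 ^+ 2 by rewrite mulr_ge0.
have h2 : 0 <= t * x ord0 c2 ^+ 2 by rewrite mulr_ge0.
rewrite ler_norml sE; lra.
Qed.

Definition limit_sol (x : E) : R := lim (approx_sol m x @[m --> \oo]).

Let q : R := k ^+ 3.
Let C : R := k ^+ 3 * s / 2.

Lemma approx_cauchy m m' (x : E) : (m <= m')%N ->
  `|approx_sol m' x - approx_sol m x| <= C * q ^+ m.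
Proof.
move=> mm; have := corr_tail_bnd (x ord0 c0) (x ord0 c1) (x ord0 c2)
  (extra0_le R) mm.
rewrite (gtr0_norm s0); congr (`|_| <= _).
by rewrite /approx_sol /on_coords; ring.
Qed.

Lemma geom_cvg0 : (fun m => C * q ^+ m) @ \oo --> (0 : R).
Proof.
have h : (fun m => C * q ^+ m) = geometric C q by [].
rewrite h; apply: cvg_geometric; rewrite ger0_norm ?exprn_ge0 ?(ltW k0)//.
by rewrite exprn_ilt1 ?(ltW k0)// kE invf_lt1 ?ltr0n// ltr1n.
Qed.

Lemma geom_small e : 0 < e -> \forall m \near \oo, C * q ^+ m < e.
Proof.
move=> e0; have /cvgrPdist_lt/(_ e e0) := geom_cvg0.
apply: filterS => m; rewrite sub0r normrN; exact: le_lt_trans (ler_norm _).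
Qed.

Lemma approx_cvg (x : E) : approx_sol m x @[m --> \oo] --> limit_sol x.
Proof.
suff : cvg (approx_sol m x @[m --> \oo]) by [].
apply/cauchy_cvgP/cauchy_exP => e e0.
have [m _ hm] := geom_small e0; exists (approx_sol m x).
exists m => // m' /= mm'; rewrite /ball/= distrC.
apply: (le_lt_trans (approx_cauchy x mm')).
by apply: hm => /=.
Qed.

Lemma limit_close m (x : E) : `|limit_sol x - approx_sol m x| <= C * q ^+ m.
Proof.
have h : `|approx_sol m' x - approx_sol m x| @[m' --> \oo] -->
    `|limit_sol x - approx_sol m x|.
  apply: cvg_norm; apply: cvgB; [exact: approx_cvg|exact: cvg_cst].
rewrite -(cvg_lim (@Rhausdorff R) h); apply: limr_le.
  by apply/cvg_ex; exists `|limit_sol x - approx_sol m x|.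
by exists m => // m' /= mm'; exact: approx_cauchy.
Qed.

Lemma approx_uniform (U : set E) : {uniform U, @approx_sol R @ \oo --> limit_sol}.
Proof.
move=> P /uniform_nbhs[F [entF FP]].
move: entF; rewrite -entourage_ballE => -[e e0 eF].
have := geom_small e0; apply: filterS => m hm; apply: FP => y _; apply: eF.
by rewrite /ball/=; apply: (le_lt_trans (limit_close m y)).
Qed.

(** At such points the cycles from the j-th on vanish, by [trep_deep]. *)
Definition settled j (x : E) : Prop := trep j (@beta R) 0 (x ord0 c1) != 1.

Lemma settled_leq j m (x : E) : (j <= m)%N -> settled j x -> settled m x.
Proof. exact: beta_stable. Qed.

Lemma coef_mx_stable j m (x : E) : (j <= m)%N -> settled j x ->
  coef_mx m x = coef_mx j x.
Proof.
move=> jm sj; rewrite /coef_mx; suff -> : approx_hess m x = approx_hess j x by [].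
by rewrite /approx_hess /corr_hess !(corr_stable _ _ _ _ _ _ _ jm).
Qed.

End bounds.

(** * Measurability, and integrals of tensor products *)

Section measurability.
Variables (R : realType) (n : nat).
Let E := 'rV[R]_n.

Lemma measurable_coord (j : 'I_n) : measurable_fun setT (fun x : E => x ord0 j).
Proof. by have /measurable_fun_mxP := @measurable_id _ E setT; apply. Qed.

(** The open sets have to be measurable for the sigma-algebra generated by
    the entries. They are countable unions of cubes with rational centres. *)
Definition rat_box (q : 'rV[rat]_n) (m : nat) : set E :=
  [set x | forall j, `|x ord0 j - ratr (q ord0 j)| < m.+1%:R^-1].

Lemma measurable_rat_box q m : measurable (rat_box q m).
Proof.
have -> : rat_box q m = \bigcap_(j in [set: 'I_n])
    [set x : E | `|x ord0 j - ratr (q ord0 j)| < m.+1%:R^-1].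
  by apply/seteqP; split=> x h j; [move=> _; exact: h|exact: h].
apply: fin_bigcap_measurable; first exact: finite_finset.
move=> j _; rewrite -[X in measurable X]setTI.
have mf : measurable_fun setT (fun x : E => `|x ord0 j - ratr (q ord0 j)| : R).
  apply: measurableT_comp => //; apply: measurable_funB => //.
  exact: measurable_coord.
have := mf measurableT `]-oo, m.+1%:R^-1[%classic.
rewrite (_ : _ @^-1` _ = [set x : E | `|x ord0 j - ratr (q ord0 j)| < m.+1%:R^-1]).
  by apply; exact: measurable_itv.
by apply/seteqP; split=> x /=; rewrite in_itv.
Qed.

Lemma open_measurable_rV (O : set E) : open O -> measurable O.
Proof.
move=> oO; pose F i : set E := if @unpickle ('rV[rat]_n * nat)%type i is Some c
  then (if `[< rat_box c.1 c.2 `<=` O >] then rat_box c.1 c.2 else set0)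
  else set0.
have -> : O = \bigcup_i F i.
  apply/seteqP; split=> [x Ox|x [i _]]; last first.
    rewrite /F; case: unpickle => // -[q m]; case: asboolP => // h; exact: h.
  have /nbhs_ballP[e /= e0 eO] : nbhs x O by exact: open_nbhs_nbhs.
  have [m me] : exists m, m.+1%:R^-1 < e / 2.
    have e2 : 0 < e / 2 by rewrite divr_gt0.
    have [m _ hm] := near_infty_natSinv_lt (PosNum e2).
    by exists m; apply: (hm m) => /=.
  have m0 : 0 < m.+1%:R^-1 :> R by rewrite invr_gt0 ltr0n.
  have qex j : {q : rat | `|x ord0 j - ratr q| < m.+1%:R^-1}.
    apply: cid; have [q] := @rat_in_itvoo R (x ord0 j) (x ord0 j + m.+1%:R^-1)
      ltac:(by rewrite ltrDl).
    rewrite in_itv/= => /andP[q1 q2]; exists q.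
    by rewrite distrC gtr0_norm ?subr_gt0// ltrBlDl.
  pose q := \row_j sval (qex j).
  have xq : rat_box q m x by move=> j; rewrite mxE; exact: svalP (qex j).
  have qO : rat_box q m `<=` O.
    move=> y yq; apply: eO; split=> // i j; rewrite (ord1 i).
    have := yq j; have := xq j; rewrite /ball/= => h1 h2.
    rewrite (_ : x ord0 j - y ord0 j = (x ord0 j - ratr (q ord0 j))
       - (y ord0 j - ratr (q ord0 j))); last by ring.
    apply: (le_lt_trans (ler_normB _ _)); rewrite (splitr e).
    exact: ltrD (lt_trans h1 me) (lt_trans h2 me).
  exists (pickle (q, m)) => //; rewrite /F pickleK.
  by case: asboolP => // h; exact: xq.
apply: bigcupT_measurable => i; rewrite /F; case: unpickle => // -[q m].
by case: asboolP => // _; exact: measurable_rat_box.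
Qed.

Lemma continuous_measurable_rV (f : E -> R) (D : set E) : measurable D ->
  continuous f -> measurable_fun D f.
Proof.
move=> mD cf; apply: (@measurable_funTS _ _ _ _ D).
apply: (measurability _ (RGenOpens.measurableE R)).
move=> _ [_ [a [b ->] <-]]; rewrite setTI; apply: open_measurable_rV.
by apply: open_comp; [move=> x _; exact: cf|exact: interval_open].
Qed.

Lemma class_C_measurable k (f : E -> R) (D : set E) : measurable D ->
  class_C k setT f -> measurable_fun D f.
Proof.
move=> mD cf; apply: continuous_measurable_rV => // x.
exact: (class_C_continuous cf I).
Qed.

End measurability.

Section cell_integrals.
Variable R : realType.
Let leb := @lebesgue_measure R.

Lemma cellular_lebesgue (f : R -> R) I : continuous f -> cellular f ->
  cell_integral f I ->
  leb.-integrable setT (EFin \o f) /\ (\int[leb]_x (f x)%:E = I%:E)%E.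
Proof.
move=> cf c [F dF FI].
have fE : EFin \o f = (EFin \o f) \_ `[- 2^-1, 2^-1].
  apply/funext => x; rewrite patchE/=; case: ifPn => // xI.
  congr EFin; apply: c; rewrite leNgt; apply: contra xI.
  by rewrite ltr_norml inE/= in_itv/= => /andP[/ltW-> /ltW->].
have FTC : (\int[leb]_(x in `[(- 2^-1)%R, 2^-1%R]) (f x)%:E = I%:E)%E.
  rewrite -FI EFinB; apply: continuous_FTC2; first by rewrite -subr_gt0 opprK; lra.
  - exact: continuous_subspaceT.
  - have cF : continuous F.
      move=> x; have [d _] := dF x.
      exact: (differentiable_continuous ((derivable1_diffP F x).1 d)).
    split; first by move=> x _; case: (dF x).
      exact/cvg_at_right_filter/cF.
    exact/cvg_at_left_filter/cF.
  - by move=> x _; rewrite derive1E; case: (dF x).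
have fi : leb.-integrable `[(- 2^-1)%R, 2^-1%R] (EFin \o f).
  apply: continuous_compact_integrable; first exact: segment_compact.
  exact: continuous_subspaceT.
split.
  rewrite fE; apply: (integrable_mkcond _ _).1 => //; exact: measurable_itv.
by rewrite -FTC [RHS]integral_mkcond -fE.
Qed.

(** Integrability of the product comes from Tonelli's theorem applied to
    |f(x) g(y)|, and its value from Fubini's. *)
Lemma prod_integrable d1 d2 (T1 : measurableType d1) (T2 : measurableType d2)
  (m1 : {sigma_finite_measure set T1 -> \bar R})
  (m2 : {sigma_finite_measure set T2 -> \bar R}) (f : T1 -> R) (g : T2 -> R)
  (a b : R) :
  m1.-integrable setT (EFin \o f) -> (\int[m1]_x (f x)%:E = a%:E)%E ->
  m2.-integrable setT (EFin \o g) -> (\int[m2]_x (g x)%:E = b%:E)%E ->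
  (m1 \x m2)%E.-integrable setT (fun z => (f z.1 * g z.2)%:E) /\
  (\int[m1 \x m2]_z (f z.1 * g z.2)%:E = (a * b)%:E)%E.
Proof.
move=> fi fa gi gb.
have mf : measurable_fun setT f by apply/measurable_EFinP; exact: measurable_int fi.
have mg : measurable_fun setT g by apply/measurable_EFinP; exact: measurable_int gi.
have mfg : measurable_fun setT (fun z : T1 * T2 => (f z.1 * g z.2)%:E).
  apply/measurable_EFinP; apply: measurable_funM.
    exact: measurableT_comp mf measurable_fst.
  exact: measurableT_comp mg measurable_snd.
have fg : (m1 \x m2)%E.-integrable setT (fun z => (f z.1 * g z.2)%:E).
  apply/(integrable12ltyP _ _ mfg).
  have [_ gfin] := integrableP _ _ _ gi.
  have [_ ffin] := integrableP _ _ _ fi.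
  have mng : measurable_fun setT (fun y => `|(g y)%:E|%E).
    by apply: measurableT_comp => //; exact/measurable_EFinP.
  have mnf : measurable_fun setT (fun y => `|(f y)%:E|%E).
    by apply: measurableT_comp => //; exact/measurable_EFinP.
  have inner x : (\int[m2]_y `|(f x * g y)%:E| =
      `|(f x)%:E| * \int[m2]_y `|(g y)%:E|)%E.
    rewrite -ge0_integralZl//.
    by apply: eq_integral => y _; rewrite /= normrM EFinM.
  under eq_integral do rewrite inner.
  rewrite ge0_integralZr//; last exact: integral_ge0.
  have g_fin : (\int[m2]_y `|(g y)%:E|)%E \is a fin_num.
    by rewrite ge0_fin_numE//; exact: integral_ge0.
  by rewrite muleC lte_mul_pinfty//; exact: integral_ge0.
split=> //; rewrite -integral12_prod_meas1//.
under eq_integral.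
  move=> x _; rewrite /fubini_F/=; under eq_integral do rewrite EFinM.
  rewrite integralZl// gb; over.
by rewrite integralZr// fa.
Qed.

(** The triple integral is computed by applying the double one twice; the inner
    product then has to be a sigma-finite measure in its own right. *)
Section sigma_finite_product.
Variables (d1 d2 : measure_display) (T1 : measurableType d1)
  (T2 : measurableType d2).
Variables (m1 : {sigma_finite_measure set T1 -> \bar R})
  (m2 : {sigma_finite_measure set T2 -> \bar R}).

Definition sf_product : set (T1 * T2) -> \bar R := (m1 \x m2)%E.

HB.instance Definition _ := Measure.copy sf_product (m1 \x m2)%E.

Let sf_product_sigma_finite : sigma_finite setT sf_product.
Proof.
have /sigma_finiteP[F [FT Fnd Ffin]] := sigma_finiteT m1.
have /sigma_finiteP[G [GT Gnd Gfin]] := sigma_finiteT m2.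
exists (fun n => F n `*` G n).
  apply/esym; rewrite -subTset => -[x y] _.
  have [i _ Fx] : (\bigcup_i F i) x by rewrite -FT.
  have [j _ Gy] : (\bigcup_i G i) y by rewrite -GT.
  exists (maxn i j) => //; split=> /=.
    by have /subsetPset := Fnd _ _ (leq_maxl i j); apply.
  by have /subsetPset := Gnd _ _ (leq_maxr i j); apply.
move=> n; have [[mF Foo] [mG Goo]] := (Ffin n, Gfin n); split.
  exact: measurableX.
rewrite /sf_product product_measure1E//.
have F0 : m1 (F n) \is a fin_num by rewrite ge0_fin_numE.
have G0 : m2 (G n) \is a fin_num by rewrite ge0_fin_numE.
by rewrite -ge0_fin_numE ?fin_numM// mule_ge0.
Qed.

HB.instance Definition _ := Measure_isSigmaFinite.Build _ _ _ sf_product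
  sf_product_sigma_finite.

End sigma_finite_product.

Lemma prod3_integrable d1 d2 d3 (T1 : measurableType d1)
  (T2 : measurableType d2) (T3 : measurableType d3)
  (m1 : {sigma_finite_measure set T1 -> \bar R})
  (m2 : {sigma_finite_measure set T2 -> \bar R})
  (m3 : {sigma_finite_measure set T3 -> \bar R})
  (f : T1 -> R) (g : T2 -> R) (h : T3 -> R) (a b c : R) :
  m1.-integrable setT (EFin \o f) -> (\int[m1]_x (f x)%:E = a%:E)%E ->
  m2.-integrable setT (EFin \o g) -> (\int[m2]_x (g x)%:E = b%:E)%E ->
  m3.-integrable setT (EFin \o h) -> (\int[m3]_x (h x)%:E = c%:E)%E ->
  ((m1 \x m2) \x m3)%E.-integrable setT
     (fun z => (f z.1.1 * g z.1.2 * h z.2)%:E) /\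
  (\int[(m1 \x m2) \x m3]_z (f z.1.1 * g z.1.2 * h z.2)%:E = (a * b * c)%:E)%E.
Proof.
move=> fi fa gi gb hi hc; have [fgi fgE] := prod_integrable fi fa gi gb.
exact: (@prod_integrable _ _ _ _ (sf_product m1 m2) m3
  (fun z => f z.1 * g z.2) h _ _ fgi fgE hi hc).
Qed.

End cell_integrals.

Section lebesgue3_tensors.
Variable R : realType.
Let E := 'rV[R]_3.
Let leb := @lebesgue_measure R.

Lemma row3E (p : measurableTypeR R * measurableTypeR R * measurableTypeR R) :
  [/\ row3 p ord0 c0 = p.1.1, row3 p ord0 c1 = p.1.2 & row3 p ord0 c2 = p.2].
Proof. by rewrite !mxE. Qed.

Lemma lebesgue3_tensor (f g h : R -> R) (a b d : R) :
  leb.-integrable setT (EFin \o f) -> (\int[leb]_x (f x)%:E = a%:E)%E ->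
  leb.-integrable setT (EFin \o g) -> (\int[leb]_x (g x)%:E = b%:E)%E ->
  leb.-integrable setT (EFin \o h) -> (\int[leb]_x (h x)%:E = d%:E)%E ->
  (@lebesgue3 R).-integrable setT
     (EFin \o on_coords (fun r s t => f r * g s * h t)) /\
  (\int[lebesgue3]_x (on_coords (fun r s t => f r * g s * h t) x)%:E =
     (a * b * d)%:E)%E.
Proof.
move=> fi fa gi gb hi hd.
have [Ti TE] := @prod3_integrable _ _ _ _ _ _ _ (@lebesgue_measure R)
  (@lebesgue_measure R) (@lebesgue_measure R) _ _ _ _ _ _ fi fa gi gb hi hd.
have TE' : (fun z : measurableTypeR R * measurableTypeR R * measurableTypeR R =>
    (f z.1.1 * g z.1.2 * h z.2)%:E) =
    (EFin \o on_coords (fun r s t => f r * g s * h t)) \o @row3 R.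
  apply/funext => p; rewrite /= /on_coords.
  by have [-> -> ->] := row3E p.
rewrite TE' in Ti TE.
have mT : measurable_fun setT
    (EFin \o on_coords (fun r s t => f r * g s * h t)).
  have mc (u : R -> R) j : leb.-integrable setT (EFin \o u) ->
      measurable_fun setT (fun x : E => u (x ord0 j)).
    move=> ui; apply: measurableT_comp; last exact: measurable_coord.
    by apply/measurable_EFinP; exact: measurable_int ui.
  apply/measurable_EFinP; apply: measurable_funM; last exact: mc.
  by apply: measurable_funM; exact: mc.
split; first by apply: integrable_pushforward => //; exact: measurable_row3.
rewrite -TE; exact: (integral_pushforward (@measurable_row3 R) mT).
Qed.

End lebesgue3_tensors.

(** * Integration by parts against the test functions *)

Section has_integral.
Variable R : realType.
Let E := 'rV[R]_3.

(** Integrability with a finite value, kept together because both are needed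
    for linearity. *)
Definition has_integral (F : E -> R) (I : R) :=
  (@lebesgue3 R).-integrable setT (EFin \o F) /\
  (\int[lebesgue3]_x (F x)%:E = I%:E)%E.

Lemma has_integral_add F G a b : has_integral F a -> has_integral G b ->
  has_integral (fun x => F x + G x) (a + b).
Proof.
move=> [Fi Fa] [Gi Gb]; split.
  rewrite (_ : EFin \o _ = (EFin \o F) \+ (EFin \o G))%E//.
  exact: integrableD.
by under eq_integral do rewrite EFinD; rewrite integralD// Fa Gb.
Qed.

Lemma has_integral_cmul c F a : has_integral F a ->
  has_integral (fun x => c * F x) (c * a).
Proof.
move=> [Fi Fa]; split.
  rewrite (_ : EFin \o _ = (fun x => c%:E * (EFin \o F) x)%E)//.
  exact: integrableZl.
by under eq_integral do rewrite EFinM; rewrite integralZl// Fa.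
Qed.

Lemma has_integral_le F G a b : has_integral F a -> has_integral G b ->
  (forall x, F x <= G x) -> a <= b.
Proof.
move=> [Fi Fa] [Gi Gb] FG; rewrite -lee_fin -Fa -Gb.
by apply: le_integral => // x _; rewrite lee_fin.
Qed.

Lemma has_integral_norm_le F G a b : has_integral F a -> has_integral G b ->
  (forall x, `|F x| <= G x) -> `|a| <= b.
Proof.
move=> Fa Gb FG; rewrite ler_norml lerNl -mulN1r.
have FGN x : - 1 * F x <= G x.
  by rewrite mulN1r; apply: le_trans (FG x); rewrite -normrN ler_norm.
rewrite (has_integral_le (has_integral_cmul (-1) Fa) Gb FGN).
by apply: has_integral_le Fa Gb _ => x; exact: le_trans (ler_norm _) (FG x).
Qed.

Lemma has_integral_unique F a b : has_integral F a -> has_integral F b -> a = b.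
Proof. by move=> [_ h] [_ h']; apply: EFin_inj; rewrite -h -h'. Qed.

Lemma has_integral_tensor (f g h : R -> R) a b d :
  continuous f -> cellular f -> cell_integral f a ->
  continuous g -> cellular g -> cell_integral g b ->
  continuous h -> cellular h -> cell_integral h d ->
  has_integral (on_coords (fun r s t => f r * g s * h t)) (a * b * d).
Proof.
move=> f1 f2 fa g1 g2 gb h1 h2 hd.
have [fi fE] := cellular_lebesgue f1 f2 fa.
have [gi gE] := cellular_lebesgue g1 g2 gb.
have [hi hE] := cellular_lebesgue h1 h2 hd.
exact: lebesgue3_tensor.
Qed.

End has_integral.

Section test_function.
Variable R : realType.
Let E := 'rV[R]_3.
Variable j : nat.

(** The cut-offs in x_0 and x_2 are those of the first layer of the j-th
    cycle. In x_1 the profile theta is copied along the parabolas of that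
    layer, one generation deeper. *)
Definition test_tensor (p : nat) (x0 x1 x2 : R) : R :=
  trep j (@gamma R) 0 x0 * trep j.+1 (@theta R) p x1 * trep j (@beta R) 0 x2.

Definition test_fun : E -> R := on_coords (test_tensor 0).
Definition test_d1 : E -> R := on_coords (test_tensor 1).

(** Integration by parts in x_1, for w with derivative dw. As a predicate on
    pairs it is linear, so it only has to be checked for tensors. *)
Definition by_parts (w dw : E -> R) := exists2 a,
  has_integral (fun x => w x * test_d1 x) a &
  has_integral (fun x => dw x * test_fun x) (- a).

Lemma by_parts_add w dw v dv : by_parts w dw -> by_parts v dv ->
  by_parts (fun x => w x + v x) (fun x => dw x + dv x).
Proof.
move=> [a w1 w2] [b v1 v2]; exists (a + b).
  have := has_integral_add w1 v1.
  by congr has_integral; apply/funext => x; ring.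
rewrite opprD; have := has_integral_add w2 v2.
by congr has_integral; apply/funext => x; ring.
Qed.

Lemma by_parts_cmul c w dw : by_parts w dw ->
  by_parts (fun x => c * w x) (fun x => c * dw x).
Proof.
move=> [a w1 w2]; exists (c * a).
  have := has_integral_cmul c w1.
  by congr has_integral; apply/funext => x; ring.
rewrite -mulrN; have := has_integral_cmul c w2.
by congr has_integral; apply/funext => x; ring.
Qed.

Lemma continuous_mul (f g : R -> R) : continuous f -> continuous g ->
  continuous (fun x => f x * g x).
Proof. by move=> cf cg x; exact: (continuousM (cf x) (cg x)). Qed.

Lemma cellular_mulr (f g : R -> R) : cellular g -> cellular (fun x => f x * g x).
Proof. by move=> cg x h; rewrite cg ?mulr0. Qed.

(** A factor g(x_1) multiplied by theta is a primitive of g theta' + g'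
    theta vanishing at both ends of the cell; the factors in x_0 and x_2 are
    the same on both sides. *)
Lemma by_parts_tensor (f g dg h : R -> R) :
  continuous f -> antider g dg -> continuous dg -> continuous h ->
  by_parts (on_coords (fun r s t => f r * g s * h t))
           (on_coords (fun r s t => f r * dg s * h t)).
Proof.
move=> cf ag cdg ch.
have cg : continuous g.
  move=> x; have [d _] := ag x.
  exact: (differentiable_continuous ((derivable1_diffP g x).1 d)).
have tt := is_tower_trep j.+1 (cell_theta R).1.
have g1 := @trep_continuous R j _ 0 (cell_gamma R).
have g2 := @trep_cellular R j _ 0 (cell_gamma R).
have b1 := @trep_continuous R j _ 0 (cell_beta R).
have b2 := @trep_cellular R j _ 0 (cell_beta R).
have t01 := @trep_continuous R j.+1 _ 0 (cell_theta R).
have t02 := @trep_cellular R j.+1 _ 0 (cell_theta R).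
have t11 := @trep_continuous R j.+1 _ 1 (cell_theta R).
have t12 := @trep_cellular R j.+1 _ 1 (cell_theta R).
have [a fa] := ex_cell_integral (continuous_mul cf g1) (cellular_mulr _ g2).
have [d hd] := ex_cell_integral (continuous_mul ch b1) (cellular_mulr _ b2).
have [b gb] := ex_cell_integral (continuous_mul cg t11) (cellular_mulr _ t12).
have gbN : cell_integral (fun x => dg x * trep j.+1 (@theta R) 0 x) (- b).
  have [G aG Gb] := gb.
  exists (fun x => g x * trep j.+1 (@theta R) 0 x + (-1) * G x).
    move=> x; refine (is_derive_eq (is_derive_add
      (is_derive_mul (ag x) (tt 0%N x)) (is_derive_cmul _ (aG x))) _); ring.
  have half : 2^-1 <= `|2^-1 : R| by rewrite ger0_norm.
  have halfN : 2^-1 <= `|- 2^-1 : R| by rewrite normrN ger0_norm.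
  by rewrite -Gb !t02//; ring.
exists (a * b * d).
  have := has_integral_tensor (continuous_mul cf g1) (cellular_mulr _ g2) fa
    (continuous_mul cg t11) (cellular_mulr _ t12) gb
    (continuous_mul ch b1) (cellular_mulr _ b2) hd.
  congr has_integral; apply/funext => x.
  by rewrite /test_d1 /test_tensor /on_coords; ring.
have := has_integral_tensor (continuous_mul cf g1) (cellular_mulr _ g2) fa
  (continuous_mul cdg t01) (cellular_mulr _ t02) gbN
  (continuous_mul ch b1) (cellular_mulr _ b2) hd.
rewrite mulrN mulNr; congr has_integral; apply/funext => x.
by rewrite /test_fun /test_tensor /on_coords; ring.
Qed.

Lemma by_parts_ext w dw v dv : w =1 v -> dw =1 dv -> by_parts w dw ->
  by_parts v dv.
Proof. by move=> /funext -> /funext ->. Qed.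

Lemma by_parts_cyc s e i :
  by_parts (on_coords (cyc s e i 0 0 0)) (on_coords (cyc s e i 0 1 0)).
Proof.
have cb := cell_beta R; have cg := cell_gamma R; have cp := cell_psi R.
have t3 c (f g h : nat -> R -> R) i0 i1 i2 : cell_tower f -> cell_tower g ->
    cell_tower h -> by_parts
      (fun x => c * on_coords (fun r s t =>
         trep i0 f 0 r * trep i1 g 0 s * trep i2 h 0 t) x)
      (fun x => c * on_coords (fun r s t =>
         trep i0 f 0 r * trep i1 g 1 s * trep i2 h 0 t) x).
  move=> cf cg' ch; apply: by_parts_cmul.
  apply: by_parts_tensor; [exact: trep_continuous| |exact: trep_continuous..].
  exact: is_tower_trep cg'.1 0%N.
have l0 := t3 (amp0 s e) _ _ _ i i.+1 i cg cp cb.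
have l1 := t3 (amp1 s) _ _ _ i i.+1 i.+1 cb cg cp.
have l2 := t3 (amp2 s) _ _ _ i.+1 i.+1 i.+1 cp cb cg.
exact: by_parts_add (by_parts_add l0 l1) l2.
Qed.

Lemma by_parts0 : by_parts (fun=> 0) (fun=> 0).
Proof.
have k1 : continuous (fun _ : R => 1 : R) by move=> x; exact: cst_continuous.
have k0 : continuous (fun _ : R => 0 : R) by move=> x; exact: cst_continuous.
have d0 : antider (fun=> 1 : R) (fun=> 0) by move=> x; exact: is_derive_const.
have := by_parts_cmul 0 (by_parts_tensor k1 d0 k0 k1).
by apply: by_parts_ext => x; rewrite mul0r.
Qed.

Lemma by_parts_sum n (w dw : 'I_n -> E -> R) :
  (forall i, by_parts (w i) (dw i)) ->
  by_parts (fun x => \sum_i w i x) (fun x => \sum_i dw i x).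
Proof.
elim: n w dw => [|n IH] w dw h.
  by apply: by_parts_ext by_parts0 => x; rewrite big_ord0.
have := by_parts_add (h ord0) (IH _ _ (fun i => h (lift ord0 i))).
by apply: by_parts_ext => x; rewrite big_ord_recl.
Qed.

Lemma by_parts_base : by_parts (@base R) (fun x => base_hess R c1 * x ord0 c1).
Proof.
have k1 : continuous (fun _ : R => 1 : R) by move=> x; exact: cst_continuous.
have k0 : continuous (fun _ : R => 0 : R) by move=> x; exact: cst_continuous.
have ci : continuous (fun x : R => x) by move=> x.
have cs := continuous_mul ci ci.
have kk : continuous (fun _ : R => 2 : R) by move=> x; exact: cst_continuous.
have k2 := continuous_mul kk ci.
have d0 : antider (fun=> 1 : R) (fun=> 0) by move=> x; exact: is_derive_const.
have ds : antider (fun x : R => x * x) (fun x => 2 * x).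
  move=> x; refine (is_derive_eq (is_derive_mul (is_derive_id x 1)
    (is_derive_id x 1)) _); ring.
have b1 := by_parts_cmul (1 - 2 * kap R * scale0 R) (by_parts_tensor k1 d0 k0 k1).
have bx := by_parts_cmul (base_hess R c0 / 2) (by_parts_tensor cs d0 k0 k1).
have by_ := by_parts_cmul (base_hess R c1 / 2) (by_parts_tensor k1 ds k2 k1).
have bz := by_parts_cmul (base_hess R c2 / 2) (by_parts_tensor k1 d0 k0 cs).
apply: by_parts_ext (by_parts_add (by_parts_add (by_parts_add b1 bx) by_) bz) => x.
  by rewrite /base sum_I3 /on_coords; ring.
by rewrite /on_coords; field.
Qed.

Lemma by_parts_approx m :
  by_parts (approx_sol m) (partial c1 (@approx_sol R m)).
Proof.
apply: by_parts_ext (by_parts_add by_parts_base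
  (by_parts_sum (fun i : 'I_m => by_parts_cyc (size_at (scale0 R) i)
     (extra_at (scale0 R) (extra0 R) i) i))) => x; first by [].
by rewrite partial_approx /= /on_coords /corr !mul0r mul1r add0r addr0.
Qed.

End test_function.

(** * Sizes of the two contributions *)

Section estimates.
Variable R : realType.
Let E := 'rV[R]_3.
Let N : R := freq R.
Let k : R := kap R.
Let s : R := scale0 R.
Let q : R := k ^+ 3 * N.
Let kE : k = 256^-1. Proof. by []. Qed.
Let k0 : 0 < k. Proof. by rewrite kE invr_gt0 ltr0n. Qed.
Let s0 : 0 < s. Proof. exact: scale0_gt0. Qed.
Let N0 : 0 < N. Proof. exact: lt_le_trans (freq_ge4 R). Qed.
Let qE : q = 2 ^+ 13.
Proof. by rewrite /q kE /N /freq; field. Qed.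

(** The first layer has slope at most 8 * 9/8 = 9; the two others are
    smaller by factors k and k^2, which is why 19/2 suffices. *)
Lemma cyc_d1_bnd (a e : R) i (x0 x1 x2 : R) : `|e| <= `|a| ->
  `|cyc a e i 0 1 0 x0 x1 x2| <= 19 / 2 * k ^+ 3 * N ^+ i.+1 * `|a|.
Proof.
move=> ea; rewrite /cyc /layer0 /layer1 /layer2.
have psi1 := trep_bnd i.+1 x1 (cell_psi R) (ler0n R 8)
  (fun y => let: And3 _ h _ := psi_bnd y in h).
have gamma1 := trep_bnd i.+1 x1 (cell_gamma R) (ler0n R 32)
  (fun y => let: And3 _ h _ := gamma_bnd y in h).
have beta1 := trep_bnd i.+1 x1 (cell_beta R) (ler0n R 64)
  (fun y => let: And3 _ h _ := beta_bnd y in h).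
rewrite muln1 in psi1 gamma1 beta1.
have t0 := mul_bnd (amp0_bnd ea)
  (prod3_bnd (trep_gamma0 i x0) psi1 (trep_beta0 i x2)).
have t1 := mul_bnd (amp1_bnd a)
  (prod3_bnd (trep_beta0 i x0) gamma1 (trep_psi0 i.+1 x2)).
have t2 := mul_bnd (amp2_bnd a)
  (prod3_bnd (trep_psi0 i.+1 x0) beta1 (trep_gamma0 i.+1 x2)).
apply: (le_trans (ler_normD _ _)); apply: (le_trans (lerD (ler_normD _ _) t2)).
apply: (le_trans (lerD (lerD t0 t1) (lexx _))).
have : 0 <= N ^+ i.+1 * `|a| by rewrite mulr_ge0// exprn_ge0// ltW.
rewrite -/N; move: (N ^+ i.+1) (`|a|) => X Y XY.
rewrite -/k kE; lra.
Qed.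

(** The slopes form a geometric sum with the large ratio k^3 N, dominated by
    its last term. *)
Lemma approx_d1_bnd j (x : E) : `|x ord0 c1| <= 2^-1 ->
  `|partial c1 (@approx_sol R j) x| <= 10 * s * q ^+ j.
Proof.
move=> x1; rewrite partial_approx /= !mul0r mul1r add0r addr0.
rewrite /on_coords; elim: j => [|j IH].
  rewrite /corr big_ord0 addr0 expr0 mulr1 /base_hess /triple/= /extra0.
  rewrite -/k -/s normrM normrM (gtr0_norm k0) (gtr0_norm s0).
  have : s * `|x ord0 c1| <= s * 2^-1 by rewrite ler_wpM2l// ltW.
  have := s0; rewrite kE; lra.
rewrite /corr big_ord_recr/= addrA.
apply: (le_trans (ler_normD _ _)).
have h := cyc_d1_bnd j (x ord0 c0) (x ord0 c1) (x ord0 c2)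
  (extra_at_norm j (extra0_le R)).
rewrite size_at_norm -/k -/s (gtr0_norm s0) in h.
apply: (le_trans (lerD IH h)).
have -> : 19 / 2 * k ^+ 3 * N ^+ j.+1 * ((k ^+ 3) ^+ j * s) =
    19 / 2 * s * q ^+ j.+1.
  have -> : q ^+ j.+1 = k ^+ 3 * (k ^+ 3) ^+ j * N ^+ j.+1.
    by rewrite -exprS -exprMn.
  by ring.
rewrite exprS; have q0 : 0 <= q ^+ j by rewrite exprn_ge0// qE exprn_ge0.
have : 0 <= s * q ^+ j by rewrite mulr_ge0// ltW.
move: (q ^+ j) => X; rewrite qE; lra.
Qed.

Lemma amp0_lb (a e : R) : `|e| <= `|a| -> 7 / 8 * k ^+ 3 * `|a| <= `|amp0 a e|.
Proof.
move=> ea; rewrite /amp0 -/N -/k.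
apply: (le_trans _ (lerB_dist _ _)).
rewrite (normrM (k ^+ 3)) (@ger0_norm _ (k ^+ 3)) ?exprn_ge0 ?(ltW k0)//.
rewrite normrM normfV (@ger0_norm _ (N ^+ 2)) ?exprn_ge0 ?(ltW N0)//.
have : `|e| / N ^+ 2 <= `|a| / N ^+ 2.
  by rewrite ler_wpM2r// invr_ge0 exprn_ge0// ltW.
have -> : `|a| / N ^+ 2 = k ^+ 3 / q / N * `|a|.
  by rewrite /q; field; rewrite !gt_eqF.
rewrite qE kE /N /freq; have := normr_ge0 a; lra.
Qed.

(** On the left half of the cell psi theta' is at least 25/512 theta', whose
    integral there is 25/512; on the right half it vanishes. *)
Lemma cell_integral_psi_theta I :
  cell_integral (fun x : R => psi 0 x * theta 1 x) I -> 25 / 512 <= I.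
Proof.
move=> [F aF <-]; have lr : - 2^-1 <= 0 :> R by lra.
have h0 : 0 <= 2^-1 :> R by lra.
have right : F 2^-1 = F 0.
  by apply: antider_eq aF _ h0 => x /andP[x0 _]; exact: psi_theta_right.
pose G (x : R) := F x + (- (25 / 512)) * theta 0 x.
have aG : antider G (fun x => psi 0 x * theta 1 x + (- (25 / 512)) * theta 1 x).
  move=> x; apply: is_derive_add; first exact: aF.
  by apply: is_derive_cmul; exact: ((cell_theta R).1 0%N x).
have tin : theta 0 0 = 1 :> R by rewrite /theta plateau_in//; lra.
have tout : theta 0 (- 2^-1) = 0 :> R.
  by apply: theta_out; rewrite normrN ger0_norm; lra.
have mono : 0 * (0 - - 2^-1) <= G 0 - G (- 2^-1).
  by apply: antider_ge aG lr _ => x /andP[_ x0]; have := psi_theta x0; lra.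
move: mono; rewrite mul0r right /G tin tout; lra.
Qed.

Lemma cell_integral_beta2 I :
  cell_integral (fun x : R => beta 0 x * beta 0 x) I -> 4^-1 <= I.
Proof.
move=> [F aF <-].
have a1 : - 2^-1 <= - 8^-1 :> R by lra.
have a2 : - 8^-1 <= 8^-1 :> R by lra.
have a3 : 8^-1 <= 2^-1 :> R by lra.
have pos (x : R) : 0 <= beta 0 x * beta 0 x.
  by have [/andP[h _] _ _] := beta_bnd x; exact: mulr_ge0.
have h1 := antider_ge aF a1 (fun x _ => pos x).
have h3 := antider_ge aF a3 (fun x _ => pos x).
have h2 : 1 * (8^-1 - - 8^-1) <= F 8^-1 - F (- 8^-1).
  apply: antider_ge aF a2 _ => x x8; rewrite beta_in/= ?mulr1//.
  by rewrite ler_norml; lra.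
lra.
Qed.

Lemma cell_integral_gamma2 I :
  cell_integral (fun x : R => gamma 0 x * gamma 0 x) I -> 4^-1 <= I.
Proof.
move=> [F aF <-].
have a1 : - 2^-1 <= - 8^-1 :> R by lra.
have a2 : - 8^-1 <= 8^-1 :> R by lra.
have a3 : 8^-1 <= 2^-1 :> R by lra.
have pos (x : R) : 0 <= gamma 0 x * gamma 0 x.
  by have [/andP[h _] _ _] := gamma_bnd x; exact: mulr_ge0.
have h1 := antider_ge aF a1 (fun x _ => pos x).
have h3 := antider_ge aF a3 (fun x _ => pos x).
have h2 : 1 * (8^-1 - - 8^-1) <= F 8^-1 - F (- 8^-1).
  apply: antider_ge aF a2 _ => x x8; rewrite gamma_in/= ?mulr1//.
  by rewrite ler_norml; lra.
lra.
Qed.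

Lemma test_fun_itv j (x : E) : 0 <= test_fun j x <= 1.
Proof.
have r01 f i y : cell_tower f -> (forall z : R, 0 <= f 0 z <= 1) ->
    0 <= trep i f 0 y <= 1.
  move=> cf f01; rewrite /trep muln0 expr0 mul1r.
  apply: (@rep_range _ (fun z => 0 <= z <= 1)) => //; last by rewrite lexx ler01.
  exact: cell_tower_cellular.
have /andP[g0 g1] := r01 _ j (x ord0 c0) (cell_gamma R)
  (fun z => let: And3 h _ _ := gamma_bnd z in h).
have /andP[t0 t1] := r01 _ j.+1 (x ord0 c1) (cell_theta R) (@theta_itv R).
have /andP[b0 b1] := r01 _ j (x ord0 c2) (cell_beta R)
  (fun z => let: And3 h _ _ := beta_bnd z in h).
rewrite /test_fun /on_coords /test_tensor.
have gt0 := mulr_ge0 g0 t0; have gt1 := mulr_ile1 g0 t0 g1 t1.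
by rewrite (mulr_ge0 gt0 b0) (mulr_ile1 gt0 b0 gt1 b1).
Qed.

Lemma test_tensor_out j p (x0 x1 x2 : R) :
  [|| 5 / 16 <= `|x0|, 8^-1 < `|x1| | 3 / 16 <= `|x2|] ->
  test_tensor j p x0 x1 x2 = 0.
Proof.
have ct := cell_theta R; rewrite /test_tensor; case/or3P => h.
- have r : 8^-1 < 5 / 16 :> R by lra.
  by rewrite (trep_out _ _ r (cell_gamma R) (@gamma_out R) h) !mul0r.
- have [->|[h' _]] := trep_cell x1; [by rewrite mulr0 mul0r|exact: ct|].
  by have := lt_le_trans h h'; rewrite ltxx.
- have r : 8^-1 < 3 / 16 :> R by lra.
  by rewrite (trep_out _ _ r (cell_beta R) (@beta_out R) h) mulr0.
Qed.

Lemma trep0_cell_integral j (f : nat -> R -> R) : cell_tower f ->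
  (forall z, f 0%N z <= 1) ->
  exists2 a, a <= 1 / 4 ^+ j & cell_integral (trep j f 0) a.
Proof.
move=> cf f1; have cc : cellular (f 0%N) by exact: cell_tower_cellular.
have [a ha] := ex_cell_integral (tower_continuous (p := 0%N) cf.1) cc.
exists (a / 4 ^+ j).
  rewrite ler_wpM2r ?invr_ge0 ?exprn_ge0//; exact: cell_integral_le ha f1.
have := cell_integral_rep j cc ha; congr cell_integral.
by apply/funext => y; rewrite /trep muln0 expr0 mul1r.
Qed.

Let cell4 j : R := 1 / 4 ^+ j.

Lemma test_fun_integral j : exists2 a,
  a <= cell4 j * cell4 j.+1 * cell4 j & has_integral (test_fun j) a.
Proof.
have ge0 i (f : nat -> R -> R) a : cell_tower f -> (forall z, 0 <= f 0%N z) ->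
    cell_integral (trep i f 0) a -> 0 <= a.
  move=> cf f0 ha; apply: cell_integral_ge ha _ => x.
  exact: trep_ge0.
have g01 (z : R) : 0 <= gamma 0 z <= 1 by have [] := gamma_bnd z.
have b01 (z : R) : 0 <= beta 0 z <= 1 by have [] := beta_bnd z.
have t01 := @theta_itv R.
have cg := cell_gamma R; have cb := cell_beta R; have cth := cell_theta R.
have [a a1 ha] := trep0_cell_integral j cg (fun z => (andP (g01 z)).2).
have [b b1 hb] := trep0_cell_integral j.+1 cth (fun z => (andP (t01 z)).2).
have [d d1 hd] := trep0_cell_integral j cb (fun z => (andP (b01 z)).2).
have a0 := ge0 _ _ _ cg (fun z => (andP (g01 z)).1) ha.
have b0 := ge0 _ _ _ cth (fun z => (andP (t01 z)).1) hb.
have d0 := ge0 _ _ _ cb (fun z => (andP (b01 z)).1) hd.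
exists (a * b * d); first by rewrite ler_pM ?mulr_ge0// ler_pM.
apply: (has_integral_tensor _ _ ha _ _ hb _ _ hd);
  by [exact: trep_continuous|exact: trep_cellular].
Qed.

(** After integration by parts the derivative falls on the first j cycles. *)
Lemma smooth_part_bnd j a :
  has_integral (fun x => approx_sol j x * test_d1 j x) a ->
  `|a| <= 10 * s * q ^+ j * (cell4 j * cell4 j.+1 * cell4 j).
Proof.
move=> ha; have [b hb hb'] := by_parts_approx R j j.
rewrite (has_integral_unique ha hb).
have [d d1 hd] := test_fun_integral j.
have B0 : 0 <= 10 * s * q ^+ j.
  by rewrite !mulr_ge0 ?(ltW s0)// exprn_ge0// qE exprn_ge0.
apply: (@le_trans _ _ (10 * s * q ^+ j * d)); last by rewrite ler_wpM2l.
rewrite -normrN; apply: has_integral_norm_le hb' (has_integral_cmul _ hd) _ => x.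
have /andP[t0 _] := test_fun_itv j x.
have [h|h] := leP `|x ord0 c1| 2^-1.
  by rewrite normrM (ger0_norm t0) ler_wpM2r// approx_d1_bnd.
rewrite (_ : test_fun j x = 0) ?mulr0 ?normr0//.
by apply: test_tensor_out; apply/or3P/Or32; lra.
Qed.

(** The first layer of the j-th cycle. It has the same cut-offs as the test
    function and the same parabolas in x_1. *)
Definition layer_at j : E -> R := on_coords
  (layer0 (size_at s j) (extra_at s (extra0 R) j) j 0 0 0).

Lemma trep_pair_integral i p p' (f g : nat -> R -> R) I :
  cell_tower f -> cell_tower g ->
  cell_integral (fun x => f p x * g p' x) I ->
  cell_integral (fun x => trep i f p x * trep i g p' x)
    (N ^+ (i * p) * N ^+ (i * p') * (I / 4 ^+ i)).
Proof.
move=> cf cg hI; have c1 : cellular (f p) by exact: cell_tower_cellular.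
have c2 : cellular (g p') by exact: cell_tower_cellular.
have cfg : cellular (fun x => f p x * g p' x).
  by move=> x h; rewrite c1 ?mul0r.
have := cell_integral_cmul (N ^+ (i * p) * N ^+ (i * p'))
  (cell_integral_rep i cfg hI).
congr cell_integral; apply/funext => y.
by rewrite /trep -rep_mul// -/N; ring.
Qed.

(** The integral factors into those of gamma^2, psi theta' and beta^2. Only
    the factor in x_1 carries a derivative, hence one power of N for each of
    its j + 1 generations. *)
Lemma layer_part_lb j : exists2 a,
  20 * s * q ^+ j * (cell4 j * cell4 j.+1 * cell4 j) <= `|a| &
  has_integral (fun x => layer_at j x * test_d1 j x) a.
Proof.
have cg := cell_gamma R; have cb := cell_beta R; have cth := cell_theta R.
have cp := cell_psi R.
have pair (f g : nat -> R -> R) p p' : cell_tower f -> cell_tower g ->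
    exists I, cell_integral (fun x => f p x * g p' x) I.
  move=> cf cg'; apply: ex_cell_integral.
    by apply: continuous_mul; apply: tower_continuous; [exact: cf.1|exact: cg'.1].
  by apply: cellular_mulr; exact: cell_tower_cellular.
have pairT (f g : nat -> R -> R) p p' i : cell_tower f -> cell_tower g ->
    continuous (fun x : R => trep i f p x * trep i g p' x) /\
    cellular (fun x : R => trep i f p x * trep i g p' x).
  move=> cf cg'; split; last by apply: cellular_mulr; exact: trep_cellular.
  by apply: continuous_mul; exact: trep_continuous.
have [a ha] := pair _ _ 0%N 0%N cg cg.
have [b hb] := pair _ _ 0%N 1%N cp cth.
have [d hd] := pair _ _ 0%N 0%N cb cb.
have a_lb := cell_integral_gamma2 ha.
have b_lb := cell_integral_psi_theta hb.
have d_lb := cell_integral_beta2 hd.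
have [g1 g2] := pairT _ _ 0%N 0%N j cg cg.
have [h1 h2] := pairT _ _ 0%N 1%N j.+1 cp cth.
have [b1 b2] := pairT _ _ 0%N 0%N j cb cb.
have T := has_integral_cmul (amp0 (size_at s j) (extra_at s (extra0 R) j))
  (has_integral_tensor g1 g2 (trep_pair_integral j cg cg ha)
     h1 h2 (trep_pair_integral j.+1 cp cth hb)
     b1 b2 (trep_pair_integral j cb cb hd)).
rewrite !muln0 muln1 expr0 !mul1r in T.
eexists; last first.
  move: T; congr has_integral; apply/funext => x.
  by rewrite /layer_at /layer0 /test_d1 /test_tensor /on_coords; ring.
have amp_lb := amp0_lb (extra_at_norm j (extra0_le R)).
rewrite size_at_norm -/s -/k (gtr0_norm s0) in amp_lb.
set A := amp0 _ _ in amp_lb *.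
have p1 : 0 <= 4^-1 :> R by lra.
have p2 : 0 <= 25 / 512 :> R by lra.
have abd : 4^-1 * (25 / 512) * 4^-1 <= a * b * d.
  exact: (ler_pM (mulr_ge0 p1 p2) p1 (ler_pM p1 p2 a_lb b_lb) d_lb).
have -> : A * (a / 4 ^+ j * (N ^+ j.+1 * (b / 4 ^+ j.+1)) * (d / 4 ^+ j)) =
    A * (N ^+ j.+1 * (a * b * d) * (cell4 j * cell4 j.+1 * cell4 j)).
  by rewrite /cell4; ring.
have c4 : 0 <= cell4 j * cell4 j.+1 * cell4 j.
  by rewrite !mulr_ge0// divr_ge0// exprn_ge0.
have Nj : 0 <= N ^+ j.+1 by rewrite exprn_ge0// ltW.
have abd0 : 0 <= a * b * d.
  by apply: le_trans abd; exact: mulr_ge0 (mulr_ge0 p1 p2) p1.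
rewrite normrM (ger0_norm (mulr_ge0 (mulr_ge0 Nj abd0) c4)).
rewrite [X in _ <= X]mulrA ler_wpM2r//.
pose c : R := 4^-1 * (25 / 512) * 4^-1.
apply: (@le_trans _ _ (7 / 8 * k ^+ 3 * ((k ^+ 3) ^+ j * s) * (N ^+ j.+1 * c))).
  have -> : 7 / 8 * k ^+ 3 * ((k ^+ 3) ^+ j * s) * (N ^+ j.+1 * c) =
      7 / 8 * c * q * (s * q ^+ j).
    have -> : q ^+ j = (k ^+ 3) ^+ j * N ^+ j by rewrite -exprMn.
    by rewrite [N ^+ _]exprS /q; ring.
  have : 0 <= s * q ^+ j by rewrite mulr_ge0 ?(ltW s0)// exprn_ge0// qE exprn_ge0.
  rewrite -mulrA; move: (s * q ^+ j) => X; rewrite qE /c; lra.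
have k30 : 0 <= (k ^+ 3) ^+ j * s by rewrite mulr_ge0 ?(ltW s0)// !exprn_ge0// ltW.
rewrite ler_pM//.
- by rewrite mulr_ge0// mulr_ge0// exprn_ge0// ltW.
- by rewrite mulr_ge0// /c; lra.
- by rewrite ler_wpM2l.
Qed.

End estimates.

(** * Integrals that persist in the limit *)

Section resonance.
Variable R : realType.
Let E := 'rV[R]_3.
Let N : R := freq R.
Let k : R := kap R.
Let s : R := scale0 R.
Let q : R := k ^+ 3 * N.
Let kE : k = 256^-1. Proof. by []. Qed.
Let qE : q = 2 ^+ 13.
Proof. by rewrite /q kE /N /freq; field. Qed.

(** Stated as a vanishing of the other factor: where theta' of generation j
    is nonzero, every profile supported in the flat part of theta vanishes. *)
Lemma trep_kills j (f : nat -> R -> R) p t : cell_tower f ->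
  (forall z, 5 / 16 <= `|z| -> f p z = 0) -> trep j (@theta R) 1 t != 0 ->
  trep j f p t = 0.
Proof.
move=> cf f0; rewrite /trep mulf_eq0 negb_or => /andP[_ t0].
have := theta_kills j t (cell_tower_cellular p cf) f0 => /eqP.
by rewrite mulf_eq0 (negPf t0) orbF => /eqP ->; rewrite mulr0.
Qed.

Lemma trep_kills_finer j i (f : nat -> R -> R) p t : cell_tower f ->
  (j < i)%N -> trep j (@theta R) 1 t != 0 -> trep i f p t = 0.
Proof.
case: i => // i cf; rewrite ltnS => ji; rewrite {1}/trep mulf_eq0 negb_or => /andP[_ t0].
have cfp : cellular (f p) by exact: cell_tower_cellular.
have rE : rep i.+1 (f p) t = rep j (rep (i - j).+1 (f p)) t.
  by rewrite /rep -iterD addnS subnKC.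
have crf : cellular (rep (i - j).+1 (f p)) by exact: cellular_rep.
have f0 z : 5 / 16 <= `|z| -> rep (i - j).+1 (f p) z = 0.
  by move=> h; rewrite repS copies_out//; [exact: cellular_rep|lra].
have := theta_kills j t crf f0 => /eqP.
by rewrite mulf_eq0 (negPf t0) orbF /trep rE => /eqP ->; rewrite mulr0.
Qed.

(** Later cycles only involve x_1 through finer generations, and the second
    and third layers of the j-th cycle through gamma and beta; theta' kills
    them all. *)
Lemma approx_test j m (x : E) : (j < m)%N ->
  approx_sol m x * test_d1 j x = (approx_sol j x + layer_at j x) * test_d1 j x.
Proof.
move=> jm; have [t0|t0] := eqVneq (trep j.+1 (@theta R) 1 (x ord0 c1)) 0.
  by rewrite /test_d1 /on_coords /test_tensor t0 !(mulr0, mul0r).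
have cb := cell_beta R; have cg := cell_gamma R; have cp := cell_psi R.
congr (_ * _); rewrite /approx_sol -(addrA (base x)); congr (_ + _).
pose G i := cyc (size_at s i) (extra_at s (extra0 R) i) i 0 0 0
  (x ord0 c0) (x ord0 c1) (x ord0 c2).
have corrE n : on_coords (corr n s (extra0 R) 0 0 0) x = \sum_(0 <= i < n) G i.
  by rewrite big_mkord.
rewrite !corrE (big_cat_nat (leq0n j.+1) jm)//= big_nat_recr//=.
rewrite [X in _ + X]big_nat_cond [X in _ + X]big1 ?addr0; last first.
  move=> i /andP[/andP[ji _] _]; rewrite /G /cyc /layer0 /layer1 /layer2.
  have kill f : cell_tower f -> trep i.+1 f 0 (x ord0 c1) = 0.
    by move=> cf; apply: trep_kills_finer t0.
  by rewrite !kill// !(mulr0, mul0r) !addr0.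
congr (_ + _); rewrite /G /cyc /layer1 /layer2 (trep_kills cg _ t0); last first.
  exact: gamma_out.
rewrite (trep_kills cb _ t0) => [|z h]; last by apply: beta_out; lra.
by rewrite !(mulr0, mul0r) !addr0.
Qed.

Lemma limit_test j (x : E) :
  limit_sol x * test_d1 j x = (approx_sol j x + layer_at j x) * test_d1 j x.
Proof.
have h : approx_sol m x * test_d1 j x @[m --> \oo] --> limit_sol x * test_d1 j x.
  by apply: cvgMl; exact: approx_cvg.
rewrite -(cvg_lim (@Rhausdorff R) h); apply: cvg_lim => //.
apply: (@cvg_trans _ ((fun=> (approx_sol j x + layer_at j x) * test_d1 j x) @ \oo)).
  apply: near_eq_cvg; exists j.+1 => // m /= jm; exact/esym/approx_test.
exact: cvg_cst.
Qed.

Lemma scale0_ge1 : 1 <= s.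
Proof. have := scale0E R; rewrite -/s -/k kE; lra. Qed.

(** The two contributions are 20 and 10 times s 2^(13 j) 4^(-3 j - 1) = s
    2^(7 j) / 4, so their sum exceeds 2^(7 j). *)
Lemma resonant_integral j : exists a : R,
  [/\ j%:R <= `|a|,
      forall m, (j < m)%N ->
        has_integral (fun x => approx_sol m x * test_d1 j x) a &
      has_integral (fun x => @limit_sol R x * test_d1 j x) a].
Proof.
have [b hb _] := by_parts_approx R j j.
have [d dlb hd] := layer_part_lb R j.
have bub := smooth_part_bnd hb.
have sE x : (approx_sol j x + layer_at j x) * test_d1 j x =
    approx_sol j x * test_d1 j x + layer_at j x * test_d1 j x by rewrite mulrDl.
have bd := has_integral_add hb hd.
exists (b + d); split.
- move: dlb bub; rewrite -/s -/q -/N -/k.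
  set c := (X in _ * X <= _ -> _).
  have -> : 20 * s * q ^+ j * c = 2 * (10 * s * q ^+ j * c) by ring.
  have : j%:R <= 10 * s * q ^+ j * c.
    have X0 : 0 < 4 ^+ j :> R by rewrite exprn_gt0.
    have cE : q ^+ j * c = 4^-1 * (q / 4 ^+ 3) ^+ j.
      rewrite expr_div_n exprAC /c exprS; field.
      by rewrite gt_eqF.
    have -> : 10 * s * q ^+ j * c = 10 / 4 * s * (q / 4 ^+ 3) ^+ j.
      by rewrite -mulrA cE; ring.
    have -> : q / 4 ^+ 3 = 2 ^+ 7 by rewrite qE; field.
    have h1 : j%:R <= (2 ^+ 7) ^+ j :> R.
      rewrite -exprM -natrX ler_nat; apply: ltnW.
      apply: leq_trans (ltn_expl j (isT : (1 < 2)%N)) _.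
      by rewrite leq_exp2l// leq_pmull.
    apply: (le_trans h1); rewrite ler_peMl ?exprn_ge0//.
    have := scale0_ge1; lra.
  have := lerB_normD d b; rewrite [d + b]addrC.
  move: (10 * s * q ^+ j * c) => X; lra.
- move=> m jm; move: bd; congr has_integral; apply/funext => x.
  by rewrite (approx_test _ jm) sE.
- by move: bd; congr has_integral; apply/funext => x; rewrite limit_test sE.
Qed.

End resonance.

(** * Unbounded variation *)

Section unbounded_variation.
Variable R : realType.
Let E := 'rV[R]_3.

Lemma smooth_test_fun l j : class_C l setT (@test_fun R j).
Proof.
have ct f p (i : 'I_3) n : cell_tower f ->
    class_C l setT (fun x : E => trep n f p (x ord0 i)).
  move=> cf.
  have h := class_C_coord (k := l) (R := R) i openT.
  have h' := class_C_tower openT p (is_tower_trep n cf.1) h.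
  exact: h'.
exact: (class_C_mul openT (class_C_mul openT
  (ct _ 0%N c0 j (cell_gamma R)) (ct _ 0%N c1 j.+1 (cell_theta R)))
  (ct _ 0%N c2 j (cell_beta R))).
Qed.

Lemma is_derive_test_fun j (x : E) :
  is_derive x (delta_mx ord0 c1) (test_fun j) (test_d1 j x).
Proof.
have D := is_derive_tensor c1 (is_tower_trep j (cell_gamma R).1 0%N (x ord0 c0))
  (is_tower_trep j.+1 (cell_theta R).1 0%N (x ord0 c1))
  (is_tower_trep j (cell_beta R).1 0%N (x ord0 c2)).
refine (is_derive_eq D _).
by rewrite /test_d1 /on_coords /test_tensor/= !mul0r mul1r add0r addr0.
Qed.

Definition test_vector (a : R) j (x : E) : E :=
  (a * test_fun j x) *: delta_mx 0 c1.

Lemma test_vector_coord a j x i :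
  test_vector a j x ord0 i = a * test_fun j x * (i == c1)%:R.
Proof. by rewrite !mxE eqxx. Qed.

(** The test functions are supported in the cube of half side 5/16, whose
    closure is inside the open cube Q_0. *)
Lemma test_out j p (x : E) : ~ cbox (fun=> 5 / 16) x ->
  on_coords (test_tensor j p) x = 0.
Proof.
move=> h; apply: test_tensor_out; apply/negPn/negP.
rewrite !negb_or -!ltNge -leNgt => /and3P[h0 h1 h2]; apply: h.
by apply: I3P; lra.
Qed.

Lemma divergence_test_vector a j x :
  divergence (test_vector a j) x = a * test_d1 j x.
Proof.
rewrite /divergence (bigD1 c1)//= big1 ?addr0 => [|i /negPf ic]; rewrite /partial.
  rewrite (_ : (fun y => _) = fun y => a * test_fun j y); last first.
    by apply/funext => y; rewrite test_vector_coord eqxx mulr1.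
  exact: (@derive_val _ _ _ _ _ _ _ (is_derive_cmul a (is_derive_test_fun j x))).
rewrite (_ : (fun y => _) = cst 0) ?derive_cst//.
by apply/funext => y; rewrite test_vector_coord ic mulr0.
Qed.

Lemma test_field_test_vector (a : R) j : a ^+ 2 = 1 ->
  test_field (@Q0 R) (test_vector a j).
Proof.
move=> a1; split.
- have h : class_C 1 setT (fun x => a * test_fun j x).
    have h1 : class_C 1 setT (fun _ : E => a).
      exact: (@class_C_cst _ _ _ openT 1%N R a).
    exact: (class_C_mul openT h1 (@smooth_test_fun 1%N j)).
  exact: (class_C_scale openT _ h).
- apply: (@sub_cbox_compactly _ (fun=> 5 / 16)).
    move=> x /= x0; apply: contrapT => h; move/eqP: x0; apply.
    by rewrite /test_vector /test_fun test_out// mulr0 scale0r.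
  by move=> x h; apply/Q0_abs => i; have := h i; lra.
- move=> x; rewrite enorm_le// /sq_norm (bigD1 c1)//= big1 ?addr0; last first.
    by move=> i /negPf ic; rewrite test_vector_coord ic mulr0 expr0n.
  rewrite test_vector_coord eqxx mulr1 exprMn a1 mul1r.
  have /andP[t0 t1] := test_fun_itv j x.
  by rewrite lerXn2r// nnegrE.
Qed.

Lemma integral_off (A : set E) (f : E -> \bar R) : measurable A ->
  (forall x, ~ A x -> f x = 0%E) ->
  (\int[lebesgue3]_(x in A) f x = \int[lebesgue3]_x f x)%E.
Proof.
move=> mA f0; rewrite [LHS]integral_mkcond; congr (integral _ _ _).
apply/funext => x; rewrite patchE; case: ifPn => // /negP xA.
by rewrite f0// => h; apply: xA; exact: mem_set.
Qed.

(** The sign of a is put into the test field. *)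
Lemma variation_ge (u : E -> R) j a :
  has_integral (fun x => u x * test_d1 j x) a ->
  (`|a|%:E <= Defs.variation (@Q0 R) u)%E.
Proof.
move=> ha; pose e : R := if 0 <= a then 1 else -1.
have e2 : e ^+ 2 = 1 by rewrite /e; case: ifP; rewrite ?sqrrN expr1n.
have ea : e * a = `|a|.
  rewrite /e; case: (leP 0 a) => h; first by rewrite mul1r ger0_norm.
  by rewrite mulN1r ltr0_norm.
apply: ereal_sup_ubound; exists (test_vector e j).
  exact: test_field_test_vector.
have mQ : measurable (@Q0 R) by apply: open_measurable_rV; exact: Q0_open.
rewrite (integral_off mQ) => [|x xQ].
  have [_ hE] := has_integral_cmul e ha; rewrite -ea -hE.
  by apply: eq_integral => x _; rewrite divergence_test_vector; congr EFin; ring.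
rewrite divergence_test_vector /test_d1 test_out ?mulr0// => h; apply: xQ.
by apply/Q0_abs => i; have := h i; lra.
Qed.

Lemma limit_not_BV_loc : ~ BV_loc (eball 1) (@limit_sol R).
Proof.
move=> /(_ _ (@Q0_open R) (@Q0_compactly R))[_].
have ge j : (j%:R%:E <= Defs.variation (@Q0 R) (@limit_sol R))%E.
  have [a [ja _ ha]] := resonant_integral R j.
  by apply: le_trans (variation_ge ha); rewrite lee_fin.
case: (Defs.variation _ _) ge => [r ge _|//|ge _]; last by have := ge 0%N.
have := ge (Num.truncn r).+1; rewrite lee_fin leNgt => /negP; apply.
exact: truncnS_gt.
Qed.

Lemma enorm_gradient_measurable (u : E -> R) : class_C 1 setT u ->
  measurable_fun setT (fun x => enorm (gradient u x)).
Proof.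
move=> cu; apply: continuous_measurable_rV => // x.
have cs : class_C 0 setT (fun x : E => sq_norm (gradient u x)).
  apply: (class_C_sum openT) => i; apply: (class_C_exp openT).
  apply: (class_C_ext openT _ (class_C_partial i cu)) => y _; by rewrite mxE.
apply: (@continuous_comp _ _ _ (fun x => sq_norm (gradient u x)) Num.sqrt).
  exact: (class_C_continuous cs I).
exact: sqrt_continuous.
Qed.

Lemma partial_le_enorm (u : E -> R) i x :
  `|partial i u x| <= enorm (gradient u x).
Proof.
rewrite -sqrtr_sqr ler_wsqrtr// (bigD1 i)//= mxE lerDl.
by apply: sumr_ge0 => j _; exact: sqr_ge0.
Qed.

(** The test function takes values in [0, 1] and vanishes outside the unit
    ball. *)
Lemma gradient_norm_ge (u : E -> R) j a : class_C 1 setT u ->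
  has_integral (fun x => partial c1 u x * test_fun j x) a ->
  (`|a|%:E <= Lpnorm (eball 1) 1 (fun x => enorm (gradient u x)))%E.
Proof.
move=> cu [ai aE]; rewrite /Lpnorm Lnorm1 -[`|a|%:E]/(`|a%:E|)%E -aE.
have mB : measurable (eball 1 : set E).
  by apply: open_measurable_rV; exact: eball_open.
have mG : measurable_fun setT
    ((EFin \o (fun x => enorm (gradient u x))) \_ (eball 1 : set E)).
  apply/(measurable_restrictT _ mB); apply/measurable_EFinP.
  apply: measurable_funTS; exact: enorm_gradient_measurable.
apply: (le_trans (le_abse_integral _ measurableT (measurable_int _ ai))).
apply: ge0_le_integral => //.
- exact: measurableT_comp (measurable_int _ ai).
- exact: measurableT_comp mG.
- move=> x _; rewrite patchE; case: ifPn => [_|/negP xB]; rewrite lee_fin.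
    have /andP[t0 t1] := test_fun_itv j x.
    rewrite normrM (ger0_norm t0) (ger0_norm (sqrtr_ge0 _)).
    apply: (le_trans _ (partial_le_enorm u c1 x)).
    by rewrite ler_piMr.
  rewrite /test_fun test_out ?mulr0 ?normr0// => h; apply: xB.
  by apply/mem_set/cbox_half_sub => i; have := h i; lra.
Qed.

Lemma gradient_norm_cvg :
  Lpnorm (eball 1) 1 (fun x => enorm (gradient (@approx_sol R m) x))
    @[m --> \oo] --> +oo%E.
Proof.
apply/cvgeyPge => A; pose j := (Num.truncn A).+1.
exists j.+1 => // m /= jm.
have [a [ja ha _]] := resonant_integral R j.
have [b hb hb'] := by_parts_approx R j m.
rewrite (has_integral_unique hb (ha m jm)) in hb'.
apply: (le_trans _ (gradient_norm_ge _ hb')); last exact: smooth_approx openT m 1.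
rewrite normrN lee_fin; apply: le_trans ja; apply: ltW; exact: truncnS_gt.
Qed.

Lemma approx_sup_le1 m : (Lpnorm (eball 2) +oo (@approx_sol R m) <= 1)%E.
Proof.
rewrite /Lpnorm unlock; case: ifPn => [_|_]; last exact: lee01.
apply/ess_supP; apply: aeW => x; rewrite /= patchE; case: ifPn => [xB|_].
  by rewrite lee_fin; apply: approx_le1; exact: set_mem.
by rewrite abse0 lee01.
Qed.

End unbounded_variation.

(** * The limit coefficients *)

Section limit_coefficient.
Variable R : realType.
Let E := 'rV[R]_3.

(** The common value of the matrices from the first settled stage on, and
    the identity on the null set of points that never settle. *)
Definition limit_coef (x : E) : 'M[R]_3 :=
  if pselect (exists m, settled m x) is left h then coef_mx (sval (cid h)) x
  else 1%:M.

Lemma limit_coefE m x : settled m x -> limit_coef x = coef_mx m x.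
Proof.
move=> sm; rewrite /limit_coef; case: pselect => [h|[]]; last by exists m.
case: cid => n sn /=.
rewrite -(coef_mx_stable (leq_maxl m n) sm).
by rewrite -(coef_mx_stable (leq_maxr m n) sn).
Qed.

Lemma limit_coef_cases (P : 'M[R]_3 -> Prop) x :
  (forall m, P (coef_mx m x)) -> P 1%:M -> P (limit_coef x).
Proof. by rewrite /limit_coef; case: pselect => // h Pc _; exact: Pc. Qed.

Lemma limit_coef_diag x : exists2 d : 'rV[R]_3,
  limit_coef x = diag_mx d & forall i, 1 <= d ord0 i <= 2 ^+ 81.
Proof.
apply: (@limit_coef_cases (fun A => exists2 d : 'rV[R]_3,
    A = diag_mx d & forall i, 1 <= d ord0 i <= 2 ^+ 81)) => [m|].
  exists (\row_i coef (approx_hess m x) i); first exact: coef_mxE.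
  by move=> i; rewrite mxE; exact: coef_bnd (approx_hess_indef m x).
exists (const_mx 1); first by rewrite diag_const_mx.
by move=> i; rewrite mxE lexx exprn_ege1// ler1n.
Qed.

Lemma limit_coef_symmetric U : symmetric_on U limit_coef.
Proof.
by move=> x _; have [d -> _] := limit_coef_diag x; exact: tr_diag_mx.
Qed.

Lemma limit_coef_elliptic U : elliptic_on U 1 (2 ^+ 81) limit_coef.
Proof.
by move=> x _; have [d -> db] := limit_coef_diag x; exact: diag_elliptic.
Qed.

Lemma measurable_coef_mx m i j :
  measurable_fun setT (fun x : E => coef_mx m x i j).
Proof.
have -> : (fun x : E => coef_mx m x i j) =
    (fun x => coef (approx_hess m x) i *+ (i == j)).
  by apply/funext => x; rewrite coef_mxE !mxE.
have mc : measurable_fun setT (fun x : E => coef (approx_hess m x) i).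
  by apply: class_C_measurable => //; exact: (@smooth_coef R setT openT m 0).
by case: (i == j) => /=; [exact: mc|exact: measurable_cst].
Qed.

Lemma measurable_beta m : measurable_fun setT
  (fun x : E => trep m (@beta R) 0 (x ord0 c1)).
Proof.
apply: measurableT_comp; last exact: measurable_coord.
apply: continuous_measurable_fun; apply: tower_continuous.
exact: is_tower_trep (cell_beta R).1.
Qed.

(** Replacing the matrices at unsettled points by the identity makes them
    converge everywhere: they are constant from some stage on, or always the
    identity. *)
Lemma measurable_limit_coef i j :
  measurable_fun setT (fun x => limit_coef x i j).
Proof.
pose B m (x : E) : R := if trep m (@beta R) 0 (x ord0 c1) == 1
  then (1%:M : 'M[R]_3) i j else coef_mx m x i j.
apply: (@measurable_fun_cvg _ _ _ _ B) => [m|x _].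
  apply: measurable_fun_ifT => //; last exact: measurable_coef_mx.
  by apply: measurable_fun_eqr => //; exact: measurable_beta.
have [[m sm]|no] := pselect (exists m, settled m x).
  apply: (@cvg_trans _ ((fun=> coef_mx m x i j) @ \oo)).
    apply: near_eq_cvg; exists m => // n /= mn.
    rewrite /B (negPf (settled_leq mn sm)); by rewrite (coef_mx_stable mn sm).
  rewrite (limit_coefE sm); exact: cvg_cst.
have -> : B^~ x = cst ((1%:M : 'M[R]_3) i j).
  apply/funext => m; rewrite /B ifT//; apply/negPn/negP => h.
  by apply: no; exists m.
rewrite /limit_coef; case: pselect => [//|_]; exact: cvg_cst.
Qed.

Lemma mx_norm_le (M : 'M[R]_3) c : 0 <= c -> (forall i j, `|M i j| <= c) ->
  `|M| <= c.
Proof.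
by move=> c0 h; rewrite [leLHS]mx_normrE; apply: bigmax_le => // -[i j] _.
Qed.

Lemma measurable_mx_norm (M : E -> 'M[R]_3) :
  (forall i j, measurable_fun setT (fun x => M x i j)) ->
  measurable_fun setT (fun x => `|M x|).
Proof.
move=> mM; rewrite (_ : (fun x => _) =
    fun x => \big[Num.max/0]_ij `|M x ij.1 ij.2|); last first.
  by apply/funext => x; exact: mx_normrE.
elim: (index_enum _) => [|ij r IH].
  by under eq_fun do rewrite big_nil; exact: measurable_cst.
under eq_fun do rewrite big_cons.
by apply: measurable_maxr => //; apply: measurableT_comp.
Qed.

Let C : R := 2 * 2 ^+ 81.

(** At unsettled points beta equals 1 and both matrices are at most 2^81;
    elsewhere they agree. *)
Lemma coef_diff_bnd m x :
  `|coef_mx m x - limit_coef x| <= C * (trep m (@beta R) 0 (x ord0 c1)).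
Proof.
have cb := cell_beta R.
have t0 : 0 <= trep m (@beta R) 0 (x ord0 c1).
  by apply: trep_ge0 => // z; have [/andP[]] := beta_bnd z.
have [t1|sm] := eqVneq (trep m (@beta R) 0 (x ord0 c1)) 1; last first.
  by rewrite (limit_coefE sm) subrr normr0 mulr_ge0// /C mulr_ge0// exprn_ge0.
rewrite t1 mulr1; have D0 : 0 <= 2 ^+ 81 :> R by rewrite exprn_ge0.
have [d dE db] := limit_coef_diag x.
have entry (v : 'rV[R]_3) i j : (forall i, 1 <= v ord0 i <= 2 ^+ 81) ->
    `|diag_mx v i j| <= 2 ^+ 81.
  move=> vb; rewrite mxE; case: (i == j); last by rewrite normr0.
  have /andP[v1 v2] := vb i; rewrite ger0_norm//.
  exact: le_trans ler01 v1.
have n1 : `|coef_mx m x| <= 2 ^+ 81.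
  rewrite coef_mxE; apply: mx_norm_le => // i j; apply: entry => l.
  by rewrite mxE; exact: coef_bnd (approx_hess_indef m x).
have n2 : `|limit_coef x| <= 2 ^+ 81.
  by rewrite dE; apply: mx_norm_le => // i j; exact: entry.
apply: (le_trans (ler_normB _ _)); apply: (le_trans (lerD n1 n2)).
by rewrite /C; lra.
Qed.

(** The bound of [coef_diff_bnd] depends on x_1 alone, and the integral of
    beta of generation m is proportional to 4^-m. *)
Lemma coef_cvg_L1 : cvg_L1 (eball 2) (@coef_mx R) limit_coef.
Proof.
pose ind : R -> R := \1_(`[-2, 2]%classic).
have ind_i : (@lebesgue_measure R).-integrable setT (EFin \o ind).
  exact: integrable_indic_itv.
have ind_4 : (\int[@lebesgue_measure R]_x (ind x)%:E = 4%:E)%E.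
  rewrite integral_indic//= setIT lebesgue_measure_itv/= lte_fin ifT; last lra.
  by rewrite -EFinD; congr EFin; lra.
have cb := cell_beta R; have cbb : cellular (beta 0) := cell_tower_cellular 0 cb.
have [I hI] := ex_cell_integral (tower_continuous (p := 0%N) cb.1) cbb.
have bint m : cell_integral (trep m (@beta R) 0) (I / 4 ^+ m).
  have := cell_integral_rep m cbb hI; congr cell_integral.
  by apply/funext => y; rewrite /trep muln0 expr0 mul1r.
have Gint m : has_integral (fun x => C * on_coords
    (fun r s t => ind r * trep m (@beta R) 0 s * ind t) x)
    (C * (4 * (I / 4 ^+ m) * 4)).
  apply: has_integral_cmul.
  have [bi bE] := cellular_lebesgue
    (tower_continuous (p := 0%N) (is_tower_trep m cb.1))
    (cell_tower_cellular 0 (cell_trep m cb)) (bint m).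
  exact: lebesgue3_tensor.
have mB : measurable (eball 2 : set E).
  by apply: open_measurable_rV; exact: eball_open.
have ub m : (Lpnorm (eball 2) 1 (fun x => `|coef_mx m x - limit_coef x|%R) <=
    (C * (4 * (I / 4 ^+ m) * 4))%:E)%E.
  have [Gi <-] := Gint m; rewrite /Lpnorm Lnorm1.
  have mG : measurable_fun setT
      ((EFin \o (fun x => `|coef_mx m x - limit_coef x|)) \_ (eball 2 : set E)).
    apply/(measurable_restrictT _ mB); apply/measurable_EFinP.
    apply: measurable_funTS; apply: measurable_mx_norm => i j.
    under eq_fun do rewrite mxE [X in _ + X]mxE.
    apply: measurable_funB; first exact: measurable_coef_mx.
    exact: measurable_limit_coef.
  have tb0 t : 0 <= trep m (@beta R) 0 t.
    by apply: trep_ge0 => // z; have [/andP[]] := beta_bnd z.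
  have C0 : 0 <= C by rewrite /C mulr_ge0 ?exprn_ge0.
  have ind0 t : 0 <= ind t by rewrite /ind indicE.
  apply: ge0_le_integral => //.
  - exact: measurableT_comp mG.
  - exact: measurable_int Gi.
  - move=> x _; rewrite patchE; case: ifPn => [/set_mem xB|_]; last first.
      rewrite abse0 lee_fin; apply: (mulr_ge0 C0).
      exact: mulr_ge0 (mulr_ge0 (ind0 _) (tb0 _)) (ind0 _).
    have inb i : ind (x ord0 i) = 1.
      rewrite /ind indicE mem_set//= in_itv/= -ler_norml.
      move: xB; rewrite eball_sq_norm//= => x4.
      rewrite -(@ler_sqr _ `|_|) ?nnegrE// real_normK ?num_real//.
      apply: le_trans (ltW x4); rewrite /sq_norm (bigD1 i)//= lerDl.
      by apply: sumr_ge0 => l _; exact: sqr_ge0.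
    rewrite /= normr_id lee_fin /on_coords !inb mul1r mulr1.
    exact: coef_diff_bnd.
have g0 : (C * (4 * (I / 4 ^+ m) * 4))%:E @[m --> \oo] --> 0%E.
  apply/cvg_EFin; first exact: nearW.
  rewrite (_ : fine \o _ = geometric (16 * C * I) (4^-1)); last first.
    by apply/funext => m; rewrite /= -exprVn; ring.
  apply: cvg_geometric; rewrite ger0_norm// invf_lt1//; lra.
rewrite /cvg_L1; apply: (@squeeze_cvge _ _ _ _ (cst 0%E)) g0; last exact: cvg_cst.
by apply: nearW => m; rewrite ub andbT Lnorm_ge0.
Qed.

End limit_coefficient.

(** * The theorem *)

Theorem theorem1p2 (R : realType) :
  compactly_contained (@Q0 R) (eball 1) /\
  exists (u_ : nat -> 'rV[R]_3 -> R) (A_ : nat -> 'rV[R]_3 -> 'M[R]_3),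
    (forall m, [/\ smooth_on (eball 2) (u_ m), smooth_on (eball 2) (A_ m) &
                   symmetric_on (eball 2) (A_ m)]) /\
    [/\ (forall m, elliptic_on (eball 2) 1 (2 ^+ 81) (A_ m)),
        (forall m, solves_on (eball 2) (A_ m) (u_ m)),
        (forall m, has_dirichlet_data (eball 2)
                     (fun x => 1 - x ord0 ord0 ^+ 2 / 2) (u_ m)),
        (forall m, (Lpnorm (eball 2) +oo (u_ m) <= 1)%E) &
        Lpnorm (eball 1) 1 (fun x => enorm (gradient (u_ m) x))
          @[m --> \oo] --> +oo%E] /\
    (exists P, quadratic_polynomial P /\
       forall m x, (eball 2 `\` @Q0 R) x -> u_ m x = P x) /\
    exists (u : 'rV[R]_3 -> R) (A : 'rV[R]_3 -> 'M[R]_3),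
      [/\ measurable_fun (eball 2) A, symmetric_on (eball 2) A,
          {uniform eball 2, u_ @ \oo --> u} & cvg_L1 (eball 2) A_ A] /\
      [/\ {ae lebesgue3, forall x, eball 2 x ->
             mx_le 1%:M (A x) /\ mx_le (A x) (2 ^+ 81)%:M},
          ~ BV_loc (eball 1) u &
          L1_approximation_solution (eball 2) A u].
Proof.
have oB : open (eball 2 : set 'rV[R]_3) by exact: eball_open.
have mA : measurable_fun (eball 2) (@limit_coef R).
  apply: measurable_funTS; apply/measurable_fun_mxP => // i j.
  exact: measurable_limit_coef.
have ms := @smooth_approx R _ oB; have mS := @smooth_coef_mx R _ oB.
split; first exact: Q0_compactly.
exists (@approx_sol R), (@coef_mx R); split=> [m|].
  by split; [exact: ms|exact: mS|exact: coef_mx_symmetric].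
split.
  split=> [m|m|m|m|]; [exact: coef_mx_elliptic|exact: approx_solves|
    exact: approx_dirichlet|exact: approx_sup_le1|exact: gradient_norm_cvg].
split.
  exists (@base R); split; first exact: base_quadratic.
  by move=> m x [_ xQ]; exact: approx_off.
exists (@limit_sol R), (@limit_coef R); split.
  split; [exact: mA|exact: limit_coef_symmetric|exact: approx_uniform|].
  exact: coef_cvg_L1.
split; [|exact: limit_not_BV_loc|].
  by apply: aeW => x; exact: limit_coef_elliptic.
exists (@coef_mx R), (@approx_sol R), 1, (2 ^+ 81); split.
- exact: ltr01.
- by move=> m; split; [exact: mS|exact: coef_mx_symmetric|
    exact: coef_mx_elliptic].
- by move=> m; split; [exact: ms|exact: approx_solves].
- exact: approx_uniform.
- by split; [exact: mA|exact: coef_cvg_L1].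
Qed.
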